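(* Let $U\subseteq\mathbb R^m$ be non-empty and let $f:\mathbb R^n\times U\to\mathbb R^n$ be smooth. Assume: (i) there is a constant $L>0$ such that $|f(x,u)-f(z,u)|\le L|x-z|$ for all $x,z\in\mathbb R^n$, $u\in U$; (ii) there exist a symmetric positive definite matrix $P\in\mathbb R^{n\times n}$, a constant $q>0$ and matrices $K\in\mathbb R^{n\times k}$, $H\in\mathbb R^{k\times n}$ such that the output map is $h(x)=Hx$ for all $x\in\mathbb R^n$, and $$(z-x)'P\big(f(z,u)-f(x,u)\big)+(z-x)'PKH(z-x)\le-q|z-x|^2\quad\text{for all }x,z\in\mathbb R^n,\ u\in U.$$ Let $r>0$ and put $R:=\min\{x'Px:\ |x|=1\}$. Then for every positive integer $p$ with $Lr<p$, every $\mu>0$ and all $0<b\le B$ with $$L|H|\frac{\sqrt{|K'PPK|}}{q}\sqrt{\frac{|P|}{R}}\,B<1,$$ there exist a non-decreasing function $Q:\mathbb R_+\to\mathbb R_+$ and constants $\sigma,\Gamma>0$ such that for every partition $\pi=\{\tau_i\}_{i=0}^\infty$ of $\mathbb R_+$ with $\sup_{i\ge0}(\tau_{i+1}-\tau_i)\le B$ and $\inf_{i\ge0}(\tau_{i+1}-\tau_i)\ge b$, every $(z_0,w_0,u,v)\in\mathbb R^n\times\mathbb R^k\times L^\infty([-r,+\infty);U)\times L^\infty_{loc}(\mathbb R_+;\mathbb R^k)$, every $x_0\in C^0([-r,0];\mathbb R^n)$ and all $\xi_{i,0}\in C^0([-r,0];\mathbb R^n)$ ($i=1,\dots,p$), the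 unique solution of the system, with $\delta:=p^{-1}r$, $$\dot x(t)=f(x(t),u(t)),$$ $$\dot z(t)=f(z(t),u(t-r))+K(Hz(t)-w(t)),$$ $$\dot w(t)=Hf(z(t),u(t-r)),\quad t\in[\tau_i,\tau_{i+1}),\qquad w(\tau_{i+1})=Hx(\tau_{i+1}-r)+v(\tau_{i+1}),$$ $$\dot\xi_1(t)=f(\xi_1(t),u(t-r+\delta))-f(\xi_1(t-\delta),u(t-r))+\dot z(t)-\mu\left(\xi_1(t)-z(t)-\int_{t-\delta}^t f(\xi_1(s),u(s-r+\delta))\,ds\right),$$ $$\dot\xi_i(t)=f(\xi_i(t),u(t-r+i\delta))-f(\xi_i(t-\delta),u(t-r+(i-1)\delta))+\dot\xi_{i-1}(t)-\mu\left(\xi_i(t)-\xi_{i-1}(t)-\int_{t-\delta}^t f(\xi_i(s),u(s-r+i\delta))\,ds\right),\quad i=2,\dots,p,$$ with initial condition $x(\theta)=x_0(\theta)$, $\xi_i(\theta)=\xi_{i,0}(\theta)$ for $\theta\in[-r,0]$ ($i=1,\dots,p$) and $(z(0),w(0))=(z_0,w_0)$, is defined for all $t\ge0$ and satisfies, for all $t\ge0$, $$|\xi_p(t)-x(t)|\le e^{-\sigma t}Q\left(\|x_0\|+\sum_{i=1}^p\|\xi_{i,0}\|+\|u\|+|z_0|+|w_0|+\sup_{0\le s\le t}|v(s)|\right)+\Gamma\sup_{0\le s\le t}\left(e^{-\sigma(t-s)}|v(s)|\right).$$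
   Context: $\mathbb R_+=[0,+\infty)$; $|\cdot|$ is the Euclidean norm of a vector or the induced (spectral) norm of a matrix; $'$ denotes transpose. A partition of $\mathbb R_+$ is a set $\{\tau_i\}_{i=0}^\infty$ with $\tau_0=0$, $\tau_{i+1}>\tau_i$ for all $i\ge 0$ and $\lim_{i\to+\infty}\tau_i=+\infty$. $L^\infty(I;U)$ (resp. $L^\infty_{loc}(I;U)$) is the space of Lebesgue measurable, essentially bounded (resp. locally essentially bounded) functions $I\to U$; $\|u\|$ is the essential supremum of $|u|$ on $[-r,+\infty)$; $\|\cdot\|$ is the sup norm on $C^0([-r,0];\mathbb R^n)$. Differential equations hold for almost every $t\ge0$; on $[-r,0]$ the functions $x,\xi_i$ equal the prescribed initial functions. The input $v$ (measurement error) is a function with pointwise values, suprema of $|v|$ are pointwise suprema, and a bound with infinite supremum is vacuous.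
   Formalization: Smoothness of f on R^n×U is read as: f is the restriction to R^n×U of a C^∞ map on R^n×R^m; for non-closed U, smoothness on R^n×U alone does not suffice (e.g. U=(0,1], f(x,u)=-x+1/u, where solutions may fail to exist). *)

(* Defs.v *)
From HB Require Import structures.
From mathcomp Require Import all_boot all_order all_algebra.
From mathcomp Require Import all_classical all_reals all_analysis ess_sup_inf.

Set Implicit Arguments.
Unset Strict Implicit.
Unset Printing Implicit Defensive.

Import Order.TTheory GRing.Theory Num.Theory.
Import numFieldNormedType.Exports.

Local Open Scope classical_set_scope.
Local Open Scope ring_scope.

(* The library norm `|x| on matrices is the entrywise sup norm, hence the
   explicit Euclidean norm. *)
Definition enorm (R : realType) (n : nat) (x : 'cV[R]_n) : R :=
  Num.sqrt (\sum_(i < n) x i 0 ^+ 2).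

Definition opnorm (R : realType) (m n : nat) (A : 'M[R]_(m, n)) : R :=
  sup [set enorm (A *m x) | x in [set x : 'cV[R]_n | enorm x <= 1]].

Definition bilin (R : realType) (n : nat) (P : 'M[R]_n) (x y : 'cV[R]_n) : R :=
  (x^T *m P *m y) 0 0.

Definition sym_posdef (R : realType) (n : nat) (P : 'M[R]_n) : Prop :=
  P^T = P /\ forall x : 'cV[R]_n, x != 0 -> 0 < bilin P x x.

(* For n > 0 the unit sphere is compact and non-empty, so this infimum is the
   minimum of x'Px over it. *)
Definition min_sphere (R : realType) (n : nat) (P : 'M[R]_n) : R :=
  inf [set bilin P x x | x in [set x : 'cV[R]_n | enorm x = 1]].

(* In finite dimension, existence and continuity of all iterated directional
   derivatives up to order k is the usual notion of class C^k. *)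
Fixpoint class_C (R : realType) (V W : normedModType R) (k : nat)
    (F : V -> W) : Prop :=
  continuous F /\
  if k is k'.+1 then
    forall v : V, (forall a, derivable F a v) /\ class_C k' (fun a => 'D_v F a)
  else True.

(* Smoothness on a set that need not be open: F is the restriction to D of a
   C^oo map of the ambient space. *)
Definition smooth_on (R : realType) (V W : normedModType R) (D : set V)
    (F : V -> W) : Prop :=
  exists2 G : V -> W, (forall k, class_C k G) & (forall a, D a -> F a = G a).

(* Measurability with respect to the completed (Lebesgue) sigma-algebra, which
   is larger than the Borel one that the library puts on R. *)
Definition lebesgue_measurable_fun (R : realType) (n : nat) (D : set R)
    (g : R -> 'cV[R]_n) : Prop :=
  forall j : 'I_n,
    measurable_fun
      (D : set (caratheodory_type (@wlength R idfun)^*%mu))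
      (fun t => g t j 0).

Definition Linfty (R : realType) (m : nat) (D : set R) (U : set 'cV[R]_m)
    (u : R -> 'cV[R]_m) : Prop :=
  [/\ (forall t, D t -> U (u t)),
      lebesgue_measurable_fun D u &
      exists M : R, {ae lebesgue_measure, forall t, D t -> enorm (u t) <= M}].

Definition Linfty_loc (R : realType) (m : nat) (D : set R) (U : set 'cV[R]_m)
    (u : R -> 'cV[R]_m) : Prop :=
  [/\ (forall t, D t -> U (u t)),
      lebesgue_measurable_fun D u &
      forall C : set R, compact C -> C `<=` D ->
        exists M : R,
          {ae lebesgue_measure, forall t, C t -> enorm (u t) <= M}].

(* Extending |u| by 0 outside D does not change its essential supremum. *)
Definition Linfty_norm (R : realType) (m : nat) (D : set R)
    (u : R -> 'cV[R]_m) : R :=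
  fine (ess_sup lebesgue_measure
          (fun t => if t \in D then (enorm (u t))%:E else 0%E)).

Definition sup_norm (R : realType) (m : nat) (D : set R)
    (g : R -> 'cV[R]_m) : R :=
  sup [set enorm (g t) | t in D].

Definition vec_integral (R : realType) (n : nat) (a b : R)
    (g : R -> 'cV[R]_n) : 'cV[R]_n :=
  \col_(j < n) \int[@completed_lebesgue_measure R]_(s in `[a, b]) (g s j 0).

(* The finitely many non-overlapping intervals are listed in increasing
   order. *)
Definition abs_cont (R : realType) (n : nat) (a b : R)
    (g : R -> 'cV[R]_n) : Prop :=
  forall e : R, 0 < e -> exists2 d : R, 0 < d &
    forall (N : nat) (l h : 'I_N -> R),
      (forall i, [/\ a <= l i, l i <= h i & h i <= b]) ->
      (forall i j : 'I_N, (i < j)%N -> h i <= l j) ->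
      \sum_(i < N) (h i - l i) < d ->
      \sum_(i < N) enorm (g (h i) - g (l i)) < e.

(* Local absolute continuity on [a, T). *)
Definition loc_abs_cont (R : realType) (n : nat) (a : R) (T : \bar R)
    (g : R -> 'cV[R]_n) : Prop :=
  forall c : R, a <= c -> (c%:E < T)%E -> abs_cont a c g.

Definition is_partition (R : realType) (tau : nat -> R) : Prop :=
  [/\ tau 0%N = 0, (forall i, tau i < tau i.+1) & tau @ \oo --> +oo].

Section system.
Context (R : realType) (n m k : nat).
Context (f : 'cV[R]_n -> 'cV[R]_m -> 'cV[R]_n).
Context (K : 'M[R]_(n, k)) (H : 'M[R]_(k, n)).
Context (r : R) (p : nat) (mu : R).
Context (tau : nat -> R).
Context (z0 : 'cV[R]_n) (w0 : 'cV[R]_k) (u : R -> 'cV[R]_m) (v : R -> 'cV[R]_k).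
Context (x0 : R -> 'cV[R]_n) (xi0 : nat -> R -> 'cV[R]_n).

(* Right-hand side of the i-th predictor; prev is its predecessor in the chain
   (z for i = 1, xi_{i-1} for i >= 2). *)
Definition predictor_rhs (i : nat) (prev xii : R -> 'cV[R]_n) (t : R) :
    'cV[R]_n :=
  let delta := p%:R^-1 * r in
  f (xii t) (u (t - r + i%:R * delta))
  - f (xii (t - delta)) (u (t - r + (i%:R - 1) * delta))
  + derive1 prev t
  - mu *: (xii t - prev t
           - vec_integral (t - delta) t
               (fun s => f (xii s) (u (s - r + i%:R * delta)))).

(* x and xi_i are considered on [-r, T), z and w on [0, T); only xi_1, ...,
   xi_p are relevant in the family xi. *)
Definition is_solution (T : \bar R) (x z : R -> 'cV[R]_n) (w : R -> 'cV[R]_k)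
    (xi : nat -> R -> 'cV[R]_n) : Prop :=
  [/\ [/\ (forall th, - r <= th <= 0 -> x th = x0 th),
          (forall i, (1 <= i <= p)%N ->
             forall th, - r <= th <= 0 -> xi i th = xi0 i th),
          z 0 = z0 & w 0 = w0],
      [/\ loc_abs_cont 0 T x, loc_abs_cont 0 T z,
          (forall i, loc_abs_cont (tau i) (mine (tau i.+1)%:E T) w) &
          (forall i, (1 <= i <= p)%N -> loc_abs_cont 0 T (xi i))],
      [/\ {ae lebesgue_measure, forall t : R, 0 <= t -> (t%:E < T)%E ->
             is_derive t 1 x (f (x t) (u t))},
          {ae lebesgue_measure, forall t : R, 0 <= t -> (t%:E < T)%E ->
             is_derive t 1 z (f (z t) (u (t - r)) + K *m (H *m z t - w t))} &
          {ae lebesgue_measure, forall t : R, 0 <= t -> (t%:E < T)%E ->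
             is_derive t 1 w (H *m f (z t) (u (t - r)))}],
      (forall i, ((tau i.+1)%:E < T)%E ->
         w (tau i.+1) = H *m x (tau i.+1 - r) + v (tau i.+1)) &
      (forall i, (1 <= i <= p)%N ->
         {ae lebesgue_measure, forall t : R, 0 <= t -> (t%:E < T)%E ->
            is_derive t 1 (xi i)
              (predictor_rhs i (if i == 1%N then z else xi i.-1) (xi i) t)})].

Definition agree_before (T : \bar R) (x z : R -> 'cV[R]_n) (w : R -> 'cV[R]_k)
    (xi : nat -> R -> 'cV[R]_n) (x' z' : R -> 'cV[R]_n) (w' : R -> 'cV[R]_k)
    (xi' : nat -> R -> 'cV[R]_n) : Prop :=
  forall t : R, 0 <= t -> (t%:E < T)%E ->
    [/\ x' t = x t, z' t = z t, w' t = w t &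
        forall i, (1 <= i <= p)%N -> xi' i t = xi i t].

(* (x, z, w, xi) is defined for all t >= 0, and every solution on an interval
   [0, T), 0 < T <= +oo, is a restriction of it. *)
Definition is_unique_global_solution (x z : R -> 'cV[R]_n) (w : R -> 'cV[R]_k)
    (xi : nat -> R -> 'cV[R]_n) : Prop :=
  is_solution +oo%E x z w xi /\
  forall (T : \bar R) x' z' w' xi', (0 < T)%E -> is_solution T x' z' w' xi' ->
    agree_before T x z w xi x' z' w' xi'.

End system.

(* Main.v *)
Require Import Defs.
From mathcomp Require Import all_boot all_order all_algebra.
From mathcomp Require Import all_classical all_reals all_analysis.
From mathcomp Require Import measurable_realfun ess_sup_inf.
From mathcomp Require Import ring lra.

Import Order.TTheory GRing.Theory Num.Theory.
Import numFieldNormedType.Exports.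

Local Open Scope classical_set_scope.
Local Open Scope ring_scope.

Set Implicit Arguments.
Unset Strict Implicit.
Unset Printing Implicit Defensive.

(* The observer error z(t) - x(t - r) and the errors xi_i(t) - x(t - r + i delta)
   form a cascade. For the observer, (z - x)' P (z - x) decays up to the
   mismatch w - H x(t - r), which between two samples drifts by at most B L |H|
   times the supremum of the observer error itself; measured with the weight
   exp(sigma t), the hypothesis on B is a small-gain condition that survives for
   small sigma > 0. For the predictors, integrating the equation of xi_i shows
   that xi_i - xi_{i-1} - int_{t-delta}^t f(xi_i, u) is a multiple of exp(-mu t);
   for the true state the same expression vanishes, so the weighted error is
   multiplied by at most L delta exp(sigma delta) < 1 and inherits the decay of
   its predecessor. Both arguments concern late times only; on a bounded initial
   interval Gronwall's inequality gives linear bounds.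

   Every equation is an integral equation with causal right-hand side, solved
   by Picard iteration after the input has been replaced by a bounded Borel
   function equal to it almost everywhere. *)

(** The small-gain steps need a supremum that is known to be finite. They are run on [r, t1] for a
    fixed horizon t1, where the weighted error attains its maximum E, so that E <= c + theta E can
    be solved for E. The factors do not depend on t1; at the end t1 = t, which is why v enters only
    through its values on [0, t]. The rate sigma is found by continuity, both contraction factors
    being below 1 at sigma = 0. Q has to be uniform in the data, but f(0, u) need not grow linearly
    in |u|. With s the argument of Q and Fb a non-decreasing bound of f(0, .) on balls, all early
    estimates are linear in N = s + Fb s, whence Q(s) = Cc (s + Fb s). The obstacle in the chain is
    the derivative of the predecessor in the equation of xi_i: it exists almost everywhere only, and
    no bound for it is at hand. Existence, growth and decay therefore rest on the integrated
    equation, in which xi_{i-1} itself appears; the differential form serves uniqueness, where that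
    derivative cancels. *)

Section Euclidean_norm.
Context {R : realType}.

(** * Euclidean norm, spectral norm and quadratic forms *)

Lemma sqr_le_imp_le (a b : R) : 0 <= b -> a ^+ 2 <= b ^+ 2 -> a <= b.
Proof.
move=> b0 ab; have [a0|/ltW a0] := lerP 0 a; last exact: le_trans b0.
by rewrite -(ler_pXn2r (n := 2)).
Qed.

Lemma enorm_ge0 n (x : 'cV[R]_n) : 0 <= enorm x.
Proof. exact: sqrtr_ge0. Qed.

Lemma enorm_sqr n (x : 'cV[R]_n) : enorm x ^+ 2 = \sum_(i < n) x i 0 ^+ 2.
Proof. by rewrite sqr_sqrtr // sumr_ge0 // => i _; rewrite sqr_ge0. Qed.

Lemma enorm0 n : enorm (0 : 'cV[R]_n) = 0.
Proof.
rewrite /enorm big1 ?sqrtr0 // => i _.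
by rewrite mxE expr0n.
Qed.

Lemma enormZ n a (x : 'cV[R]_n) : enorm (a *: x) = `|a| * enorm x.
Proof.
rewrite /enorm -sqrtr_sqr -sqrtrM ?sqr_ge0 //; congr Num.sqrt.
by rewrite mulr_sumr; apply: eq_bigr => i _; rewrite mxE exprMn.
Qed.

Lemma enormN n (x : 'cV[R]_n) : enorm (- x) = enorm x.
Proof. by rewrite -scaleN1r enormZ normrN1 mul1r. Qed.

Lemma enormB n (x y : 'cV[R]_n) : enorm (x - y) = enorm (y - x).
Proof. by rewrite -enormN opprB. Qed.

Lemma coord_le_enorm n (x : 'cV[R]_n) i : `|x i 0| <= enorm x.
Proof.
apply: sqr_le_imp_le; first exact: enorm_ge0.
rewrite enorm_sqr real_normK ?num_real // (bigD1 i) //= lerDl.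
by apply: sumr_ge0 => j _; rewrite sqr_ge0.
Qed.

Lemma enorm_eq0 n (x : 'cV[R]_n) : enorm x <= 0 -> x = 0.
Proof.
move=> x0; apply/matrixP => i j; rewrite ord1 mxE; apply/eqP.
by rewrite -normr_le0 (le_trans (coord_le_enorm x i)).
Qed.

(** Lagrange's identity: twice the difference of the two sides is the sum over all i, j of (a_i b_j
    - a_j b_i)^2. *)
Lemma cauchy_schwarz_sum n (a b : 'I_n -> R) :
  (\sum_i a i * b i) ^+ 2 <= (\sum_i a i ^+ 2) * (\sum_i b i ^+ 2).
Proof.
have : 0 <= \sum_i \sum_j (a i * b j - a j * b i) ^+ 2.
  by apply: sumr_ge0 => i _; apply: sumr_ge0 => j _; rewrite sqr_ge0.
have -> : \sum_i \sum_j (a i * b j - a j * b i) ^+ 2 =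
  2 * ((\sum_i a i ^+ 2) * (\sum_i b i ^+ 2) - (\sum_i a i * b i) ^+ 2).
  under eq_bigr do under eq_bigr do rewrite sqrrB.
  under eq_bigr do rewrite big_split sumrB /=.
  rewrite big_split sumrB /=.
  have E1 : \sum_i \sum_j (a i * b j) ^+ 2 = (\sum_i a i ^+ 2) * (\sum_i b i ^+ 2).
    rewrite mulr_suml; apply: eq_bigr => i _; rewrite mulr_sumr.
    by apply: eq_bigr => j _; rewrite exprMn.
  have E2 : \sum_i \sum_j (a j * b i) ^+ 2 = (\sum_i a i ^+ 2) * (\sum_i b i ^+ 2).
    by rewrite exchange_big.
  have E3 : \sum_i \sum_j (a i * b j * (a j * b i) *+ 2) =
     2 * (\sum_i a i * b i) ^+ 2.
    rewrite expr2 mulr_suml mulr_sumr; apply: eq_bigr => i _.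
    rewrite mulr_sumr mulr_sumr; apply: eq_bigr => j _.
    by rewrite mulr2n; ring.
  rewrite E1 E2 E3; ring.
by rewrite pmulr_rge0 // subr_ge0.
Qed.

Lemma dot_le n (x y : 'cV[R]_n) :
  `|\sum_i x i 0 * y i 0| <= enorm x * enorm y.
Proof.
apply: sqr_le_imp_le; first by rewrite mulr_ge0 ?enorm_ge0.
rewrite real_normK ?num_real // exprMn !enorm_sqr.
exact: cauchy_schwarz_sum.
Qed.

Lemma enormD n (x y : 'cV[R]_n) : enorm (x + y) <= enorm x + enorm y.
Proof.
apply: sqr_le_imp_le; first by rewrite addr_ge0 ?enorm_ge0.
rewrite sqrrD !enorm_sqr.
under eq_bigr do rewrite mxE sqrrD.
rewrite big_split /= big_split /= sumrMnl lerD2r lerD2l lerMn2r /=.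
exact: le_trans (ler_norm _) (dot_le x y).
Qed.

Lemma enorm_distl n (x y : 'cV[R]_n) : enorm x <= enorm y + enorm (x - y).
Proof. by rewrite -{1}(subrK y x) addrC (le_trans (enormD _ _)). Qed.

Lemma enorm_triangle n (x y z : 'cV[R]_n) :
  enorm (x - z) <= enorm (x - y) + enorm (y - z).
Proof. by have := enormD (x - y) (y - z); rewrite addrA subrK. Qed.

Lemma enorm_le_sum n (x : 'cV[R]_n) : enorm x <= \sum_i `|x i 0|.
Proof.
apply: sqr_le_imp_le; first by rewrite sumr_ge0.
rewrite enorm_sqr expr2 mulr_suml; apply: ler_sum => i _.
rewrite (bigD1 i) //= mulrDr -normrM -expr2 ger0_norm ?sqr_ge0 // lerDl.
by rewrite mulr_ge0 // sumr_ge0.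
Qed.

Lemma norm_le_enorm n (x : 'cV[R]_n) : `|x| <= enorm x.
Proof.
rewrite [leLHS]/Num.Def.normr/= mx_normrE bigmax_le ?enorm_ge0 // => -[i j] _ /=.
by rewrite ord1; exact: coord_le_enorm.
Qed.

Lemma enorm_le_norm n (x : 'cV[R]_n) : enorm x <= n%:R * `|x|.
Proof.
apply: (le_trans (enorm_le_sum x)).
rewrite mulr_natl -[n in _ *+ n]card_ord -sumr_const; apply: ler_sum => i _.
rewrite [leRHS]/Num.Def.normr/= mx_normrE.
exact: (le_bigmax _ (fun i : 'I_n * 'I_1 => `|x i.1 i.2|) (i, 0)).
Qed.

(** Coordinates of a vector of the unit ball are at most 1 in modulus, so the sum of the moduli of
    all entries is a bound. This is what makes the [sup] in [opnorm] meaningful. *)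
Lemma opnorm_has_sup m n (A : 'M[R]_(m, n)) :
  has_sup [set enorm (A *m x) | x in [set x : 'cV[R]_n | enorm x <= 1]].
Proof.
split; first by exists (enorm (A *m 0)), 0 => //=; rewrite enorm0 ler01.
exists (\sum_i \sum_j `|A i j|) => _ /= [x x1 <-].
apply: (le_trans (enorm_le_sum _)); apply: ler_sum => i _; rewrite mxE.
apply: (le_trans (ler_norm_sum _ _ _)); apply: ler_sum => j _.
rewrite normrM ler_piMr //.
exact: le_trans (coord_le_enorm _ _) x1.
Qed.

Lemma opnorm_ge0 m n (A : 'M[R]_(m, n)) : 0 <= opnorm A.
Proof.
apply: (le_trans (enorm_ge0 (A *m 0))).
apply: (ub_le_sup (proj2 (opnorm_has_sup A))).
by exists 0 => //=; rewrite enorm0 ler01.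
Qed.

Lemma enorm_mulmx m n (A : 'M[R]_(m, n)) x : enorm (A *m x) <= opnorm A * enorm x.
Proof.
have [x0|x0] := lerP (enorm x) 0.
  by rewrite (enorm_eq0 x0) mulmx0 !enorm0 mulr0.
rewrite -ler_pdivrMr //.
have -> : enorm (A *m x) / enorm x = enorm (A *m ((enorm x)^-1 *: x)).
  by rewrite -scalemxAr enormZ ger0_norm ?invr_ge0 ?enorm_ge0 // mulrC.
apply: (ub_le_sup (proj2 (opnorm_has_sup A))); exists ((enorm x)^-1 *: x) => //=.
by rewrite enormZ ger0_norm ?invr_ge0 ?enorm_ge0 // mulVf // gt_eqF.
Qed.

Lemma bilinE n (P : 'M[R]_n) x y : bilin P x y = \sum_i x i 0 * (P *m y) i 0.
Proof.
by rewrite /bilin -mulmxA mxE; apply: eq_bigr => i _; rewrite mxE.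
Qed.

Lemma bilin_le n (P : 'M[R]_n) x y : `|bilin P x y| <= enorm x * enorm (P *m y).
Proof. by rewrite bilinE dot_le. Qed.

Lemma bilin_le_opnorm n (P : 'M[R]_n) x : bilin P x x <= opnorm P * enorm x ^+ 2.
Proof.
apply: (le_trans (ler_norm _)); apply: (le_trans (bilin_le _ _ _)).
rewrite mulrC expr2 mulrA ler_wpM2r ?enorm_ge0 //; exact: enorm_mulmx.
Qed.

Lemma bilinDr n (P : 'M[R]_n) x y z : bilin P x (y + z) = bilin P x y + bilin P x z.
Proof. by rewrite /bilin mulmxDr mxE. Qed.

Lemma bilinDl n (P : 'M[R]_n) x y z : bilin P (x + y) z = bilin P x z + bilin P y z.
Proof. by rewrite /bilin linearD !mulmxDl mxE. Qed.

Lemma bilinNr n (P : 'M[R]_n) x y : bilin P x (- y) = - bilin P x y.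
Proof. by rewrite /bilin mulmxN mxE. Qed.

Lemma bilinNl n (P : 'M[R]_n) x y : bilin P (- x) y = - bilin P x y.
Proof. by rewrite /bilin linearN !mulNmx mxE. Qed.

Lemma bilinZr n (P : 'M[R]_n) a x y : bilin P x (a *: y) = a * bilin P x y.
Proof. by rewrite /bilin -scalemxAr mxE. Qed.

Lemma bilinZl n (P : 'M[R]_n) a x y : bilin P (a *: x) y = a * bilin P x y.
Proof. by rewrite /bilin linearZ /= -!scalemxAl mxE. Qed.

Lemma bilinC n (P : 'M[R]_n) x y : P^T = P -> bilin P x y = bilin P y x.
Proof.
move=> sP; rewrite /bilin -[in RHS]sP.
by rewrite -[in RHS](trmxK x) -!trmx_mul [RHS]mxE mulmxA.
Qed.

Lemma enorm_sqr_mulmx m n (A : 'M[R]_(m, n)) x :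
  enorm (A *m x) ^+ 2 = bilin (A^T *m A) x x.
Proof.
rewrite enorm_sqr /bilin -mulmxA -mulmxA mulmxA -trmx_mul mxE.
by apply: eq_bigr => i _; rewrite !mxE expr2.
Qed.

(** |PKy|^2 is the quadratic form of K'PPK at y. This is where the constant sqrt |K'PPK| of the gain
    condition comes from. *)
Lemma enorm_PK n k (P : 'M[R]_n) (K : 'M[R]_(n, k)) y : P^T = P ->
  enorm (P *m K *m y) <= Num.sqrt (opnorm (K^T *m P *m P *m K)) * enorm y.
Proof.
move=> sP; apply: sqr_le_imp_le.
  by rewrite mulr_ge0 ?enorm_ge0 ?sqrtr_ge0.
rewrite [leRHS]exprMn [X in _ <= X * _]sqr_sqrtr ?opnorm_ge0 // enorm_sqr_mulmx trmx_mul sP !mulmxA.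
exact: bilin_le_opnorm.
Qed.

End Euclidean_norm.

(** * Growth inequalities from derivatives that exist almost everywhere *)

Section Gauge.
Context {R : realType}.
Notation mu := (@lebesgue_measure R).

(** Real induction: the points x with P a x have a supremum; local validity there, glued to a nearby
    member of the set, shows that the supremum belongs to the set and cannot lie below b. *)
Lemma cousin (P : R -> R -> Prop) (a b : R) : a <= b ->
  (forall t, a <= t <= b -> exists2 d, 0 < d &
    forall l h, a <= l -> l <= t -> t <= h -> h <= b -> t - d < l -> h < t + d ->
    P l h) ->
  (forall l m h, a <= l -> l <= m -> m <= h -> h <= b -> P l m -> P m h -> P l h) ->
  P a b.
Proof.
move=> ab loc add.
pose S := [set x | a <= x <= b /\ P a x].
have Sa : S a.
  split; first by rewrite lexx.
  have [|d d0 dP] := loc a; first by rewrite lexx.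
  by apply: dP => //; lra.
have ubS : ubound S b by move=> x [/andP[]].
have supS : has_sup S by split; [exists a|exists b].
have as_ : a <= sup S by apply: (ub_le_sup (proj2 supS)).
have sb : sup S <= b by apply: ge_sup => //; exists a.
have [|d d0 dP] := loc (sup S); first by rewrite as_ sb.
have [x Sx xs] := sup_adherent d0 supS.
have xles : x <= sup S by apply: (ub_le_sup (proj2 supS)).
case: Sx => /andP[ax xb] Pax.
pose y := Num.min b (sup S + d / 2).
have yb : y <= b by rewrite ge_min lexx.
have sy : sup S <= y by rewrite le_min sb /=; lra.
have ysd : y < sup S + d by rewrite gt_min; apply/orP; right; lra.
have Pay : P a y.
  apply: (add a x y) => //; first exact: le_trans xles sy.
  exact: dP.
have ys : y <= sup S.
  by apply: (ub_le_sup (proj2 supS)); split=> //; rewrite yb andbT (le_trans as_).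
have yE : y = b.
  move: ys; rewrite /y /Num.min; case: ltP => // _; lra.
by rewrite -yE.
Qed.

(** Absolute continuity of an interval function, required from above only: D may take very negative
    values. Finite families are lists, so that families over adjacent intervals can be
    concatenated. *)
Definition gauge_ac (a b : R) (D : R -> R -> R) :=
  forall e, 0 < e -> exists2 d, 0 < d & forall s : seq (R * R),
    all (fun p => [&& a <= p.1, p.1 <= p.2 & p.2 <= b]) s ->
    pairwise (fun p q => p.2 <= q.1) s ->
    \sum_(p <- s) (p.2 - p.1) < d -> \sum_(p <- s) D p.1 p.2 <= e.

Lemma negligible_set1 (c : R) : mu.-negligible [set c].
Proof. by exists [set c]; split => //; rewrite lebesgue_measure_set1. Qed.

(* Replaces Vitali coverings: by Cousin's lemma [a, b] splits into small
   intervals whose tags are either good points or points of an open set of small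
   measure containing the exceptional null set, where [gauge_ac] applies. *)
Lemma gauge_le0 (a b : R) (D : R -> R -> R) : a <= b ->
  (forall l m h, a <= l -> l <= m -> m <= h -> h <= b ->
     D l h <= D l m + D m h) ->
  gauge_ac a b D ->
  {ae mu, forall t, a < t < b -> forall e, 0 < e -> exists2 d, 0 < d &
    forall l h, a <= l -> l <= t -> t <= h -> h <= b -> t - d < l -> h < t + d ->
    D l h <= e * (h - l)} ->
  D a b <= 0.
Proof.
move=> ab Dsub Dac Dae.
suff H e : 0 < e -> D a b <= e * (b - a) + e.
  apply/ler_addgt0Pl => e e0; rewrite addr0.
  have ba0 : 0 < b - a + 1 by lra.
  have := H (e / (b - a + 1)) (divr_gt0 e0 ba0).
  rewrite -{2}(mulr1 (e / _)) -mulrDr mulfVK //; exact: lt0r_neq0.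
move=> e0; have [d d0 dac] := Dac e e0.
pose N := [set t | a <= t <= b] `&` ~` [set t | forall e, 0 < e -> exists2 d, 0 < d &
    forall l h, a <= l -> l <= t -> t <= h -> h <= b -> t - d < l -> h < t + d ->
    D l h <= e * (h - l)].
have negN : mu.-negligible N.
  apply: (negligibleS _ (negligibleU (negligibleU (negligible_set1 a) (negligible_set1 b)) Dae)).
  move=> t [/andP[]]; rewrite le_eqVlt => /predU1P[-> _ _|at_]; first by left; left.
  rewrite le_eqVlt => /predU1P[-> _|tb]; first by left; right.
  by move=> nt; right => /= H; apply: nt; apply: H; rewrite at_.
have d20 : 0 < d / 2 by lra.
have [U [oU NU muU]] := outer_measure_open_le N d20.
rewrite ((negligible_outer_measure N).1 negN) add0e in muU.
have mU : measurable U by exact: open_measurable.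
(* The list s collects the pieces tagged in N. Their total length is controlled by the measure of U
   on [l, h[, taken half-open so that adjacent intervals contribute disjoint sets. Good tags account
   for the term e (h - l). *)
pose P l h := exists s : seq (R * R),
  [/\ all (fun p => [&& l <= p.1, p.1 <= p.2 & p.2 <= h]) s,
      pairwise (fun p q => p.2 <= q.1) s,
      ((\sum_(p <- s) (p.2 - p.1))%:E <= mu (U `&` `[l, h[))%E &
      D l h <= e * (h - l) + \sum_(p <- s) D p.1 p.2].
have : P a b.
  apply: cousin => //.
  - move=> t tab; have [Nt|Nt] := pselect (N t).
      have /nbhs_ballP[r /= r0 rU] : nbhs t U by apply: open_nbhs_nbhs; split => //; exact: NU.
      exists r => // l h al lt th hb tl ht.
      exists [:: (l, h)]; split => //=.
      + by rewrite !lexx (le_trans lt th).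
      + rewrite big_seq1 setIidr; last first.
          move=> x /=; rewrite in_itv/= => /andP[lx xh]; apply: rU.
          rewrite /ball/= ltr_norml; apply/andP; split; lra.
        rewrite lebesgue_measure_itv/= lte_fin; case: ifPn => // .
        by rewrite -leNgt lee_fin => hl; lra.
      + by rewrite big_seq1 lerDr mulr_ge0 ?(ltW e0) // subr_ge0 (le_trans lt th).
    have {Nt}: forall e, 0 < e -> exists2 d, 0 < d &
      forall l h, a <= l -> l <= t -> t <= h -> h <= b -> t - d < l -> h < t + d ->
      D l h <= e * (h - l).
      by apply: contrapT => nt; apply: Nt; split.
    move=> /(_ e e0)[r r0 rP]; exists r => // l h al lt th hb tl ht.
    by exists [::]; split; rewrite ?big_nil ?addr0 //; exact: rP.
  - move=> l m h al lm mh hb [s1 [as1 ps1 ls1 D1]] [s2 [as2 ps2 ls2 D2]].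
    exists (s1 ++ s2); split.
    + rewrite all_cat; apply/andP; split; [apply: sub_all as1|apply: sub_all as2] => p /=.
        by move=> /and3P[-> -> /le_trans->].
      by move=> /and3P[/(le_trans lm) -> -> ->].
    + rewrite pairwise_cat ps1 ps2 !andbT; apply/allrelP => p q.
      move=> /(allP as1) /and3P[_ _ pm] /(allP as2) /and3P[mq _ _].
      exact: le_trans mq.
    + rewrite big_cat /= EFinD.
      have -> : U `&` `[l, h[ = (U `&` `[l, m[) `|` (U `&` `[m, h[).
        rewrite -setIUr; congr (_ `&` _); apply/seteqP; split => x /=; rewrite !in_itv/=.
          by move=> /andP[-> ->]; rewrite andbT /=; case: (ltP x m); [left|right].
        move=> [/andP[-> xm]|/andP[mx ->]]; first exact: lt_le_trans mh.
        by rewrite (le_trans lm).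
      rewrite measureU ?leeD //; [exact: measurableI|exact: measurableI|].
      rewrite -setIIr (_ : `[l, m[ `&` `[m, h[ = set0) ?setI0 //.
      apply/seteqP; split => // x /=; rewrite !in_itv/= => -[/andP[_ xm] /andP[mx _]].
      by move: (lt_le_trans xm mx); rewrite ltxx.
    + apply: (le_trans (Dsub _ m _ al lm mh hb)); rewrite big_cat /=; lra.
move=> [s [as_ ps ls Ds]]; apply: (le_trans Ds); rewrite lerD2l.
apply: dac => //; rewrite -lte_fin; apply: (le_lt_trans ls).
apply: (@le_lt_trans _ _ (mu U)).
  by apply: le_measure; rewrite ?inE //; exact: measurableI.
by apply: (le_lt_trans muU); rewrite lte_fin; lra.
Qed.

Lemma abs_cont_seq n (a b : R) (g : R -> 'cV[R]_n) : abs_cont a b g ->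
  gauge_ac a b (fun l h => enorm (g h - g l)).
Proof.
move=> ac e e0; have [d d0 dac] := ac e e0; exists d => // s as_ ps ls; apply: ltW.
pose l (i : 'I_(size s)) := (nth (0, 0) s i).1.
pose h (i : 'I_(size s)) := (nth (0, 0) s i).2.
have := dac (size s) l h.
rewrite (big_nth (0, 0)) big_mkord; apply.
- by move=> i; have /(all_nthP (0, 0)) /(_ i (ltn_ord i)) /and3P[] := as_.
- move=> i j ij; move/(pairwiseP (0, 0)) : ps => /(_ i j); apply => //; exact: ltn_ord.
- by move: ls; rewrite (big_nth (0, 0)) big_mkord.
Qed.

Lemma gauge_ac_le (a b : R) (D D' : R -> R -> R) :
  (forall l h, a <= l -> l <= h -> h <= b -> D l h <= D' l h) ->
  gauge_ac a b D' -> gauge_ac a b D.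
Proof.
move=> DD ac e e0; have [d d0 dac] := ac e e0; exists d => // s as_ ps ls.
apply: le_trans (dac s as_ ps ls); rewrite big_seq [leRHS]big_seq.
by apply: ler_sum => p /(allP as_) /and3P[*]; exact: DD.
Qed.

Lemma gauge_ac_lipschitz (a b M : R) (D : R -> R -> R) :
  (forall l h, a <= l -> l <= h -> h <= b -> D l h <= M * (h - l)) ->
  gauge_ac a b D.
Proof.
move=> DM e e0; exists (e / (`|M| + 1)); first by rewrite divr_gt0 // ltr_wpDl.
move=> s as_ ps; rewrite ltr_pdivlMr ?ltr_wpDl // => /ltW; apply: le_trans.
rewrite mulr_suml big_seq [leRHS]big_seq; apply: ler_sum => p /(allP as_) /and3P[ap pp pb].
apply: (le_trans (DM _ _ ap pp pb)); rewrite mulrC ler_wpM2l ?subr_ge0 //.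
by rewrite (le_trans (ler_norm _)) // lerDl.
Qed.


Lemma ae_sub (P Q : R -> Prop) : (forall t, P t -> Q t) ->
  {ae mu, forall t, P t} -> {ae mu, forall t, Q t}.
Proof. by move=> PQ; apply: negligibleS => t /=; apply: contra_not; exact: PQ. Qed.

Lemma ae_and (P Q : R -> Prop) : {ae mu, forall t, P t} ->
  {ae mu, forall t, Q t} -> {ae mu, forall t, P t /\ Q t}.
Proof.
move=> hP hQ; apply: negligibleS (negligibleU hP hQ) => t /= /not_andP[]; [by left|by right].
Qed.

Lemma is_derive_approx (V : normedModType R) (g : R -> V) (t : R) (l : V) :
  is_derive t 1 g l -> forall e, 0 < e -> exists2 d, 0 < d &
  forall s, `|s - t| < d -> `|g s - g t - (s - t) *: l| <= e * `|s - t|.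
Proof.
move=> gl e e0.
have : (fun h => h^-1 *: (g (h *: 1 + t) - g t)) @ 0^' --> l.
  have dg : derivable g t 1 by exact: ex_derive.
  have <- : 'D_1 g t = l by exact: derive_val.
  exact: dg.
move=> /cvgrPdist_le/(_ e e0); rewrite near_withinE => /nbhs_ballP[d /= d0 dP].
exists d => // s sd.
have [->|st] := eqVneq s t; first by rewrite !subrr scale0r subr0 !normr0 mulr0.
have st0 : s - t != 0 by rewrite subr_eq0.
have := dP (s - t); rewrite /ball /= sub0r normrN => /(_ sd st0).
have -> : (s - t) *: 1 + t = s by rewrite /GRing.scale /= mulr1 subrK.
move=> H; rewrite -(normrN (_ - _ *: _)) opprB.
have -> : (s - t) *: l - (g s - g t) = (s - t) *: (l - (s - t)^-1 *: (g s - g t)).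
  by rewrite scalerBr scalerA divff // scale1r.
by rewrite normrZ mulrC ler_wpM2r.
Qed.

Lemma is_derive_enorm_approx n (g : R -> 'cV[R]_n) (t : R) (l : 'cV[R]_n) :
  is_derive t 1 g l -> forall e, 0 < e -> exists2 d, 0 < d &
  forall s, `|s - t| < d -> enorm (g s - g t - (s - t) *: l) <= e * `|s - t|.
Proof.
move=> gl e e0; have n1 : 0 < n%:R + 1 :> R by rewrite ltr_wpDl.
have [d d0 dP] := is_derive_approx gl (divr_gt0 e0 n1).
exists d => // s /dP H; apply: (le_trans (enorm_le_norm _)).
apply: (@le_trans _ _ ((n%:R + 1) * `|g s - g t - (s - t) *: l|)).
  by rewrite ler_wpM2r // lerDl.
by rewrite -ler_pdivlMl // mulrA [_^-1 * e]mulrC.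
Qed.

(** [gauge_le0] applied to |g h - g l| - (phi h - phi l), which is subadditive by the triangle
    inequality. Monotonicity of phi suffices for [gauge_ac], since that condition is one-sided and
    the increments of phi enter with a negative sign. *)
Lemma abs_cont_growth n (g : R -> 'cV[R]_n) (phi : R -> R) (a b : R) : a <= b ->
  abs_cont a b g ->
  (forall x y, a <= x -> x <= y -> y <= b -> phi x <= phi y) ->
  {ae mu, forall t, a < t < b -> exists l lphi,
    [/\ is_derive t 1 g l, is_derive t 1 phi lphi & enorm l <= lphi]} ->
  enorm (g b - g a) <= phi b - phi a.
Proof.
move=> ab ac mono ae; rewrite -subr_le0.
apply: (@gauge_le0 a b (fun l h => enorm (g h - g l) - (phi h - phi l))) => //.
- move=> l m h al lm mh hb.
  have := enorm_triangle (g h) (g m) (g l); lra.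
- apply: gauge_ac_le (abs_cont_seq ac) => l h al lh hb.
  by rewrite lerBlDr lerDl subr_ge0 mono.
- apply: ae_sub ae => t tP /tP[l [lphi [gl phil llphi]]] e e0.
  have e20 : 0 < e / 2 by lra.
  have [d1 d10 D1] := is_derive_enorm_approx gl e20.
  have [d2 d20 D2] := is_derive_approx phil e20.
  exists (Num.min d1 d2); first by rewrite lt_min d10.
  move=> x y ax xt ty yb tx yt.
  have m1 : Num.min d1 d2 <= d1 by rewrite ge_min lexx.
  have m2 : Num.min d1 d2 <= d2 by rewrite ge_min lexx orbT.
  have nx : `|x - t| = t - x by rewrite ler0_norm; lra.
  have ny : `|y - t| = y - t by rewrite ger0_norm; lra.
  have := D1 x; rewrite nx => /(_ ltac:(lra)) G1.
  have := D1 y; rewrite ny => /(_ ltac:(lra)) G2.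
  have := D2 x; rewrite nx => /(_ ltac:(lra)); rewrite ler_norml => /andP[F1 F1'].
  have := D2 y; rewrite ny => /(_ ltac:(lra)); rewrite ler_norml => /andP[F2 F2'].
  rewrite /GRing.scale /= in F1 F1' F2 F2'.
  have E : enorm (g y - g x) <= e / 2 * (y - x) + (y - x) * lphi.
    have -> : g y - g x = (g y - g t - (y - t) *: l) - (g x - g t - (x - t) *: l)
                          + (y - x) *: l.
      by apply/matrixP => i j; rewrite !mxE; ring.
    apply: (le_trans (enormD _ _)); rewrite lerD //.
      apply: (le_trans (enormD _ _)); rewrite enormN; lra.
    by rewrite enormZ ger0_norm ?ler_wpM2l //; lra.
  nra.
Qed.

(** The signed counterpart of [abs_cont_growth]: the bound is on the derivative of psi, not on its
    modulus. It integrates the differential inequality of the Lyapunov function. *)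
Lemma lipschitz_growth (psi phi : R -> R) (a b M : R) : a <= b ->
  (forall x y, a <= x -> x <= y -> y <= b -> `|psi y - psi x| <= M * (y - x)) ->
  (forall x y, a <= x -> x <= y -> y <= b -> phi x <= phi y) ->
  {ae mu, forall t, a < t < b -> exists l lphi,
    [/\ is_derive t 1 psi l, is_derive t 1 phi lphi & l <= lphi]} ->
  psi b - psi a <= phi b - phi a.
Proof.
move=> ab lip mono ae; rewrite -subr_le0.
apply: (@gauge_le0 a b (fun l h => (psi h - psi l) - (phi h - phi l))) => //.
- by move=> l m h al lm mh hb; lra.
- apply: (@gauge_ac_lipschitz _ _ M) => l h al lh hb.
  have := mono l h al lh hb; have := lip l h al lh hb.
  by rewrite ler_norml => /andP[]; lra.
- apply: ae_sub ae => t tP /tP[l [lphi [gl phil llphi]]] e e0.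
  have e20 : 0 < e / 2 by lra.
  have [d1 d10 D1] := is_derive_approx gl e20.
  have [d2 d20 D2] := is_derive_approx phil e20.
  exists (Num.min d1 d2); first by rewrite lt_min d10.
  move=> x y ax xt ty yb tx yt.
  have m1 : Num.min d1 d2 <= d1 by rewrite ge_min lexx.
  have m2 : Num.min d1 d2 <= d2 by rewrite ge_min lexx orbT.
  have nx : `|x - t| = t - x by rewrite ler0_norm; lra.
  have ny : `|y - t| = y - t by rewrite ger0_norm; lra.
  have := D1 x; rewrite nx => /(_ ltac:(lra)); rewrite ler_norml => /andP[G1 G1'].
  have := D1 y; rewrite ny => /(_ ltac:(lra)); rewrite ler_norml => /andP[G2 G2'].
  have := D2 x; rewrite nx => /(_ ltac:(lra)); rewrite ler_norml => /andP[F1 F1'].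
  have := D2 y; rewrite ny => /(_ ltac:(lra)); rewrite ler_norml => /andP[F2 F2'].
  rewrite /GRing.scale /= in F1 F1' F2 F2' G1 G1' G2 G2'.
  nra.
Qed.

Lemma lipschitz_abs_cont n (g : R -> 'cV[R]_n) (a b M : R) :
  (forall x y, a <= x -> x <= y -> y <= b -> enorm (g y - g x) <= M * (y - x)) ->
  abs_cont a b g.
Proof.
move=> lip e e0; have M1 : 0 < `|M| + 1 by rewrite ltr_wpDl.
exists (e / (`|M| + 1)); first by rewrite divr_gt0.
move=> N l h lh _; rewrite ltr_pdivlMr // => /(le_lt_trans _); apply.
rewrite mulr_suml; apply: ler_sum => i _; have [al lhi hb] := lh i.
apply: (le_trans (lip _ _ al lhi hb)); rewrite mulrC ler_wpM2l ?subr_ge0 //.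
by rewrite (le_trans (ler_norm _)) // lerDl.
Qed.

End Gauge.

(** * Primitives of locally bounded Borel functions *)

Section Primitive.
Context {R : realType}.
Notation mu := (@lebesgue_measure R).

Local Notation cT := (caratheodory_type (@wlength R idfun)^*%mu).

Definition borel_fun n (g : R -> 'cV[R]_n) :=
  forall j, measurable_fun [set: R] (fun t => g t j 0).

Definition loc_bounded n (g : R -> 'cV[R]_n) :=
  forall c, exists M, forall t, `|t| <= c -> enorm (g t) <= M.

(* Zero for [t <= a]. *)
Definition prim n (a : R) (g : R -> 'cV[R]_n) (t : R) : 'cV[R]_n :=
  \col_j \int[mu]_(s in `[a, t]) (g s j 0).

Lemma itv_integrable (f : R -> R) (a b M : R) : measurable_fun [set: R] f ->
  (forall t, a <= t <= b -> `|f t| <= M) -> mu.-integrable `[a, b] (EFin \o f).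
Proof.
move=> mf fM; apply: measurable_bounded_integrable => //.
- by rewrite /= lebesgue_measure_itv/=; case: ifP => // _; rewrite -EFinD ltry.
- exact: measurable_funS mf.
- exists M; split; first exact: num_real.
  move=> x Mx y /=; rewrite in_itv/= => yab.
  exact: (le_trans (fM _ yab) (ltW Mx)).
Qed.

Lemma borel_itv_integrable n (g : R -> 'cV[R]_n) j a b :
  borel_fun g -> loc_bounded g ->
  mu.-integrable `[a, b] (EFin \o (fun t => g t j 0)).
Proof.
move=> bg lg; have [M MP] := lg (Num.max `|a| `|b|).
apply: (itv_integrable (M := M)) => // t /andP[at_ tb].
apply: (le_trans (coord_le_enorm _ _)); apply: MP.
rewrite le_max ler_norml; have [t0|t0] := lerP 0 t.
  apply/orP; right; rewrite ger0_norm //; exact: le_trans (ler_norm b).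
apply/orP; left; apply/andP; split.
  by have := ler_norm (- a); rewrite normrN; lra.
by rewrite (le_trans (ltW t0)).
Qed.

Lemma prim_le n a (g : R -> 'cV[R]_n) t : t <= a -> prim a g t = 0.
Proof.
move=> ta; apply/matrixP => j i; rewrite !mxE.
move: ta; rewrite le_eqVlt => /predU1P[->|ta].
  by rewrite set_itv1 Rintegral_set1.
by rewrite set_itv_ge ?Rintegral_set0 // bnd_simp -ltNge.
Qed.

Lemma primB n a (g : R -> 'cV[R]_n) s t : borel_fun g -> loc_bounded g ->
  a <= s -> s <= t -> prim a g t - prim a g s = prim s g t.
Proof.
move=> bg lg as_ st; apply/matrixP => j i; rewrite !mxE.
rewrite (@Rintegral_itvB _ _ (BLeft a) (BRight t) s) ?bnd_simp //.
  rewrite Rintegral_itv_obnd_cbnd //.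
  apply: (@integrableS _ _ _ mu `[s, t]) => //; last exact: borel_itv_integrable.
  by apply: subset_itvr; rewrite bnd_simp.
exact: borel_itv_integrable.
Qed.

(** Integrating coordinate by coordinate costs the factor n. The bound serves regularity; estimates
    whose constants matter go through [prim_diff_growth]. *)
Lemma enorm_prim n a (g : R -> 'cV[R]_n) t M : borel_fun g -> a <= t ->
  (forall s, a <= s <= t -> enorm (g s) <= M) -> enorm (prim a g t) <= n%:R * M * (t - a).
Proof.
move=> bg at_ gM; apply: (le_trans (enorm_le_sum _)).
have -> : n%:R * M * (t - a) = \sum_(i < n) M * (t - a).
  by rewrite sumr_const card_ord -mulrA mulr_natl.
apply: ler_sum => i _; rewrite mxE.
have gint : mu.-integrable `[a, t] (EFin \o (fun t => g t i 0)).
  apply: (itv_integrable (M := M)) => // s /gM; exact: le_trans (coord_le_enorm _ _).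
have cint : mu.-integrable `[a, t] (EFin \o (fun=> M)).
  by apply: (itv_integrable (M := `|M|)).
apply: (le_trans (le_normr_Rintegral _ gint)) => //.
apply: (@le_trans _ _ (\int[mu]_(s in `[a, t]) M)).
  apply: le_Rintegral => //.
    apply: (itv_integrable (M := M)).
      exact: measurableT_comp (bg i).
    by move=> s /gM; rewrite normr_id; exact: le_trans (coord_le_enorm _ _).
  move=> s /=; rewrite in_itv/= => /gM; exact: le_trans (coord_le_enorm _ _).
rewrite Rintegral_cst //= lebesgue_measure_itv/= lte_fin.
case: ifPn => //= _; first by rewrite /= mulr0 mulr_ge0 ?subr_ge0 //
  (le_trans (enorm_ge0 (g a))) // gM // lexx.
Qed.

Lemma is_derive_cvE n (F : R -> 'cV[R]_n) (t : R) l :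
  is_derive t 1 F l <-> forall j, is_derive t 1 (fun s => F s j 0) (l j 0).
Proof.
split.
  move=> Fl j; have dF : derivable F t 1 by exact: ex_derive.
  have vF : 'D_1 F t = l by exact: derive_val.
  apply: DeriveDef; first by have /derivable_mxP := dF; exact.
  by rewrite -vF derive_mx // mxE.
move=> H; have dF : derivable F t 1.
  by apply/derivable_mxP => i j; rewrite ord1; exact: ex_derive.
apply: DeriveDef => //; rewrite derive_mx //; apply/matrixP => i j.
by rewrite mxE ord1; exact: derive_val.
Qed.

Lemma ae_forall_ord n (P : 'I_n -> R -> Prop) :
  (forall j, {ae mu, forall t, P j t}) -> {ae mu, forall t, forall j, P j t}.
Proof.
move=> H; pose P' (k : nat) t := forall j : 'I_n, k = j -> P j t.
have : {ae mu, forall t, forall k, P' k t}.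
  apply: ae_foralln => k; have [kn|kn] := ltnP k n.
    apply: ae_sub (H (Ordinal kn)) => t Pt j kj.
    by have -> : j = Ordinal kn by apply: val_inj.
  by apply: aeW => t j kj; move: kn; rewrite kj leqNgt ltn_ord.
by apply: ae_sub => t Pt j; exact: (Pt j).
Qed.

Lemma is_derive_prim n a (g : R -> 'cV[R]_n) : borel_fun g -> loc_bounded g ->
  {ae mu, forall t : R, a < t -> is_derive t 1 (prim a g) (g t)}.
Proof.
move=> bg lg.
suff : {ae mu, forall t : R, forall j, a < t -> is_derive t 1 (fun s => prim a g s j 0) (g t j 0)}.
  by apply: ae_sub => t H at_; apply/is_derive_cvE => j; exact: H.
apply: ae_forall_ord => j.
have li : locally_integrable [set: R] (fun t => g t j 0).
  split; [exact: bg|exact: openT|move=> K _ cK].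
  have /compact_bounded[M [_ MP]] := cK.
  have := @borel_itv_integrable n g j (- (`|M| + 1)) (`|M| + 1) bg lg.
  move=> /integrableP[mg]; apply: le_lt_trans; apply: ge0_subset_integral => //.
  - exact: compact_measurable.
  - by apply/measurable_EFinP; apply: measurableT_comp => //; exact: measurable_funS (bg j).
  - move=> x Kx /=; rewrite in_itv/= -ler_norml; apply: (MP (`|M| + 1)) => //.
    by rewrite (le_lt_trans (ler_norm _)) // ltrDl.
have := @FTC1 R (fun t => g t j 0) (BLeft a) (fun y => @borel_itv_integrable n g j a y bg lg) li.
apply: ae_sub => t H at_.
case: H; first by rewrite lte_fin.
move=> d1 d2.
have E : (fun s => prim a g s j 0) =
    (fun x => \int[mu]_(t in [set` Interval (BLeft a) (BRight x)]) (g t j 0)).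
  by apply/funext => s; rewrite mxE.
rewrite E; apply: (DeriveDef d1).
by rewrite -derive1E; exact: d2.
Qed.

(** The integral in the system is taken for the completed measure on the larger sigma-algebra,
    [prim] for the Borel one. Completeness turns almost everywhere equality into measurability of
    g', so g' may be replaced by g. *)
Lemma vec_integral_borel n (g g' : R -> 'cV[R]_n) s t : borel_fun g -> loc_bounded g ->
  {ae mu, forall x, s <= x <= t -> g x = g' x} -> vec_integral s t g' = prim s g t.
Proof.
move=> bg lg gg; apply/matrixP => j i; rewrite !mxE /Rintegral; congr fine.
have mid : measurable_fun [set: cT] (idfun : cT -> measurableTypeR R).
  by move=> _ Y mY; rewrite setTI; exact: sub_caratheodory.
have mst : measurable (`[s, t]%classic : set cT).
  by apply: sub_caratheodory; exact: measurable_itv.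
have mgj : measurable_fun [set: R] (fun x => (g x j 0)%:E) by apply/measurable_EFinP; exact: bg.
have mg : measurable_fun (`[s, t]%classic : set cT) (fun x => (g x j 0)%:E).
  exact: measurable_funTS (measurableT_comp mgj mid).
have aeE : ae_eq (@completed_lebesgue_measure R) (`[s, t]%classic : set cT)
    (fun x => (g x j 0)%:E) (fun x => (g' x j 0)%:E).
  case: gg => A [mA A0 AP]; exists A; split => //; first exact: sub_caratheodory.
  move=> x /= xP; apply: AP => /= xP'; apply: xP; rewrite in_itv/= => /xP' ->.
  by [].
have mg' := ae_measurable_fun completed_lebesgue_measure_is_complete aeE mg.
transitivity (\int[@completed_lebesgue_measure R]_(x in (`[s, t]%classic : set cT)) (g x j 0)%:E)%E.
  by symmetry; apply: ae_eq_integral.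
have gint := @borel_itv_integrable n g j s t bg lg.
(* The identity map pushes the completed measure forward to the Borel sets, where it coincides with
   [mu]; the change of variables formula then compares the two integrals. *)
pose nu := measure_function_pushforward__canonical__measure_function_Measure
  (@completed_lebesgue_measure R) mid.
have nu_mu A : measurable A -> A `<=` `[s, t]%classic -> nu A = mu A by [].
transitivity (\int[nu]_(x in `[s, t]) (g x j 0)%:E)%E; last first.
  exact: (@eq_measure_integral _ _ _ _ mu nu _ nu_mu).
have E := @integral_pushforward _ _ _ _ _ _ mid (@completed_lebesgue_measure R)
  `[s, t]%classic (fun x => (g x j 0)%:E) mgj.
rewrite E //.
have [M MP] := lg (`|s| + `|t|).
suff : (@completed_lebesgue_measure R).-integrable (`[s, t]%classic : set cT)
  (EFin \o (fun x : cT => g x j 0)) by [].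
apply: (@measurable_bounded_integrable _ _ _ (@completed_lebesgue_measure R) (fun x : cT => g x j 0)
  (`[s, t]%classic : set cT) mst).
- rewrite -[X in (X < _)%E]/(mu `[s, t]%classic).
  by rewrite lebesgue_measure_itv/=; case: ifP => // _; rewrite -EFinD ltry.
- exact: (measurable_EFinP _ _).1 mg.
- exists M; split; first exact: num_real.
  move=> x Mx y /=; rewrite in_itv/= => /andP[sy yt].
  apply: (le_trans _ (ltW Mx)); apply: (le_trans (coord_le_enorm _ _)); apply: MP.
  rewrite ler_norml; apply/andP; split.
    have := ler_norm (- s); have := normr_ge0 t; rewrite normrN; lra.
  have := ler_norm t; have := normr_ge0 s; lra.
Qed.

End Primitive.

(** * Passing from Lebesgue measurable to Borel functions *)

Section Borel_representative.
Context {R : realType}.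
Notation mu := (@lebesgue_measure R).
Local Notation cT := (caratheodory_type (@wlength R idfun)^*%mu).

(** Translation preserves Lebesgue measure, because its pushforward gives half-open intervals their
    length and Lebesgue measure is determined by that. *)
Lemma negligible_shift (N : set R) (c : R) : mu.-negligible N ->
  mu.-negligible [set t | N (t + c)].
Proof.
move=> [A [mA A0 NA]].
have mshift : measurable_fun [set: measurableTypeR R]
    (fun t : measurableTypeR R => (t + c : measurableTypeR R)).
  exact: measurable_funD.
have mA' : measurable ((fun t : measurableTypeR R => (t + c : measurableTypeR R)) @^-1` A).
  by rewrite -[X in measurable X]setTI; exact: mshift.
exists ((fun t : measurableTypeR R => (t + c : measurableTypeR R)) @^-1` A); split => //.
  pose nu := measure_function_pushforward__canonical__measure_function_Measure mu mshift.
  rewrite -[LHS]/(nu A) -A0; apply/esym/lebesgue_measure_unique => //= _ [[a b]] _ <-.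
  rewrite /nu /= /pushforward.
  have -> : (fun t : measurableTypeR R => (t + c : measurableTypeR R)) @^-1` `]a, b]%classic =
      `]a - c, b - c]%classic.
    by apply/seteqP; split => t /=; rewrite !in_itv/= ltrBlDr lerBrDr.
  rewrite !lebesgue_measure_itv/= !lte_fin ltrD2r.
  by case: ifP => // _; rewrite -!EFinD; congr EFin; ring.
by move=> t /=; exact: NA.
Qed.

Lemma ae_shift (P : R -> Prop) (c : R) : {ae mu, forall t, P t} ->
  {ae mu, forall t, P (t + c)}.
Proof. exact: negligible_shift. Qed.

Lemma lebesgue_measurable_borel (A : set R) :
  measurable (A : set cT) -> exists B N, [/\ measurable (B : set R), mu.-negligible N & A = B `|` N].
Proof.
move=> mA; have : (completed_algebra_gen mu) A.
  by rewrite -g_sigma_completed_algebra_genE completed_caratheodory_measurable.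
by move=> [B mB [N negN BN]]; exists B, N.
Qed.

(** Each set where a coordinate lies below a rational is a Borel set up to a null set. There are
    countably many such sets, so one Borel null set A covers all exceptions, and u may be reset to
    the constant us on A and outside D. Values stay in U, where the assumptions on f apply. *)
Lemma borel_representative m (D : set R) (U : set 'cV[R]_m) (us : 'cV[R]_m) (u : R -> 'cV[R]_m) :
  U us -> measurable D -> (forall t, D t -> U (u t)) -> lebesgue_measurable_fun D u ->
  exists ut, [/\ borel_fun ut, (forall t, ut t = us \/ D t /\ ut t = u t),
    (forall t, U (ut t)) &
   {ae mu, forall t, D t -> ut t = u t}].
Proof.
move=> Us mD Uu mu_.
have mDc : measurable (D : set cT) by exact: sub_caratheodory.
have q (j : 'I_m) (q : rat) : exists BN : set R * set R, [/\ measurable BN.1, mu.-negligible BN.2 &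
   D `&` [set t | u t j 0 < ratr q] = BN.1 `|` BN.2].
  have := mu_ j mDc `]-oo, (ratr q)[%classic (measurable_itv _).
  move=> /lebesgue_measurable_borel[B [N [mB negN BN]]]; exists (B, N); split => //=.
have {q} /choice[F FP] : forall jq : 'I_m * rat, exists BN : set R * set R,
    [/\ measurable BN.1, mu.-negligible BN.2 &
   D `&` [set t | u t jq.1 0 < ratr jq.2] = BN.1 `|` BN.2] by move=> [j r]; exact: q.
pose N := \bigcup_(k in [set: nat]) (if unpickle k is Some jq then (F jq).2 else set0).
have : mu.-negligible N.
  apply: negligible_bigcup => k; case: unpickle => [jq|]; last exact: negligible_set0.
  by have [] := FP jq.
move=> [A [mA A0 NA]].
have NFA jq : (F jq).2 `<=` A.
  by apply: (subset_trans _ NA) => t Ft; exists (pickle jq) => //; rewrite pickleK.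
pose E := D `\` A.
have mE : measurable E by exact: measurableD.
pose ut t := if t \in E then u t else us.
exists ut; split.
- move=> j; apply: (measurability (@RGenInftyO.G R)).
    exact: RGenInftyO.measurableE.
  move=> _ [_ [x ->] <-]; rewrite setTI.
  pose G (q : rat) := if ratr q <= x then (F (j, q)).1 else set0.
  have -> : (fun t => ut t j 0) @^-1` `]-oo, x[%classic =
    (E `&` \bigcup_q G q) `|` (~` E `&` [set _ | us j 0 < x]).
    apply/seteqP; split => [t /=|t /=].
      rewrite in_itv/= /ut; case: ifPn => [|/negP]; rewrite inE => Et utx; last by right.
      have [q] := rat_in_itvoo utx; rewrite in_itv/= => /andP[uq qx].
      left; split => //; exists q => //; rewrite /G ltW //.
      have [_ _ Fq] := FP (j, q).
      have : ((F (j, q)).1 `|` (F (j, q)).2) t by rewrite -Fq; split => //; exact: (proj1 Et).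
      by case => // /NFA; case: Et.
    rewrite in_itv/= /ut => -[[Et [q _]]|[Et]]; last by rewrite memNset.
    rewrite /G; case: ifPn => // qx Ftq; rewrite mem_set //.
    have [_ _ Fq] := FP (j, q).
    have [_ /= uq] : (D `&` [set t | u t j 0 < ratr q]) t by rewrite Fq; left.
    exact: lt_le_trans qx.
  apply: measurableU.
    apply: measurableI => //; apply: countable_bigcupT_measurable => // q.
    by rewrite /G; case: ifP => // _; have [] := FP (j, q).
  apply: measurableI; first exact: measurableC.
  by case: (us j 0 < x); [rewrite (_ : [set _ | true] = setT)|rewrite (_ : [set _ | false] = set0)] => //;
   apply/seteqP; split.
- move=> t; rewrite /ut; case: ifPn; last by left.
  by rewrite inE => -[Dt _]; right.
- move=> t; rewrite /ut; case: ifPn => //.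
  by rewrite inE => -[Dt _]; exact: Uu.
- exists A; split => // t /= /not_implyP[Dt]; apply: contra_notP => At.
  by rewrite /ut mem_set.
Qed.

End Borel_representative.

(** * Borel measurability of compositions *)

Section Measurable_composition.
Context {R : realType}.

Lemma enorm_ball_nbhs n (a : 'cV[R]_n) (e : R) : 0 < e ->
  \forall x \near a, enorm (x - a) < e.
Proof.
move=> e0; have n1 : 0 < n%:R + 1 :> R by rewrite ltr_wpDl.
near=> x.
have : `|a - x| < e / (n%:R + 1).
  by near: x; apply: cvgr_dist_lt; rewrite ?divr_gt0.
rewrite distrC => H; apply: (le_lt_trans (enorm_le_norm _)).
apply: (@le_lt_trans _ _ ((n%:R + 1) * `|x - a|)); first by rewrite ler_wpM2r // lerDl.
by rewrite mulrC -ltr_pdivlMr.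
Unshelve. all: by end_near. Qed.

Lemma nbhs_enorm_ball n (a : 'cV[R]_n) (A : set 'cV[R]_n) : nbhs a A ->
  exists2 e : R, 0 < e & forall x, enorm (x - a) < e -> A x.
Proof.
move=> /nbhs_ballP[e /= e0 eA]; exists e => // x xa; apply: eA.
rewrite -ball_normE /ball_ /=; apply: le_lt_trans xa.
by rewrite distrC; exact: norm_le_enorm.
Qed.

Lemma rat_approx_col n (a : 'cV[R]_n) (e : R) : 0 < e ->
  exists q : {ffun 'I_n -> rat}, enorm (a - \col_i ratr (q i)) < e.
Proof.
move=> e0; have n1 : 0 < n%:R + 1 :> R by rewrite ltr_wpDl.
have en : 0 < e / (n%:R + 1) by rewrite divr_gt0.
have /choice[q qP] : forall i : 'I_n, exists q : rat, `|a i 0 - ratr q| <= e / (n%:R + 1).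
  move=> i; have /rat_in_itvoo[q] : a i 0 - e / (n%:R + 1) < a i 0 by rewrite ltrBlDr ltrDl.
  rewrite in_itv/= => /andP[q1 q2]; exists q; rewrite ger0_norm; lra.
exists (finfun q); apply: (le_lt_trans (enorm_le_sum _)).
apply: (@le_lt_trans _ _ (\sum_(i < n) e / (n%:R + 1))).
  by apply: ler_sum => i _; rewrite !mxE ffunE.
rewrite sumr_const card_ord -[X in X < _]mulr_natl mulrA ltr_pdivrMr // mulrC ltr_pM2l //.
by rewrite ltrDl.
Qed.

Lemma measurable_enorm_ball n (y : R -> 'cV[R]_n) (c : 'cV[R]_n) (e : R) :
  borel_fun y -> measurable [set t | enorm (y t - c) < e].
Proof.
move=> my; have [e0|e0] := lerP e 0.
  rewrite (_ : [set _ | _] = set0) //; apply/seteqP; split => // t /=.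
  by move/lt_le_trans => /(_ _ e0); rewrite ltNge enorm_ge0.
have -> : [set t | enorm (y t - c) < e] =
  (fun t => \sum_(i < n) (y t i 0 - c i 0) ^+ 2) @^-1` `]-oo, (e ^+ 2)[%classic.
  have E t : \sum_(i < n) (y t i 0 - c i 0) ^+ 2 = enorm (y t - c) ^+ 2.
    by rewrite enorm_sqr; apply: eq_bigr => i _; rewrite !mxE.
  by apply/seteqP; split => t /=; rewrite in_itv/= E ltr_pXn2r // nnegrE ?enorm_ge0 ?(ltW e0).
rewrite -[X in measurable X]setTI.
have : measurable_fun [set: R] (fun t => \sum_(i < n) (y t i 0 - c i 0) ^+ 2).
  apply: measurable_sum => i; apply: measurable_funX; exact: measurable_funB.
by move=> H; exact: (H measurableT _ (measurable_itv _)).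
Qed.

(** The preimage of an open half-line under G is open, hence a union of the countably many products
    of balls with rational centres and radii 1/(N+1) that it contains; the inverse image of each
    such product under (y, u) is Borel. *)
Lemma borel_comp2 n m k (G : 'cV[R]_n * 'cV[R]_m -> 'cV[R]_k)
    (y : R -> 'cV[R]_n) (u : R -> 'cV[R]_m) :
  continuous G -> borel_fun y -> borel_fun u -> borel_fun (fun t => G (y t, u t)).
Proof.
move=> cG my mu_ j; apply: (measurability (@RGenInftyO.G R)).
  exact: RGenInftyO.measurableE.
move=> _ [_ [x ->] <-]; rewrite setTI.
pose O := [set p | G p j 0 < x].
pose I := ({ffun 'I_n -> rat} * {ffun 'I_m -> rat} * nat)%type.
pose box (i : I) := [set p : 'cV[R]_n * 'cV[R]_m |
  enorm (p.1 - \col_l ratr (i.1.1 l)) < i.2.+1%:R^-1 /\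
  enorm (p.2 - \col_l ratr (i.1.2 l)) < i.2.+1%:R^-1].
pose C (i : I) := if `[< box i `<=` O >] then [set t | box i (y t, u t)] else set0.
have -> : (fun t => G (y t, u t) j 0) @^-1` `]-oo, x[%classic = \bigcup_i C i.
  apply/seteqP; split => t /=; rewrite in_itv/=; last first.
    by move=> [i _]; rewrite /C; case: asboolP => // /[apply].
  move=> Ot; have : nbhs (y t, u t) O.
    have cj : {for (y t, u t), continuous (fun p => G p j 0)}.
      apply: (@continuous_comp _ _ _ G (fun M : 'cV[R]_k => M j 0)); first exact: cG.
      exact: coord_continuous.
    exact: (cvgr_lt _ cj).
  move=> [[A B] [/= /nbhs_enorm_ball[e1 e10 A1] /nbhs_enorm_ball[e2 e20 B1]] AB].
  (* Halved because a point of the product is compared with (y t, u t) through the rational centre,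
     at distance less than e from both. *)
  pose e := Num.min e1 e2 / 2.
  have e0 : 0 < e by rewrite divr_gt0 // lt_min e10.
  have [N Ne] : exists N : nat, N.+1%:R^-1 < e.
    by have := near_infty_natSinv_lt (PosNum e0) => -[N _ NP]; exists N; apply: NP => /=.
  have N0 : 0 < N.+1%:R^-1 :> R by rewrite invr_gt0.
  have [q1 Q1] := rat_approx_col (y t) N0.
  have [q2 Q2] := rat_approx_col (u t) N0.
  exists (q1, q2, N) => //; rewrite /C asboolT // => -[p1 p2] [/= P1 P2]; apply: AB.
  have m1 : Num.min e1 e2 <= e1 by rewrite ge_min lexx.
  have m2 : Num.min e1 e2 <= e2 by rewrite ge_min lexx orbT.
  split => /=; [apply: A1|apply: B1].
    apply: (le_lt_trans (enorm_triangle _ (\col_l ratr (q1 l)) _)).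
    rewrite [X in _ + X]enormB.
    have := ltrD (lt_trans P1 Ne) (lt_trans Q1 Ne); rewrite -splitr => /lt_le_trans; exact.
  apply: (le_lt_trans (enorm_triangle _ (\col_l ratr (q2 l)) _)).
  rewrite [X in _ + X]enormB.
  have := ltrD (lt_trans P2 Ne) (lt_trans Q2 Ne); rewrite -splitr => /lt_le_trans; exact.
apply: countable_bigcupT_measurable; first exact: countableP.
move=> i; rewrite /C; case: asboolP => // _.
apply: (@measurableI _ _ [set t | enorm (y t - _) < _] [set t | enorm (u t - _) < _]);
  exact: measurable_enorm_ball.
Qed.

Lemma continuous_borel n (y : R -> 'cV[R]_n) : continuous y -> borel_fun y.
Proof.
move=> cy j; apply: continuous_measurable_fun => t.
apply: (@continuous_comp _ _ _ y (fun M : 'cV[R]_n => M j 0)); first exact: cy.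
exact: coord_continuous.
Qed.

Lemma continuous_enorm n (y : R -> 'cV[R]_n) : continuous y -> continuous (fun t => enorm (y t)).
Proof.
move=> cy t; apply/cvgrPdist_lt => e e0.
near=> s; have H : enorm (y s - y t) < e by near: s; exact: (cy t _ (enorm_ball_nbhs (y t) e0)).
have := enorm_distl (y s) (y t); have := enorm_distl (y t) (y s).
rewrite (enormB (y t)) ltr_norml => H1 H2; apply/andP; split; lra.
Unshelve. all: by end_near. Qed.

Lemma continuous_loc_bounded n (y : R -> 'cV[R]_n) : continuous y -> loc_bounded y.
Proof.
move=> cy c; have [c0|c0] := ltrP c 0.
  by exists 0 => t; rewrite leNgt (lt_le_trans c0).
have [||M _ MP] := @EVT_max R (fun t => enorm (y t)) (- c) c.
- lra.
- by apply: continuous_subspaceT => t; exact: continuous_enorm.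
by exists (enorm (y M)) => t; rewrite ler_norml => tc; apply: MP; rewrite in_itv.
Qed.

Lemma enorm_continuous n (y : R -> 'cV[R]_n) :
  (forall t e, 0 < e -> exists2 d, 0 < d & forall s, `|s - t| < d -> enorm (y s - y t) < e) ->
  continuous y.
Proof.
move=> H t; apply/cvgrPdist_lt => e e0; have [d d0 dP] := H t e e0.
apply/nbhs_ballP; exists d => // s /=; rewrite /ball /= distrC => /dP.
by rewrite enormB; exact: le_lt_trans (norm_le_enorm _).
Qed.

Lemma continuous_enormP n (y : R -> 'cV[R]_n) : continuous y ->
  forall t e, 0 < e -> exists2 d, 0 < d & forall s, `|s - t| < d -> enorm (y s - y t) < e.
Proof.
move=> cy t e e0; have /nbhs_ballP[d /= d0 dP] := cy t _ (enorm_ball_nbhs (y t) e0).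
by exists d => // s sd; apply: dP; rewrite /ball /= distrC.
Qed.

Lemma borelD n (y z : R -> 'cV[R]_n) : borel_fun y -> borel_fun z -> borel_fun (fun t => y t + z t).
Proof.
move=> my mz j; rewrite (_ : (fun t => _) = (fun t => y t j 0 + z t j 0)).
  by apply: measurable_funD; [exact: my|exact: mz].
by apply/funext => t; rewrite mxE.
Qed.

Lemma borel_mulmx n k (A : 'M[R]_(k, n)) (y : R -> 'cV[R]_n) : borel_fun y ->
  borel_fun (fun t => A *m y t).
Proof.
move=> my j; rewrite (_ : (fun t => _) = (fun t => \sum_i A j i * y t i 0)).
  by apply: measurable_sum => i; apply: measurable_funM => //; exact: my.
by apply/funext => t; rewrite mxE.
Qed.

Lemma borelN n (y : R -> 'cV[R]_n) : borel_fun y -> borel_fun (fun t => - y t).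
Proof.
move=> my; have := borel_mulmx (- 1%:M) my; congr (borel_fun _).
by apply/funext => t; rewrite mulNmx mul1mx.
Qed.

Lemma borelB n (y z : R -> 'cV[R]_n) : borel_fun y -> borel_fun z -> borel_fun (fun t => y t - z t).
Proof. by move=> my mz; apply: borelD => //; exact: borelN. Qed.

Lemma borel_shift n (y : R -> 'cV[R]_n) c : borel_fun y -> borel_fun (fun t => y (t + c)).
Proof.
move=> my j; apply: (@measurableT_comp _ _ _ _ _ _ (fun t => y t j 0)) => //.
exact: measurable_funD.
Qed.

End Measurable_composition.

(** * Sharp bounds on primitives and Gronwall's inequality *)

Section Growth.
Context {R : realType}.
Notation mu := (@lebesgue_measure R).

Lemma loc_bounded_itv n (g : R -> 'cV[R]_n) a b : loc_bounded g ->
  exists2 M, 0 <= M & forall t, a <= t <= b -> enorm (g t) <= M.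
Proof.
move=> lg; have [M MP] := lg (`|a| + `|b|); exists `|M| => // t /andP[at_ tb].
apply: (le_trans (MP t _) (ler_norm M)).
rewrite ler_norml; apply/andP; split.
  by have := ler_norm (- a); have := normr_ge0 b; rewrite normrN; lra.
by have := ler_norm b; have := normr_ge0 a; lra.
Qed.

Lemma prim_lipschitz_crude n a (g : R -> 'cV[R]_n) b : borel_fun g -> loc_bounded g ->
  exists2 M, 0 <= M & forall s t, s <= t -> t <= b ->
    enorm (prim a g t - prim a g s) <= M * (t - s).
Proof.
move=> bg lg; have [M M0 MP] := loc_bounded_itv a b lg.
have nM : 0 <= n%:R * M by rewrite mulr_ge0.
exists (n%:R * M) => // s t st tb.
have [ta|/ltW at_] := lerP t a.
  by rewrite !prim_le ?(le_trans st) // subrr enorm0 mulr_ge0 // subr_ge0.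
have [sa|/ltW as_] := lerP s a.
  rewrite [prim a g s]prim_le // subr0; apply: (@le_trans _ _ (n%:R * M * (t - a))).
    by apply: enorm_prim => // x /andP[ax xt]; apply: MP; rewrite ax (le_trans xt).
  by rewrite ler_wpM2l // lerD2l lerN2.
rewrite primB //; apply: enorm_prim => // x /andP[sx xt].
by apply: MP; rewrite (le_trans as_) // (le_trans xt).
Qed.

Lemma prim_continuous n a (g : R -> 'cV[R]_n) : borel_fun g -> loc_bounded g ->
  continuous (prim a g).
Proof.
move=> bg lg; apply: enorm_continuous => t e e0.
have [M M0 MP] := prim_lipschitz_crude a (t + 1) bg lg.
have M1 : 0 < M + 1 by lra.
exists (Num.min 1 (e / (M + 1))); first by rewrite lt_min ltr01 divr_gt0.
move=> s; rewrite lt_min ltr_pdivlMr // => /andP[s1 sM].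
have H : enorm (prim a g s - prim a g t) <= M * `|s - t|.
  have [st|/ltW ts] := lerP s t.
    by rewrite enormB; apply: MP => //; lra.
  apply: MP => //.
  by move: s1; rewrite ltr_norml => /andP[]; lra.
apply: (le_lt_trans H); have := normr_ge0 (s - t); nra.
Qed.

(** No dimensional factor appears, because the Euclidean norm of the derivative is compared with
    phi' through [abs_cont_growth] instead of integrating coordinates separately. *)
Lemma prim_diff_growth n a (g g' : R -> 'cV[R]_n) (phi phi' : R -> R) t :
  borel_fun g -> loc_bounded g -> borel_fun g' -> loc_bounded g' -> a <= t ->
  (forall x y, a <= x -> x <= y -> y <= t -> phi x <= phi y) ->
  (forall s, a < s < t -> is_derive s 1 phi (phi' s)) ->
  (forall s, a < s < t -> enorm (g s - g' s) <= phi' s) ->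
  enorm (prim a g t - prim a g' t) <= phi t - phi a.
Proof.
move=> bg lg bg' lg' at_ mono dphi gphi.
have := @abs_cont_growth R n (prim a g \- prim a g') phi a t at_ _ mono.
rewrite /= [prim a g a]prim_le // [prim a g' a]prim_le // subrr subr0; apply.
  have [M M0 MP] := prim_lipschitz_crude a t bg lg.
  have [M' M0' MP'] := prim_lipschitz_crude a t bg' lg'.
  apply: (@lipschitz_abs_cont _ _ _ _ _ (M + M')) => x y ax xy yt /=.
  have -> : prim a g y - prim a g' y - (prim a g x - prim a g' x) =
    (prim a g y - prim a g x) - (prim a g' y - prim a g' x).
    by apply/matrixP => i j; rewrite !mxE; ring.
  apply: (le_trans (enormD _ _)); rewrite enormN mulrDl lerD //; [exact: MP|exact: MP'].
have := ae_and (is_derive_prim a bg lg) (is_derive_prim a bg' lg').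
apply: ae_sub => s [H H'] /andP[as_ st]; exists (g s - g' s), (phi' s); split.
- by apply: is_deriveB; [exact: H|exact: H'].
- by apply: dphi; rewrite as_.
- by apply: gphi; rewrite as_.
Qed.

Lemma borel_cst n (c : 'cV[R]_n) : borel_fun (fun=> c).
Proof. by move=> j; exact: measurable_cst. Qed.

Lemma loc_bounded_cst n (c : 'cV[R]_n) : loc_bounded (fun=> c).
Proof. by move=> b; exists (enorm c). Qed.

Lemma prim0 n a t : prim a (fun=> 0 : 'cV[R]_n) t = 0.
Proof.
by apply/matrixP => i j; rewrite !mxE /Rintegral integral0_eq // => x _; rewrite mxE.
Qed.

Lemma is_derive_lin (M t : R) : is_derive t 1 (fun s => M * s) M.
Proof.
have -> : (fun s => M * s) = M *: (id : R -> R) by [].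
by apply: is_derive_eq; rewrite /GRing.scale /= mulr1.
Qed.

Lemma is_derive_expM (k t : R) : is_derive t 1 (fun s => expR (k * s)) (k * expR (k * t)).
Proof.
have H := is_derive_lin k t.
by apply: is_derive_eq (is_derive1_comp (is_derive_expR _) H) _; rewrite mulrC.
Qed.

Lemma is_derive_lin_exp (A B k t : R) :
  is_derive t 1 (fun s => A * s + B * expR (k * s)) (A + B * (k * expR (k * t))).
Proof. exact: is_deriveD (is_derive_lin A t) (is_deriveZ B (is_derive_expM k t)). Qed.

Lemma prim_diff_le n a (g g' : R -> 'cV[R]_n) (M : R) t :
  borel_fun g -> loc_bounded g -> borel_fun g' -> loc_bounded g' -> a <= t -> 0 <= M ->
  (forall s, a < s < t -> enorm (g s - g' s) <= M) ->
  enorm (prim a g t - prim a g' t) <= M * (t - a).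
Proof.
move=> bg lg bg' lg' at_ M0 gM; rewrite mulrBr.
apply: (prim_diff_growth (phi := fun s => M * s) (phi' := fun=> M)) => //.
  by move=> x y _ xy _; rewrite ler_wpM2l.
by move=> s _; exact: is_derive_lin.
Qed.

Lemma prim_lipschitz n a (g : R -> 'cV[R]_n) (M : R) s t :
  borel_fun g -> loc_bounded g -> a <= s -> s <= t -> 0 <= M ->
  (forall x, s <= x <= t -> enorm (g x) <= M) ->
  enorm (prim a g t - prim a g s) <= M * (t - s).
Proof.
move=> bg lg as_ st M0 gM; rewrite primB // -[prim s g t]subr0 -(@prim0 n s t).
apply: (prim_diff_le bg lg (borel_cst 0) (loc_bounded_cst 0)) => //.
by move=> x /andP[sx xt]; rewrite subr0; apply: gM; rewrite (ltW sx) (ltW xt).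
Qed.

(** Composition with [clamp] extends a function from [a, b] to the whole line by its end values.
    Solutions are built and measured as continuous functions on the line, while the data are given
    on intervals. *)
Definition clamp (a b t : R) := Num.max a (Num.min t b).

Lemma clampE a b t : a <= t <= b -> clamp a b t = t.
Proof. by move=> /andP[at_ tb]; rewrite /clamp min_l // max_r. Qed.

Lemma clamp_in a b t : a <= b -> a <= clamp a b t <= b.
Proof. by move=> ab; rewrite /clamp le_max lexx /= ge_max ab ge_min lexx orbT. Qed.

Lemma clamp_mono a b s t : s <= t -> clamp a b s <= clamp a b t.
Proof.
move=> st; rewrite /clamp ge_max le_max lexx /=; rewrite le_max; apply/orP; right.
by rewrite le_min ge_min st /= ge_min lexx orbT.
Qed.

Lemma clamp_lip a b s t : s <= t -> clamp a b t - clamp a b s <= t - s.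
Proof.
rewrite /clamp => st; rewrite /Num.max /Num.min.
by case: (ltP t b) => tb; case: (ltP s b) => sb /=; case: ltP => ?; case: ltP => ? /=; lra.
Qed.

Lemma abs_cont_clamp n (g : R -> 'cV[R]_n) a b : a <= b -> abs_cont a b g ->
  continuous (fun t => g (clamp a b t)).
Proof.
move=> ab ac; apply: enorm_continuous => t e e0; have [d d0 dP] := ac e e0.
exists d => // s sd.
have key x y : x <= y -> y - x < d -> enorm (g (clamp a b y) - g (clamp a b x)) < e.
  move=> xy yx; have := dP 1%N (fun=> clamp a b x) (fun=> clamp a b y).
  rewrite !big_ord1; apply.
  - move=> _; have /andP[h1 h2] := clamp_in x ab; have /andP[h3 h4] := clamp_in y ab.
    by split=> //; exact: clamp_mono.
  - by move=> i j; rewrite !ord1.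
  - exact: le_lt_trans (clamp_lip _ _ xy) yx.
have [st|/ltW ts] := lerP s t.
  by rewrite enormB; apply: key => //; move: sd; rewrite ltr_norml => /andP[]; lra.
by apply: key => //; move: sd; rewrite ltr_norml => /andP[]; lra.
Qed.

Lemma one_le_expR (x : R) : 0 <= x -> 1 <= expR x.
Proof. by move=> x0; rewrite -expR0 ler_expR. Qed.

(** The derivative at t is controlled by a bound for y on all of [0, t], so delayed and integral
    terms are covered. With D the supremum of exp(-2 Lam t) |y t|, integration halves the
    contribution of D: D <= A0 + A c + D/2. *)
Lemma gronwall n (y : R -> 'cV[R]_n) (A0 A Lam c : R) : 0 <= c -> 0 < Lam -> 0 <= A ->
  abs_cont 0 c y -> enorm (y 0) <= A0 ->
  {ae mu, forall t : R, 0 < t < c -> exists2 l, is_derive t 1 y l &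
    forall M, (forall s, 0 <= s <= t -> enorm (y s) <= M) -> enorm l <= A + Lam * M} ->
  forall t, 0 <= t <= c -> enorm (y t) <= 2 * (A0 + A * c) * expR (2 * Lam * t).
Proof.
move=> c0 Lam0 A_0 ac y0 ae.
pose S := [set expR (- (2 * Lam * t)) * enorm (y t) | t in [set t | 0 <= t <= c]].
have [Mb Mb0 MbP] := loc_bounded_itv 0 c (continuous_loc_bounded (abs_cont_clamp c0 ac)).
have e1 t : 0 <= t -> expR (- (2 * Lam * t)) <= 1.
  by move=> t0; rewrite -expR0 ler_expR oppr_le0 mulr_ge0 // mulr_ge0 // ltW.
have supS : has_sup S.
  split; first by exists (expR (- (2 * Lam * 0)) * enorm (y 0)), 0 => //=; rewrite lexx.
  exists Mb => _ [t /= tc <-]; have /andP[t0 _] := tc.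
  have := MbP t tc; rewrite clampE // => H; apply: le_trans H.
  by rewrite ler_piMl ?enorm_ge0 ?e1.
pose D := sup S.
have DP t : 0 <= t <= c -> enorm (y t) <= D * expR (2 * Lam * t).
  move=> tc; rewrite -ler_pdivrMr ?expR_gt0 // -expRN mulrC.
  by apply: (ub_le_sup (proj2 supS)); exists t.
have D0 : 0 <= D.
  have := DP 0; rewrite lexx c0 mulr0 expR0 mulr1 => /(_ isT).
  exact: le_trans (enorm_ge0 _).
have A00 : 0 <= A0 by exact: le_trans (enorm_ge0 _) y0.
have key t : 0 <= t <= c -> enorm (y t) <= A0 + A * c + D / 2 * expR (2 * Lam * t).
  move=> /andP[t0 tc].
  pose phi s := A * s + D / 2 * expR (2 * Lam * s).
  have L2 : 0 <= 2 * Lam by rewrite mulr_ge0 // ltW.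
  have D2 : 0 <= D / 2 by rewrite divr_ge0.
  have H : enorm (y t - y 0) <= phi t - phi 0.
    apply: abs_cont_growth => //.
    - move=> e e0; have [d d0 dP] := ac e e0; exists d => // N l h lh; apply: dP => i.
      by have [h1 h2 h3] := lh i; split => //; exact: le_trans tc.
    - move=> u v u0 uv vt; rewrite /phi lerD // ler_wpM2l // ler_expR ler_wpM2l //.
    - apply: ae_sub ae => s sP /andP[s0 st].
      have [|l yl lM] := sP; first by rewrite s0 (lt_le_trans st).
      exists l, (A + Lam * (D * expR (2 * Lam * s))); split => //.
        apply: is_derive_eq (is_derive_lin_exp A (D / 2) (2 * Lam) s) _.
        by congr (_ + _); field.
      apply: lM => x /andP[x0 xs]; apply: (le_trans (DP x _)).
        by rewrite x0 (le_trans xs) // (le_trans (ltW st)).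
      by rewrite ler_wpM2l // ler_expR ler_wpM2l.
  have := enorm_distl (y t) (y 0); rewrite /phi mulr0 mulr0 expR0 in H * => H2.
  have : A * t <= A * c by rewrite ler_wpM2l.
  by move: H H2 y0 D2; lra.
have DA : D <= 2 * (A0 + A * c).
  suff : D <= A0 + A * c + D / 2 by lra.
  apply: ge_sup => //; first by case: supS.
  move=> _ [t /= tc <-]; have /andP[t0 _] := tc.
  rewrite expRN mulrC ler_pdivrMr ?expR_gt0 //; apply: (le_trans (key t tc)).
  rewrite [leRHS]mulrDl lerD2r ler_peMr ?addr_ge0 ?mulr_ge0 //.
  by rewrite -expR0 ler_expR !mulr_ge0 // ltW.
move=> t tc; apply: (le_trans (DP t tc)); by rewrite ler_wpM2r ?expR_ge0.
Qed.

End Growth.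

(** * Picard iteration for causal integral equations *)

Section Picard.
Context {R : realType}.
Notation mu := (@lebesgue_measure R).

Lemma geometric_small (K e : R) : 0 < e -> exists j : nat, K / 2 ^+ j < e.
Proof.
move=> e0; have [K0|K0] := lerP K 0.
  by exists 0%N; rewrite expr0 divr1 (le_lt_trans K0).
exists (Num.bound (K / e)); rewrite ltr_pdivrMr ?exprn_gt0 //.
rewrite mulrC -ltr_pdivrMr //.
apply: (lt_le_trans (archi_boundP _)); first by rewrite divr_ge0 // ltW.
by rewrite -natrX ler_nat ltnW // ltn_expl.
Qed.

(** The intervals with centre a_j and radius 2K/2^j are nested; the supremum of their left ends lies
    in all of them. *)
Lemma geometric_limit (a : nat -> R) (K : R) :
  (forall j, `|a j.+1 - a j| <= K / 2 ^+ j) ->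
  exists l, forall j, `|a j - l| <= 2 * K / 2 ^+ j.
Proof.
move=> aK; pose b j := a j - 2 * K / 2 ^+ j; pose c j := a j + 2 * K / 2 ^+ j.
have E j : 2 * K / 2 ^+ j.+1 = K / 2 ^+ j.
  by rewrite exprS; field; rewrite expf_neq0.
have E2 j : 2 * K / 2 ^+ j = K / 2 ^+ j + K / 2 ^+ j by rewrite -mulrA mulr_natl mulr2n.
have bS j : b j <= b j.+1.
  by rewrite /b E E2; have := aK j; rewrite ler_norml => /andP[]; lra.
have cS j : c j.+1 <= c j.
  by rewrite /c E E2; have := aK j; rewrite ler_norml => /andP[]; lra.
have K0 : 0 <= K by have := aK 0%N; rewrite expr0 divr1; exact: le_trans.
have bc j : b j <= c j.
  by rewrite /b /c lerD2l ge0_cp // ?divr_ge0 ?mulr_ge0 ?exprn_ge0.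
have bm i j : (i <= j)%N -> b i <= b j.
  by move/subnK <-; elim: (j - i)%N => // d H; rewrite addSn (le_trans H).
have cm i j : (i <= j)%N -> c j <= c i.
  by move/subnK <-; elim: (j - i)%N => // d H; rewrite addSn (le_trans (cS _)).
have bcij i j : b i <= c j.
  apply: (le_trans (bm i (maxn i j) _)); first exact: leq_maxl.
  by apply: (le_trans (bc _)); apply: cm; exact: leq_maxr.
have supb : has_sup (range b).
  by split; [exists (b 0%N), 0%N|exists (c 0%N) => _ [i _ <-]].
exists (sup (range b)) => j; rewrite ler_norml.
have h1 : b j <= sup (range b) by apply: (ub_le_sup (proj2 supb)); exists j.
have h2 : sup (range b) <= c j by apply: ge_sup; [exact: (proj1 supb)|move=> _ [i _ <-]].
by move: h1 h2; rewrite /b /c => h1 h2; apply/andP; split; lra.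
Qed.

Lemma geometric_limit_vec n (a : nat -> 'cV[R]_n) (K : R) :
  (forall j, enorm (a j.+1 - a j) <= K / 2 ^+ j) ->
  exists l, forall j, enorm (a j - l) <= n%:R * (2 * K) / 2 ^+ j.
Proof.
move=> aK.
have /choice[l lP] : forall i : 'I_n, exists l, forall j, `|a j i 0 - l| <= 2 * K / 2 ^+ j.
  move=> i; apply: geometric_limit => j; apply: le_trans (aK j).
  by have := coord_le_enorm (a j.+1 - a j) i; rewrite !mxE.
exists (\col_i l i) => j; apply: (le_trans (enorm_le_sum _)).
apply: (@le_trans _ _ (\sum_(i < n) 2 * K / 2 ^+ j)).
  by apply: ler_sum => i _; rewrite !mxE.
by rewrite sumr_const card_ord -[leLHS]mulr_natl mulrA.
Qed.

(* Causal integral equations; past values may enter [Phi y t] through [y] on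
   all of ]-oo, t]. The iteration contracts in the weighted norm
   sup exp(-2 Lam t) |y t|. *)
Lemma causal_picard n (Phi : (R -> 'cV[R]_n) -> R -> 'cV[R]_n) (h : R -> 'cV[R]_n) (Lam : R) :
  0 < Lam -> continuous h ->
  (forall y : R -> 'cV[R]_n, continuous y -> borel_fun (Phi y) /\ loc_bounded (Phi y)) ->
  (forall (y y' : R -> 'cV[R]_n) (t M : R), continuous y -> continuous y' -> 0 <= t ->
    (forall s, s <= t -> enorm (y s - y' s) <= M) ->
    enorm (Phi y t - Phi y' t) <= Lam * M) ->
  exists2 y : R -> 'cV[R]_n, continuous y & forall t : R, y t = h t + prim 0 (Phi y) t.
Proof.
move=> L0 ch mPhi lPhi.
have [L20 L2] : 0 <= 2 * Lam /\ 0 <= Lam by split; lra.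
pose T (y : R -> 'cV[R]_n) (t : R) : 'cV[R]_n := h t + prim 0 (Phi y) t.
have cT (y : R -> 'cV[R]_n) : continuous y -> continuous (T y).
  move=> cy t; apply: cvgD; first exact: ch.
  by have [b l] := mPhi y cy; exact: prim_continuous.
have TB y y' t : T y t - T y' t = prim 0 (Phi y) t - prim 0 (Phi y') t.
  by rewrite /T; apply/matrixP => i j; rewrite !mxE; ring.
(* The weight exp(2 Lam t) has the primitive exp(2 Lam t) / (2 Lam), so the Lipschitz constant Lam
   turns C into C/2. *)
have contr (y y' : R -> 'cV[R]_n) (c C : R) : continuous y -> continuous y' -> 0 <= C ->
    (forall t, t <= c -> enorm (y t - y' t) <= C * expR (2 * Lam * t) \/ t <= 0 /\ y t = y' t) ->
  forall t, t <= c -> enorm (T y t - T y' t) <= C / 2 * expR (2 * Lam * t) \/ t <= 0 /\ T y t = T y' t.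
  move=> cy cy' C0 yy' t tc.
  have [t0|/ltW t0] := lerP t 0.
    by right; split => //; apply/eqP; rewrite -subr_eq0 TB !prim_le // subrr.
  left; rewrite TB; have [b l] := mPhi y cy; have [b' l'] := mPhi y' cy'.
  apply: (@le_trans _ _ (C / 2 * expR (2 * Lam * t) - C / 2 * expR (2 * Lam * 0))).
    apply: (prim_diff_growth (phi := fun s => C / 2 * expR (2 * Lam * s))
       (phi' := fun s => Lam * (C * expR (2 * Lam * s)))) => //.
    - by move=> x z _ xz _; rewrite ler_wpM2l ?divr_ge0 // ler_expR ler_wpM2l.
    - move=> s _; apply: is_derive_eq (is_deriveZ (C / 2) (is_derive_expM (2 * Lam) s)) _.
      by rewrite /GRing.scale /=; field.
    - move=> s /andP[s0 st]; apply: lPhi => //; first exact: ltW.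
      move=> x xs; have xc : x <= c by rewrite (le_trans xs) // (le_trans (ltW st)).
      have [|[_ ->]] := yy' x xc.
        by move=> /le_trans; apply; rewrite ler_wpM2l // ler_expR ler_wpM2l.
      by rewrite subrr enorm0 mulr_ge0 ?expR_ge0.
  by rewrite lerBlDr lerDl mulr_ge0 ?divr_ge0 ?expR_ge0.
pose Y j := iter j T h.
have cY j : continuous (Y j) by elim: j => //= j; exact: cT.
pose S (c : R) := [set enorm (Y 1%N t - Y 0%N t) | t in [set t | t <= c]].
have Y10 t : t <= 0 -> Y 1%N t - Y 0%N t = 0.
  by move=> t0; rewrite /= /T prim_le // addr0 subrr.
have supS c : has_sup (S c).
  split; first by exists (enorm (Y 1%N c - Y 0%N c)), c => /=.
  have [M M0 MP] : exists2 M, 0 <= M & forall t, 0 <= t <= c -> enorm (Y 1%N t - Y 0%N t) <= M.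
    apply: (loc_bounded_itv 0 c (continuous_loc_bounded _)) => t.
    by apply: cvgB; exact: cY.
  exists M => _ [t /= tc <-]; have [t0|/ltW t0] := lerP t 0.
    by rewrite Y10 // enorm0.
  by apply: MP; rewrite t0.
pose B c := sup (S c).
have B0 c : 0 <= B c.
  by apply: (le_trans (enorm_ge0 (Y 1%N c - Y 0%N c))); apply: (ub_le_sup (proj2 (supS c))); exists c => /=.
have Bmono c c' : c <= c' -> B c <= B c'.
  move=> cc'; apply: ge_sup; first exact: (proj1 (supS c)).
  by move=> _ [t /= tc <-]; apply: (ub_le_sup (proj2 (supS c'))); exists t => //=; exact: le_trans cc'.
have Yj c j t : t <= c -> enorm (Y j.+1 t - Y j t) <= B c / 2 ^+ j * expR (2 * Lam * t) \/
    t <= 0 /\ Y j.+1 t = Y j t.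
  move=> tc; have := tc; elim: j t tc => [|j IH] t tc _.
    have [t0|/ltW t0] := lerP t 0.
      by right; split => //; apply/eqP; rewrite -subr_eq0 Y10.
    left; rewrite expr0 divr1; apply: (@le_trans _ _ (B c)).
      by apply: (ub_le_sup (proj2 (supS c))); exists t.
    by rewrite ler_peMr // one_le_expR // mulr_ge0.
  have -> : B c / 2 ^+ j.+1 = B c / 2 ^+ j / 2 by rewrite exprS invfM mulrA [in LHS]mulrAC.
  have C0 : 0 <= B c / 2 ^+ j by rewrite divr_ge0 ?exprn_ge0.
  exact: (contr (Y j.+1) (Y j) c _ (cY _) (cY _) C0 (fun s sc => IH s sc sc) t tc).
pose E (c : R) := expR (2 * Lam * `|c|).
have Yj' c j t : t <= c -> enorm (Y j.+1 t - Y j t) <= B c * E c / 2 ^+ j.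
  move=> tc; have [|[_ ->]] := Yj c j t tc.
    move=> /le_trans; apply; rewrite mulrAC ler_wpM2r ?invr_ge0 ?exprn_ge0 //.
    rewrite ler_wpM2l // ler_expR ler_wpM2l // (le_trans tc) //; exact: ler_norm.
  by rewrite subrr enorm0 divr_ge0 ?exprn_ge0 // mulr_ge0 ?expR_ge0.
have /choice[y yP] : forall t, exists l, forall j, enorm (Y j t - l) <= n%:R * (2 * (B t * E t)) / 2 ^+ j.
  by move=> t; apply: geometric_limit_vec => j; exact: Yj'.
(* The limit is chosen point by point with a constant depending on t; as B is monotone, K c is a
   common constant on ]-oo, c]. Convergence is thus uniform there, which gives continuity of y and
   lets the limit pass through [Phi]. *)
pose K (c : R) := n%:R * (2 * (B c * expR (2 * Lam * c))).
have K0 c : 0 <= K c by rewrite !mulr_ge0 ?expR_ge0.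
have y_neg t : t <= 0 -> y t = h t.
  move=> t0; have YE j : Y j t = h t.
    by elim: j => //= j IH; rewrite /T prim_le // addr0.
  apply/eqP; rewrite -subr_eq0; apply/eqP; apply: enorm_eq0; apply/ler_addgt0Pl => e e0.
  have [j je] := geometric_small (n%:R * (2 * (B t * E t))) e0.
  by rewrite addr0 enormB -(YE j); apply: (le_trans (yP t j)); exact: ltW.
have yK c j t : 0 <= c -> t <= c -> enorm (Y j t - y t) <= K c / 2 ^+ j.
  move=> c0 tc; have [t0|/ltW t0] := lerP t 0.
    rewrite y_neg // (_ : Y j t = h t) ?subrr ?enorm0 ?divr_ge0 ?exprn_ge0 //.
    by elim: j => //= j IH; rewrite /T prim_le // addr0.
  apply: (le_trans (yP t j)); rewrite ler_wpM2r ?invr_ge0 ?exprn_ge0 //.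
  rewrite ler_wpM2l // ler_wpM2l // ler_pM ?expR_ge0 //; first exact: Bmono.
  by rewrite ler_expR ler_wpM2l // ger0_norm.
have cy : continuous y.
  apply: enorm_continuous => t e e0; have e30 : 0 < e / 3 by lra.
  pose c := `|t| + 1; have c0 : 0 <= c by rewrite addr_ge0.
  have [j je] := geometric_small (K c) e30.
  have [d d0 dP] := continuous_enormP (@cY j) t e30.
  exists (Num.min d 1); first by rewrite lt_min d0 ltr01.
  move=> s; rewrite lt_min => /andP[sd s1].
  have sc : s <= c by move: s1; rewrite ltr_norml => /andP[_]; have := ler_norm t; rewrite /c; lra.
  have tc : t <= c by have := ler_norm t; rewrite /c; lra.
  have h1 := le_lt_trans (yK c j s c0 sc) je.
  have h2 := le_lt_trans (yK c j t c0 tc) je; have h3 := dP s sd.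
  have := enorm_triangle (y s) (Y j s) (y t); have := enorm_triangle (Y j s) (Y j t) (y t).
  by rewrite (enormB (y s) (Y j s)); move: h1 h2 h3; lra.
exists y => // t; rewrite -/(T y t).
have [t0|/ltW t0] := lerP t 0; first by rewrite y_neg // /T prim_le // addr0.
apply/eqP; rewrite -subr_eq0; apply/eqP; apply: enorm_eq0; apply/ler_addgt0Pl => e e0.
have [j je] := geometric_small (K t * (1 + Lam * t)) e0; rewrite addr0.
apply: (le_trans (enorm_triangle _ (Y j.+1 t) _)).
have h1 : enorm (y t - Y j.+1 t) <= K t / 2 ^+ j.
  rewrite enormB; apply: (le_trans (yK t j.+1 t t0 (lexx _))).
  by rewrite ler_wpM2l // exprS invfM ler_piMl ?invr_ge0 ?exprn_ge0 // invf_le1 // ler1n.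
have h2 : enorm (Y j.+1 t - T y t) <= Lam * (K t / 2 ^+ j) * (t - 0).
  rewrite [Y j.+1 t]/= -/(Y j) TB; have [b l] := mPhi _ (cY j); have [b' l'] := mPhi y cy.
  apply: prim_diff_le => //; first by rewrite mulr_ge0 // divr_ge0 ?exprn_ge0.
  move=> s /andP[s0 st]; apply: lPhi => //; first exact: ltW.
  by move=> x xs; apply: yK => //; rewrite (le_trans xs) // ltW.
apply: (le_trans (lerD h1 h2)); apply: le_trans (ltW je).
by rewrite subr0 le_eqVlt; apply/orP; left; apply/eqP; ring.
Qed.

End Picard.

Lemma subrBB (V : zmodType) (a b c d : V) : a - b - (c - d) = a - c - (b - d).
Proof. by rewrite !opprB addrACA [in RHS]addrACA [- b - c]addrC. Qed.

Lemma gain_diff (R : pzRingType) n k (K : 'M[R]_(n, k)) (H : 'M[R]_(k, n))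
    (a a' y y' : 'cV[R]_n) (s s' : 'cV[R]_k) :
  a + K *m (H *m y - s) - (a' + K *m (H *m y' - s')) =
  (a - a') + (K *m (H *m (y - y')) - K *m (s - s')).
Proof.
by rewrite opprD addrACA -!mulmxBr subrBB !mulmxBr.
Qed.

Lemma gain_error (R : pzRingType) n k (K : 'M[R]_(n, k)) (H : 'M[R]_(k, n))
    (a b y x : 'cV[R]_n) (w : 'cV[R]_k) :
  a + K *m (H *m y - w) - b = (a - b) + (K *m (H *m (y - x)) - K *m (w - H *m x)).
Proof.
by rewrite addrAC -mulmxBr [H *m (_ - _)]mulmxBr opprB addrA subrK.
Qed.

(** * Differentiation rules, local Lipschitz continuity and uniqueness tools *)

Section Calculus.
Context {R : realType}.
Notation mu := (@lebesgue_measure R).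

Lemma is_derive_local (V : normedModType R) (F F' : R -> V) (t : R) l d : 0 < d ->
  (forall s, `|s - t| < d -> F s = F' s) -> is_derive t 1 F l -> is_derive t 1 F' l.
Proof.
move=> d0 FF; apply: near_eq_is_derive; apply/nbhs_ballP; exists d => // s.
by rewrite /ball /= distrC => /FF.
Qed.

Lemma is_derive_right (V : normedModType R) (F F' : R -> V) (t : R) l : 0 < t ->
  (forall s, 0 < s -> F s = F' s) -> is_derive t 1 F l -> is_derive t 1 F' l.
Proof.
move=> t0 FF; apply: (is_derive_local t0) => s; rewrite ltr_norml => /andP[h1 h2].
by apply: FF; lra.
Qed.

Lemma is_derive_shift n (F : R -> 'cV[R]_n) (t c : R) l :
  is_derive (t + c) 1 F l -> is_derive t 1 (fun s => F (s + c)) l.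
Proof.
move=> /is_derive_cvE H; apply/is_derive_cvE => j.
have d1 : is_derive t 1 (fun s : R => s + c) (1 : R).
  by apply: is_derive_eq (is_deriveD (is_derive_id t 1) (is_derive_cst c t 1)) _; rewrite addr0.
by apply: is_derive_eq (@is_derive1_comp R (fun s => F s j 0) (fun s => s + c) t _ _ (H j) d1) _;
   rewrite mulr1.
Qed.

Lemma is_derive_mulmx n k (A : 'M[R]_(k, n)) (F : R -> 'cV[R]_n) (t : R) l :
  is_derive t 1 F l -> is_derive t 1 (fun s => A *m F s) (A *m l).
Proof.
move=> /is_derive_cvE H; apply/is_derive_cvE => j; rewrite mxE.
have := is_derive_sum (fun i => is_deriveZ (A j i) (H i)).
by congr (is_derive _ _ _ _); apply/funext => s; rewrite mxE fct_sumE.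
Qed.

Lemma is_derive_expN (mu0 t : R) n (G0 : 'cV[R]_n) :
  is_derive t 1 (fun s => expR (- mu0 * s) *: G0) (- mu0 *: (expR (- mu0 * t) *: G0)).
Proof.
apply/is_derive_cvE => j; rewrite !mxE.
have E : (fun s => (expR (- mu0 * s) *: G0) j 0) = (G0 j 0 \*: (fun s => expR (- mu0 * s))).
  by apply/funext => s; rewrite mxE mulrC.
rewrite E; apply: is_derive_eq (is_deriveZ (G0 j 0) (is_derive_expM (- mu0) t)) _.
by rewrite /GRing.scale /=; ring.
Qed.

Lemma is_deriveD_fun n (f g : R -> 'cV[R]_n) (t : R) l l' :
  is_derive t 1 f l -> is_derive t 1 g l' -> is_derive t 1 (fun s => f s + g s) (l + l').
Proof. by move=> fl gl; exact: is_deriveD. Qed.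

Lemma is_deriveB_fun n (f g : R -> 'cV[R]_n) (t : R) l l' :
  is_derive t 1 f l -> is_derive t 1 g l' -> is_derive t 1 (fun s => f s - g s) (l - l').
Proof. by move=> fl gl; exact: is_deriveB. Qed.

Lemma is_derive_addc n (v : 'cV[R]_n) (g : R -> 'cV[R]_n) (t : R) l :
  is_derive t 1 g l -> is_derive t 1 (fun s => v + g s) l.
Proof.
by move=> gl; have := is_deriveD_fun (is_derive_cst v t 1) gl; rewrite add0r.
Qed.

(** The constructed solutions have locally bounded derivatives, so this replaces local absolute
    continuity for them: it passes to sums, shifts and linear images with explicit constants. *)
Definition lip_loc n (y : R -> 'cV[R]_n) (a : R) :=
  forall c, exists2 M, 0 <= M &
    forall s t, a <= s -> s <= t -> t <= c -> enorm (y t - y s) <= M * (t - s).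

Lemma lip_loc_abs_cont n (y : R -> 'cV[R]_n) a c : lip_loc y a -> abs_cont a c y.
Proof.
by move=> /(_ c)[M M0 MP]; apply: (lipschitz_abs_cont (M := M)) => x z ax xz zc; exact: MP.
Qed.

Lemma lip_loc_prim n a (g : R -> 'cV[R]_n) b : borel_fun g -> loc_bounded g ->
  lip_loc (prim a g) b.
Proof.
move=> bg lg c; have [M M0 MP] := prim_lipschitz_crude a c bg lg.
by exists M => // s t _ st tc; exact: MP.
Qed.

Lemma lip_locD n (y z : R -> 'cV[R]_n) a : lip_loc y a -> lip_loc z a -> lip_loc (fun t => y t + z t) a.
Proof.
move=> ly lz c; have [M M0 MP] := ly c; have [N N0 NP] := lz c.
exists (M + N) => [|s t as_ st tc]; first exact: addr_ge0.
have -> : y t + z t - (y s + z s) = (y t - y s) + (z t - z s).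
  by apply/matrixP => i j; rewrite !mxE; ring.
by apply: (le_trans (enormD _ _)); rewrite mulrDl lerD ?MP ?NP.
Qed.

Lemma lip_locS n (y : R -> 'cV[R]_n) a b : a <= b -> lip_loc y a -> lip_loc y b.
Proof.
move=> ab ly c; have [M M0 MP] := ly c; exists M => // s t bs st tc.
by apply: MP => //; exact: le_trans bs.
Qed.

Lemma lip_loc_eq n (y z : R -> 'cV[R]_n) a : (forall t, a <= t -> y t = z t) ->
  lip_loc y a -> lip_loc z a.
Proof.
move=> yz ly c; have [M M0 MP] := ly c; exists M => // s t as_ st tc.
by rewrite -!yz ?MP // (le_trans as_).
Qed.

Lemma lip_loc_cst n (v : 'cV[R]_n) a : lip_loc (fun=> v) a.
Proof. by move=> c; exists 0 => // s t _ _ _; rewrite subrr enorm0 mul0r. Qed.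

Lemma expN_lip (mu0 s t : R) : 0 <= mu0 -> 0 <= s -> s <= t ->
  `|expR (- mu0 * t) - expR (- mu0 * s)| <= mu0 * (t - s).
Proof.
move=> m0 s0 st; rewrite ler0_norm; last first.
  by rewrite subr_le0 ler_expR !mulNr lerN2 ler_wpM2l.
have -> : - mu0 * t = - mu0 * s + - (mu0 * (t - s)) by ring.
rewrite expRD opprB -{1}(mulr1 (expR _)) -mulrBr.
have h1 : expR (- mu0 * s) <= 1.
  by rewrite -expR0 ler_expR mulNr oppr_le0 mulr_ge0.
have h2 : 1 - expR (- (mu0 * (t - s))) <= mu0 * (t - s).
  by have := expR_ge1Dx (- (mu0 * (t - s))); lra.
apply: le_trans h2; rewrite ler_piMl // subr_ge0 -expR0 ler_expR oppr_le0.
by rewrite mulr_ge0 // subr_ge0.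
Qed.

Lemma lip_loc_expN n (mu0 : R) (G0 : 'cV[R]_n) : 0 <= mu0 ->
  lip_loc (fun t => expR (- mu0 * t) *: G0) 0.
Proof.
move=> m0 c; exists (mu0 * enorm G0) => [|s t s0 st tc]; first by rewrite mulr_ge0 ?enorm_ge0.
by rewrite -scalerBl enormZ mulrAC ler_wpM2r ?enorm_ge0 // expN_lip.
Qed.

Lemma continuous_comp_clamp n (y : R -> 'cV[R]_n) (a b : R) : a <= b ->
  {within `[a, b], continuous y} -> continuous (fun t => y (clamp a b t)).
Proof.
move=> ab /subspace_continuousP cy; apply: enorm_continuous => t e e0.
have := cy (clamp a b t); rewrite /= in_itv/= clamp_in // => /(_ isT _ (enorm_ball_nbhs _ e0)).
move=> /nbhs_ballP[d /= d0 dP].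
exists d => // s sd; apply: dP; last by rewrite /= in_itv/= clamp_in.
rewrite /ball /=; apply: le_lt_trans sd; have [st|/ltW ts] := lerP s t.
  by rewrite ger0_norm ?subr_ge0 ?clamp_mono // clamp_lip.
by rewrite ler0_norm ?subr_le0 ?clamp_mono // opprB clamp_lip.
Qed.

Lemma continuous_reparam n (y : R -> 'cV[R]_n) (q : R -> R) : continuous y ->
  (forall s t, s <= t -> `|q t - q s| <= t - s) -> continuous (fun t => y (q t)).
Proof.
move=> cy lq; apply: enorm_continuous => t e e0.
have [d d0 dP] := continuous_enormP cy (q t) e0; exists d => // s sd; apply: dP.
apply: le_lt_trans sd; have [st|/ltW ts] := lerP s t.
  by rewrite distrC lq.
by rewrite lq.
Qed.

Lemma max0_lip (s t : R) : s <= t -> `|Num.max 0 t - Num.max 0 s| <= t - s.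
Proof.
by move=> st; rewrite ler_norml /Num.max; apply/andP; split; case: ltP => ?; case: ltP => ?; lra.
Qed.

Lemma shift_lip (c s t : R) : s <= t -> `|(t + c) - (s + c)| <= t - s.
Proof. by move=> st; rewrite ger0_norm; lra. Qed.

Lemma lip_loc_continuous n (y : R -> 'cV[R]_n) : lip_loc y 0 ->
  continuous (fun t : R => y (Num.max 0 t)).
Proof.
move=> ly; apply: enorm_continuous => t e e0.
have [M M0 MP] := ly (`|t| + 1); have M1 : 0 < M + 1 by lra.
exists (Num.min 1 (e / (M + 1))); first by rewrite lt_min ltr01 divr_gt0.
move=> s; rewrite lt_min ltr_pdivlMr // => /andP[s1 sM].
have mx (x : R) : x <= `|t| + 1 -> Num.max 0 x <= `|t| + 1.
  by move=> xt; rewrite ge_max xt andbT addr_ge0.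
have tt := ler_norm t.
have ht : Num.max 0 t <= `|t| + 1 by apply: mx; lra.
have hs : Num.max 0 s <= `|t| + 1.
  by apply: mx; move: s1; rewrite ltr_norml => /andP[]; lra.
have m0 (x : R) : 0 <= Num.max 0 x by rewrite le_max lexx.
have mm (x z : R) : x <= z -> Num.max 0 x <= Num.max 0 z.
  by move=> xz; rewrite ge_max !le_max lexx xz /= orbT.
have H : enorm (y (Num.max 0 s) - y (Num.max 0 t)) <= M * `|s - t|.
  have [st|/ltW ts] := lerP s t.
    rewrite enormB; apply: (le_trans (MP _ _ (m0 s) (mm _ _ st) ht)); rewrite ler_wpM2l //.
    exact: le_trans (ler_norm _) (max0_lip st).
  apply: (le_trans (MP _ _ (m0 t) (mm _ _ ts) hs)); rewrite ler_wpM2l //.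
  exact: le_trans (ler_norm _) (max0_lip ts).
apply: (le_lt_trans H); have := normr_ge0 (s - t); move: sM M0; clear; nra.
Qed.

Lemma prim_ext n a (g g' : R -> 'cV[R]_n) t :
  (forall s, a <= s <= t -> g s = g' s) -> prim a g t = prim a g' t.
Proof.
move=> gg; apply/matrixP => i j; rewrite !mxE; apply: eq_Rintegral => s.
by rewrite inE /= in_itv/= => /gg ->.
Qed.

Lemma abs_cont_eq0 n (y : R -> 'cV[R]_n) (c : R) : 0 <= c -> abs_cont 0 c y ->
  y 0 = 0 -> {ae mu, forall t, 0 < t < c -> is_derive t 1 y 0} -> y c = 0.
Proof.
move=> c0 ac y0 ae; apply: enorm_eq0.
suff : enorm (y c - y 0) <= 0 - 0 by rewrite y0 !subr0.
apply: (@abs_cont_growth R n y (fun=> 0) 0 c) => //.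
apply: ae_sub ae => t H /H yt; exists 0, 0; split => //; last by rewrite enorm0.
exact: is_derive_cst.
Qed.

Lemma abs_contB n (y z : R -> 'cV[R]_n) a b : abs_cont a b y -> abs_cont a b z ->
  abs_cont a b (fun t => y t - z t).
Proof.
move=> ay az e e0; have e20 : 0 < e / 2 by lra.
have [d d0 dP] := ay _ e20; have [d' d'0 d'P] := az _ e20.
exists (Num.min d d'); first by rewrite lt_min d0.
move=> N l h lh dj; rewrite lt_min => /andP[s1 s2].
have h1 := dP N l h lh dj s1; have h2 := d'P N l h lh dj s2.
apply: (@le_lt_trans _ _ (\sum_(i < N) enorm (y (h i) - y (l i)) + \sum_(i < N) enorm (z (h i) - z (l i)))).
  rewrite -big_split /=; apply: ler_sum => i _.
  have -> : y (h i) - z (h i) - (y (l i) - z (l i)) = (y (h i) - y (l i)) - (z (h i) - z (l i)).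
    by apply/matrixP => q j; rewrite !mxE; ring.
  by apply: (le_trans (enormD _ _)); rewrite enormN.
lra.
Qed.

Lemma lip_loc_mulmx n k (A : 'M[R]_(k, n)) (y : R -> 'cV[R]_n) a : lip_loc y a ->
  lip_loc (fun t => A *m y t) a.
Proof.
move=> ly c; have [M M0 MP] := ly c; exists (opnorm A * M) => [|s t as_ st tc].
  by rewrite mulr_ge0 ?opnorm_ge0.
rewrite -mulmxBr -mulrA; apply: (le_trans (enorm_mulmx _ _)).
by rewrite ler_wpM2l ?opnorm_ge0 ?MP.
Qed.

Lemma gronwall_unique n (y y' : R -> 'cV[R]_n) (Lam c : R) : 0 <= c -> 0 < Lam ->
  abs_cont 0 c y -> abs_cont 0 c y' -> y' 0 = y 0 ->
  {ae mu, forall t : R, 0 < t < c -> exists l l', [/\ is_derive t 1 y l, is_derive t 1 y' l' &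
    forall M, (forall s, 0 <= s <= t -> enorm (y' s - y s) <= M) -> enorm (l' - l) <= Lam * M]} ->
  forall t, 0 <= t <= c -> y' t = y t.
Proof.
move=> c0 L0 ac ac' y0 ae t tc; apply/eqP; rewrite -subr_eq0; apply/eqP; apply: enorm_eq0.
have := @gronwall R n (fun s => y' s - y s) 0 0 Lam c c0 L0 (lexx _) (abs_contB ac' ac).
rewrite y0 subrr enorm0 => /(_ (lexx _)) H.
apply: (le_trans (H _ t tc)); last by rewrite mul0r addr0 mulr0 mul0r.
apply: ae_sub ae => s sP /sP[l [l' [yl yl' lM]]]; exists (l' - l).
  exact: is_deriveB_fun yl' yl.
by move=> M /lM; rewrite add0r.
Qed.

(** A competing solution is known on a bounded interval only. The extension makes its right-hand
    side a locally bounded Borel function on the line, to which [prim] applies. *)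
Lemma extension_continuous n (y0 y : R -> 'cV[R]_n) (a c : R) : 0 <= c ->
  continuous y0 -> (forall t, a <= t <= 0 -> y t = y0 t) -> abs_cont 0 c y -> a <= 0 ->
  exists2 yc : R -> 'cV[R]_n, continuous yc & forall t, a <= t <= c -> yc t = y t.
Proof.
move=> c0 cy0 yy0 ac a0.
exists (fun t => y0 (clamp a 0 t) + (y (clamp 0 c t) - y 0)).
  move=> t; apply: cvgD.
    apply: (continuous_reparam cy0) => s s' ss'.
    by rewrite ger0_norm ?subr_ge0 ?clamp_mono // clamp_lip.
  by apply: cvgB; [exact: (abs_cont_clamp c0 ac)|exact: cvg_cst].
move=> t /andP[at_ tc]; have y00 : y 0 = y0 0 by apply: yy0; rewrite a0 lexx.
have [t0|/ltW t0] := lerP t 0.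
  rewrite clampE ?at_ // /clamp min_l // max_l // subrr addr0 yy0 //.
  by rewrite at_.
rewrite [clamp 0 c t]clampE ?t0 // {1}/clamp min_r // max_r // y00.
by rewrite addrC subrK.
Qed.

End Calculus.

(** * Extrema over balls and spheres *)

Section Compactness.
Context {R : realType}.

(** Compactness and the extreme value theorems below are for row vectors; continuity of functions of
    columns is carried over by transposition. *)
Lemma continuous_trmx n (f : 'cV[R]_n -> R) :
  (forall x e, 0 < e -> exists2 d, 0 < d & forall y, enorm (y - x) < d -> `|f y - f x| < e) ->
  continuous (fun v : 'rV[R]_n => f v^T).
Proof.
move=> H v; have FF : Filter (nbhs v) by exact: nbhs_filter.
apply/cvgrPdist_lt => e e0; have [d d0 dP] := H v^T e e0.
have n1 : 0 < n%:R + 1 :> R by rewrite ltr_wpDl.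
have : \forall w \near v, ball v (d / (n%:R + 1)) w by apply: nbhsx_ballx; rewrite divr_gt0.
apply: filterS => w; rewrite -ball_normE /ball_ /= ltr_pdivlMr // => vw; rewrite distrC; apply: dP.
apply: le_lt_trans vw; apply: (le_trans (enorm_le_sum _)).
apply: (@le_trans _ _ (\sum_(i < n) `|v - w|)).
  apply: ler_sum => i _; rewrite !mxE distrC [leRHS]/Num.Def.normr/= mx_normrE.
  apply: (le_trans _ (le_bigmax _ (fun i : 'I_1 * 'I_n => `|(v - w) i.1 i.2|) (0, i))).
  by rewrite /= !mxE.
by rewrite sumr_const card_ord -[leLHS]mulr_natr ler_wpM2l // lerDl.
Qed.

Lemma rV_bounded_closed n (s : R) (A : set 'rV[R]_n) :
  (forall v, A v -> enorm v^T <= s) -> bounded_set A.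
Proof.
move=> As; exists s; split; first exact: num_real.
move=> x sx v /As vs; apply: le_trans (ltW sx); apply: le_trans vs.
rewrite [leLHS]/Num.Def.normr/= mx_normrE bigmax_le ?enorm_ge0 // => -[i j] _ /=.
by have := coord_le_enorm v^T j; rewrite mxE ord1.
Qed.

Lemma enorm_dist n (x y : 'cV[R]_n) : `|enorm y - enorm x| <= enorm (y - x).
Proof.
have := enorm_distl x y; have := enorm_distl y x; rewrite (enormB x y) ler_norml.
by move=> h1 h2; apply/andP; split; lra.
Qed.

Lemma continuous_enorm_tr n : continuous (fun v : 'rV[R]_n => enorm v^T).
Proof.
apply: continuous_trmx => x e e0; exists e => // y; exact: le_lt_trans (enorm_dist _ _).
Qed.

Lemma bounded_on_ball n k (g : 'cV[R]_n -> 'cV[R]_k) : continuous g ->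
  forall s, exists M, forall u, enorm u <= s -> enorm (g u) <= M.
Proof.
move=> cg s; have [s0|s0] := ltrP s 0.
  by exists 0 => u us; have := lt_le_trans s0 (le_trans (enorm_ge0 u) us); rewrite ltxx.
pose A := [set v : 'rV[R]_n | enorm v^T <= s].
have cf : continuous (fun v : 'rV[R]_n => enorm (g v^T)).
  apply: (@continuous_trmx n (fun u => enorm (g u))) => x e e0.
  have /nbhs_enorm_ball[d d0 dP] := cg x _ (enorm_ball_nbhs (g x) e0).
  exists d => // y /dP; exact: le_lt_trans (enorm_dist _ _).
have cA : compact A.
  apply: bounded_closed_compact; first by apply: (@rV_bounded_closed _ s).
  rewrite (_ : A = (fun v : 'rV[R]_n => enorm v^T) @^-1` [set x | x <= s]) //.
  by apply: preimage_closed; [move=> v _; exact: continuous_enorm_tr|exact: closed_le].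
have A0 : A !=set0 by exists 0; rewrite /A /= trmx0 enorm0.
have [c _ cM] := EVT_max_rV A0 cA (continuous_subspaceT (fun v => @cf v)).
exists (enorm (g c^T)) => u us; have := cM u^T.
by rewrite trmxK; apply; rewrite inE /A /= trmxK.
Qed.

Lemma bilin_bound n (P : 'M[R]_n) x y : `|bilin P x y| <= opnorm P * enorm x * enorm y.
Proof.
apply: (le_trans (bilin_le P x y)); rewrite mulrC [opnorm P * _]mulrC -mulrA mulrC.
by rewrite ler_wpM2l ?enorm_ge0 ?enorm_mulmx.
Qed.

Lemma bilin_diff n (P : 'M[R]_n) x y :
  bilin P y y - bilin P x x = bilin P (y - x) y + bilin P x (y - x).
Proof. by rewrite !(bilinDl, bilinDr, bilinNr, bilinNl); ring. Qed.

(** The form attains its infimum on the compact sphere, at a non-zero vector, so the infimum is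
    positive; homogeneity of degree two extends the bound to all x. *)
Lemma min_sphereP n (P : 'M[R]_n) : (0 < n)%N -> sym_posdef P ->
  0 < min_sphere P /\ forall x, min_sphere P * enorm x ^+ 2 <= bilin P x x.
Proof.
move=> n0 [sP pP]; pose A := [set v : 'rV[R]_n | enorm v^T = 1].
pose S := [set bilin P x x | x in [set x : 'cV[R]_n | enorm x = 1]].
have cf : continuous (fun v : 'rV[R]_n => bilin P v^T v^T).
  apply: (@continuous_trmx n (fun u => bilin P u u)) => x e e0.
  have K0 : 0 < opnorm P * (2 * enorm x + 1) + 1.
    by rewrite ltr_wpDl // mulr_ge0 ?opnorm_ge0 // addr_ge0 // mulr_ge0 // enorm_ge0.
  exists (Num.min 1 (e / (opnorm P * (2 * enorm x + 1) + 1))).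
    by rewrite lt_min ltr01 divr_gt0.
  move=> y; rewrite lt_min ltr_pdivlMr // => /andP[y1 ye].
  apply: le_lt_trans ye; rewrite bilin_diff; apply: (le_trans (ler_normD _ _)).
  apply: (le_trans (lerD (bilin_bound _ _ _) (bilin_bound _ _ _))).
  have h := enorm_distl y x; have := enorm_ge0 (y - x); have := opnorm_ge0 P.
  move: (opnorm P) (enorm (y - x)) (enorm x) (enorm y) h y1; clear.
  move=> a b c d h y1 a0 b0.
  have : 0 <= a * b * (2 * c + 1 - c - d) by apply: mulr_ge0; [exact: mulr_ge0|lra].
  nra.
have cA : compact A.
  apply: bounded_closed_compact; first by apply: (@rV_bounded_closed _ 1) => v ->.
  rewrite (_ : A = (fun v : 'rV[R]_n => enorm v^T) @^-1` [set x | x = 1]) //.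
  by apply: preimage_closed; [move=> v _; exact: continuous_enorm_tr|exact: closed_eq].
have A0 : A !=set0.
  exists (delta_mx 0 (Ordinal n0)); rewrite /A /= trmx_delta /enorm.
  rewrite (bigD1 (Ordinal n0)) //= mxE !eqxx big1 ?addr0 ?expr1n ?sqrtr1 //.
  by move=> i ni; rewrite mxE (negbTE ni) expr0n.
have [c cA' cM] := EVT_min_rV A0 cA (continuous_subspaceT (fun v => @cf v)).
have c1 : enorm c^T = 1 by move: cA'; rewrite inE.
have lb : lbound S (bilin P c^T c^T).
  by move=> _ [x /= x1 <-]; have := cM x^T; rewrite trmxK; apply; rewrite inE /A /= trmxK.
have S0 : S !=set0 by exists (bilin P c^T c^T), c^T.
have c0 : 0 < bilin P c^T c^T.
  by apply: pP; apply/eqP => c0; move: c1; rewrite c0 enorm0 => /eqP; rewrite eq_sym oner_eq0.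
split; first by apply: (lt_le_trans c0); exact: lb_le_inf.
move=> x; have [x0|x0] := lerP (enorm x) 0.
  rewrite (enorm_eq0 x0) enorm0 expr0n mulr0.
  by rewrite /bilin mulmx0 mxE.
have : min_sphere P <= bilin P ((enorm x)^-1 *: x) ((enorm x)^-1 *: x).
  apply: ge_inf; first by exists (bilin P c^T c^T).
  exists ((enorm x)^-1 *: x) => //=.
  by rewrite enormZ ger0_norm ?invr_ge0 ?enorm_ge0 // mulVf // gt_eqF.
rewrite bilinZl bilinZr mulrA -invfM -expr2 mulrC ler_pdivlMr ?exprn_gt0 //.
Qed.

Lemma min_sphere_le_opnorm n (P : 'M[R]_n) : (0 < n)%N -> sym_posdef P ->
  min_sphere P <= opnorm P.
Proof.
move=> n0 hP; have [_ H] := min_sphereP n0 hP.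
have := le_trans (H (delta_mx (Ordinal n0) 0)) (bilin_le_opnorm _ _).
have -> : enorm (delta_mx (Ordinal n0) 0 : 'cV[R]_n) = 1.
  rewrite /enorm (bigD1 (Ordinal n0)) //= mxE !eqxx big1 ?addr0 ?expr1n ?sqrtr1 //.
  by move=> i ni; rewrite mxE (negbTE ni) expr0n.
by rewrite expr1n !mulr1.
Qed.

End Compactness.

(** * Exponential decay from the quadratic Lyapunov function *)

Section Lyapunov.
Context {R : realType}.
Notation mu := (@lebesgue_measure R).

Lemma is_derive_bilin n (P : 'M[R]_n) (e : R -> 'cV[R]_n) (t : R) l : P^T = P ->
  is_derive t 1 e l -> is_derive t 1 (fun s => bilin P (e s) (e s)) (2 * bilin P (e t) l).
Proof.
move=> sP el; have Pel := is_derive_mulmx P el.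
have /is_derive_cvE d1 := el; have /is_derive_cvE d2 := Pel.
have := is_derive_sum (fun i => is_deriveM (d1 i) (d2 i)).
have -> : (\sum_(i < n) (fun s => e s i 0) * (fun s => (P *m e s) i 0)) =
   (fun s => bilin P (e s) (e s)).
  by apply/funext => s; rewrite fct_sumE bilinE.
move=> H; apply: is_derive_eq H _.
rewrite big_split /= -[X in _ + X = _]/(\sum_(i < n) (P *m e t) i 0 * l i 0).
rewrite mulr_natl mulr2n; congr (_ + _); first by rewrite bilinE.
by rewrite bilinC // bilinE; apply: eq_bigr => i _; rewrite mulrC.
Qed.

Lemma expR_lip (k b s t : R) : 0 <= k -> s <= t -> t <= b ->
  `|expR (k * t) - expR (k * s)| <= k * expR (k * b) * (t - s).
Proof.
move=> k0 st tb; have kst : k * s <= k * t by rewrite ler_wpM2l.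
rewrite ger0_norm ?subr_ge0 ?ler_expR //.
have -> : k * s = k * t + - (k * (t - s)) by ring.
rewrite expRD -{1}(mulr1 (expR _)) -mulrBr [k * expR _]mulrC -mulrA.
have h := expR_ge1Dx (- (k * (t - s))).
apply: ler_pM; [exact: expR_ge0| |by rewrite ler_expR ler_wpM2l|lra].
rewrite subr_ge0 -expR0 ler_expR oppr_le0 mulr_ge0 // subr_ge0 //.
Qed.

(** With W the form at e and kap = q/|P|, the derivative of exp(kap s) W is at most (M^2/q) exp((kap
    - 2 sg) s). Integrating, removing the weight and dividing by [min_sphere P] bounds the squared
    weighted error; sqrt(A^2 + b^2) <= A + b finishes. At sg = 0 the factor of M is sqrt(|P|/R)/q,
    as in the gain condition. *)
Lemma lyapunov_decay n (P : 'M[R]_n) (e : R -> 'cV[R]_n) (q sg M a t : R) : (0 < n)%N ->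
  sym_posdef P -> 0 < q -> 0 < sg -> 2 * sg < q / opnorm P -> 0 <= M -> a <= t ->
  lip_loc e a -> (exists N, forall s, a <= s <= t -> enorm (e s) <= N) -> 0 <= a ->
  {ae mu, forall s : R, a < s < t -> exists2 l, is_derive s 1 e l &
    bilin P (e s) l <= - q * enorm (e s) ^+ 2 + enorm (e s) * (M * expR (- sg * s))} ->
  expR (sg * t) * enorm (e t) <=
    Num.sqrt (opnorm P / min_sphere P) * (expR (sg * a) * enorm (e a)) +
    M * Num.sqrt (q * (q / opnorm P - 2 * sg) * min_sphere P)^-1.
Proof.
move=> n0 hP q0 sg0 sgk M0 at_ le_ [N eN] a0 ae.
have [m0 mP] := min_sphereP n0 hP.
have p0 : 0 < opnorm P := lt_le_trans m0 (min_sphere_le_opnorm n0 hP).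
set kap := q / opnorm P in sgk *; set m := min_sphere P in m0 mP *.
have kap0 : 0 < kap by rewrite divr_gt0.
have k2 : 0 < kap - 2 * sg by rewrite subr_gt0.
pose W s := bilin P (e s) (e s).
pose C := M ^+ 2 / q.
have C0 : 0 <= C by rewrite divr_ge0 ?sqr_ge0 // ltW.
pose psi s := expR (kap * s) * W s.
pose phi s := C / (kap - 2 * sg) * expR ((kap - 2 * sg) * s).
have N0 : 0 <= N by apply: le_trans (enorm_ge0 _) (eN a _); rewrite lexx.
have [Me Me0 MeP] := le_ t.
have Wb s : a <= s <= t -> `|W s| <= opnorm P * N * N.
  move=> /eN sN; apply: (le_trans (bilin_bound _ _ _)).
  by rewrite ler_pM // ?mulr_ge0 ?enorm_ge0 ?(ltW p0) // ler_wpM2l // ltW.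
have Wl s s' : a <= s -> s <= s' -> s' <= t -> `|W s' - W s| <= opnorm P * Me * (N + N) * (s' - s).
  move=> as_ ss s't; rewrite /W bilin_diff; apply: (le_trans (ler_normD _ _)).
  apply: (le_trans (lerD (bilin_bound _ _ _) (bilin_bound _ _ _))).
  have h1 := MeP s s' as_ ss s't.
  have h2 : enorm (e s') <= N by apply: eN; rewrite (le_trans as_).
  have h3 : enorm (e s) <= N by apply: eN; rewrite as_ (le_trans ss).
  have -> : opnorm P * Me * (N + N) * (s' - s) =
    opnorm P * ((Me * (s' - s)) * N + N * (Me * (s' - s))) by ring.
  rewrite -!mulrA -mulrDr ler_wpM2l ?(ltW p0) // !mulrA.
  by rewrite -[N * Me * _]mulrA; apply: lerD; apply: ler_pM; rewrite ?enorm_ge0.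
have psil s s' : a <= s -> s <= s' -> s' <= t -> `|psi s' - psi s| <=
   (expR (kap * t) * (opnorm P * Me * (N + N)) + kap * expR (kap * t) * (opnorm P * N * N)) * (s' - s).
  move=> as_ ss s't.
  have -> : psi s' - psi s = expR (kap * s') * (W s' - W s) +
     (expR (kap * s') - expR (kap * s)) * W s by rewrite /psi; ring.
  apply: (le_trans (ler_normD _ _)); rewrite !normrM mulrDl; apply: lerD.
    rewrite -mulrA; apply: ler_pM => //; last exact: Wl.
    by rewrite ger0_norm ?expR_ge0 // ler_expR ler_wpM2l // ltW.
  rewrite [leRHS]mulrAC; apply: ler_pM => //; first exact: expR_lip (ltW kap0) ss s't.
  by apply: Wb; rewrite as_ (le_trans ss).
have main : psi t - psi a <= phi t - phi a.
  apply: (lipschitz_growth at_ psil).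
    move=> x y _ xy _; apply: ler_wpM2l; first by rewrite divr_ge0 // ltW.
    by rewrite ler_expR ler_wpM2l // ltW.
  apply: ae_sub ae => s H sat; have [l el ll] := H sat.
  exists (kap * expR (kap * s) * W s + expR (kap * s) * (2 * bilin P (e s) l)),
    (C * expR ((kap - 2 * sg) * s)); split.
  - have d1 := is_derive_expM kap s; have d2 := is_derive_bilin (proj1 hP) el.
    apply: is_derive_eq (is_deriveM d1 d2) _.
    by rewrite /GRing.scale /= addrC [W s * _]mulrC.
  - apply: is_derive_eq (is_deriveZ (C / (kap - 2 * sg)) (is_derive_expM (kap - 2 * sg) s)) _.
    by rewrite /GRing.scale /= mulrA divfK // gt_eqF.
  - have -> : expR ((kap - 2 * sg) * s) = expR (kap * s) * expR (- sg * s) ^+ 2.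
      by rewrite -expRM_natl -expRD; congr expR; ring.
    have -> : kap * expR (kap * s) * W s + expR (kap * s) * (2 * bilin P (e s) l) =
      expR (kap * s) * (kap * W s + 2 * bilin P (e s) l) by ring.
    rewrite mulrCA ler_wpM2l ?expR_ge0 //.
    have Wu : kap * W s <= q * enorm (e s) ^+ 2.
      apply: (le_trans (ler_wpM2l (ltW kap0) (bilin_le_opnorm P (e s)))).
      by rewrite /kap mulrA divfK // gt_eqF.
    rewrite /C; move: (expR (- sg * s)) (enorm (e s)) ll Wu => E y ll Wu.
    (* Young's inequality: the cross term 2 y M E is absorbed by q y^2, one of the two copies of q
       y^2 being used up by kap W. *)
    have : 0 <= (q * y - M * E) ^+ 2 / q by rewrite divr_ge0 ?sqr_ge0 // ltW.
    have -> : (q * y - M * E) ^+ 2 / q = q * y ^+ 2 - 2 * (y * (M * E)) + M ^+ 2 / q * E ^+ 2.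
      by field; rewrite gt_eqF.
    rewrite mulNr in ll; move: (M ^+ 2 / q * E ^+ 2) (q * y ^+ 2) (y * (M * E)) ll Wu.
    by move: (kap * W s) (bilin P (e s) l) => Z1 Z2 Z3 Z4 Z5; clear -Z1; lra.
pose A := Num.sqrt (opnorm P / m) * (expR (sg * a) * enorm (e a)).
pose b := M * Num.sqrt (q * (kap - 2 * sg) * m)^-1.
rewrite -/A -/b.
have A0 : 0 <= A by rewrite !mulr_ge0 ?sqrtr_ge0 ?expR_ge0 ?enorm_ge0.
have b0 : 0 <= b by rewrite mulr_ge0 ?sqrtr_ge0.
apply: sqr_le_imp_le; first exact: addr_ge0.
have A2 : A ^+ 2 = opnorm P / m * (expR (sg * a) ^+ 2 * enorm (e a) ^+ 2).
  by rewrite /A exprMn sqr_sqrtr ?divr_ge0 ?ltW // exprMn.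
have b2 : b ^+ 2 = C / (kap - 2 * sg) / m.
  rewrite /b exprMn sqr_sqrtr ?invr_ge0 ?mulr_ge0 ?ltW //.
  by rewrite /C !invfM !mulrA.
apply: (@le_trans _ _ (A ^+ 2 + b ^+ 2)); last first.
  by rewrite sqrrD addrAC lerDl mulrn_wge0 // mulr_ge0.
rewrite A2 b2 exprMn.
have E1 : m * (expR (sg * t) ^+ 2 * enorm (e t) ^+ 2) <=
   opnorm P * (expR (sg * a) ^+ 2 * enorm (e a) ^+ 2) + C / (kap - 2 * sg).
  (* Multiplying by w replaces the weight exp(kap t) by exp(2 sg t) and turns the forcing term into
     a constant; at a <= t the new weight is at most exp(2 sg a), as 2 sg < kap. *)
  pose w := expR ((2 * sg - kap) * t).
  have w0 : 0 < w by exact: expR_gt0.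
  have Ew : w * expR (kap * t) = expR (sg * t) ^+ 2.
    by rewrite /w -expRD -expRM_natl; congr expR; ring.
  have Ew2 : w * expR ((kap - 2 * sg) * t) = 1.
    by rewrite /w -expRD -[RHS]expR0; congr expR; ring.
  have Ew3 : w * expR (kap * a) <= expR (sg * a) ^+ 2.
    rewrite /w -expRD -expRM_natl ler_expR.
    have : 0 <= (kap - 2 * sg) * (t - a) by rewrite mulr_ge0 ?subr_ge0 // ltW.
    by rewrite -[2%:R]/(2 : R); nra.
  have h1 : m * (expR (sg * t) ^+ 2 * enorm (e t) ^+ 2) <= w * psi t.
    rewrite /psi [leRHS]mulrA Ew mulrCA ler_wpM2l ?sqr_ge0 //; exact: mP.
  have h2 : w * psi t <= w * (psi a + phi t).
    rewrite ler_wpM2l ?(ltW w0) //.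
    have : 0 <= phi a by apply: mulr_ge0; [rewrite divr_ge0 // ltW|exact: expR_ge0].
    by move: main; move: (psi t) (psi a) (phi t) (phi a) => Z1 Z2 Z3 Z4; clear -Z1; lra.
  apply: (le_trans h1); apply: (le_trans h2); rewrite mulrDr; apply: lerD.
    rewrite /psi mulrA; apply: (@le_trans _ _ (w * expR (kap * a) * (opnorm P * enorm (e a) ^+ 2))).
      by rewrite ler_wpM2l ?bilin_le_opnorm // mulr_ge0 ?expR_ge0 ?ltW.
    rewrite [leLHS]mulrCA ler_wpM2l ?(ltW p0) // ler_wpM2r ?sqr_ge0 //.
  by rewrite /phi mulrCA Ew2 mulr1.
have -> : opnorm P / m * (expR (sg * a) ^+ 2 * enorm (e a) ^+ 2) + C / (kap - 2 * sg) / m =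
  (opnorm P * (expR (sg * a) ^+ 2 * enorm (e a) ^+ 2) + C / (kap - 2 * sg)) / m by ring.
by rewrite ler_pdivlMr // mulrC.
Qed.

Lemma continuous_expM (k : R) : continuous (fun s => expR (k * s)).
Proof.
move=> s; apply: differentiable_continuous; apply/derivable1_diffP.
by have := is_derive_expM k s; move=> h; exact: ex_derive.
Qed.

(** E is finite before any decay is known, and the second clause turns a pointwise bound that itself
    contains E into an inequality for E. *)
Lemma weighted_max n (y : R -> 'cV[R]_n) (sg a b : R) : a <= b -> continuous y ->
  exists E, (forall s, a <= s <= b -> expR (sg * s) * enorm (y s) <= E) /\
    forall C, (forall s, a <= s <= b -> expR (sg * s) * enorm (y s) <= C) -> E <= C.
Proof.
move=> ab cy.
have cf : continuous (fun s => expR (sg * s) * enorm (y s)).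
  move=> s; apply: cvgM; [exact: continuous_expM|exact: continuous_enorm].
have [c cab cM] := EVT_max ab (continuous_subspaceT (fun s => @cf s)).
exists (expR (sg * c) * enorm (y c)); split => [s sab|C]; first by apply: cM; rewrite in_itv.
by apply; move: cab; rewrite in_itv.
Qed.

Lemma lip_loc_shift n (y : R -> 'cV[R]_n) (a c : R) : lip_loc y a ->
  lip_loc (fun t => y (t + c)) (a - c).
Proof.
move=> ly b; have [M M0 MP] := ly (b + c); exists M => // s t as_ st tb.
have -> : t - s = (t + c) - (s + c) by ring.
by apply: MP; rewrite ?lerD2r // -lerBlDr.
Qed.

Lemma lip_locB n (y z : R -> 'cV[R]_n) a : lip_loc y a -> lip_loc z a ->
  lip_loc (fun t => y t - z t) a.
Proof.
move=> ly lz; apply: lip_locD => // c; have [M M0 MP] := lz c.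
by exists M => // s t as_ st tc; rewrite -opprD enormN; exact: MP.
Qed.

End Lyapunov.

(** * Choice of the decay rate *)

Section Rates.
Context {R : realType}.

Lemma continuous_lt1 (th : R -> R) : {for 0, continuous th} -> th 0 < 1 ->
  exists2 d, 0 < d & forall s, `|s| < d -> th s < 1.
Proof.
move=> c0 t1; have h : \forall s \near (0 : R), th s < 1 by exact: (cvgr_lt _ c0 _ t1).
move/nbhs_ballP : h => [d /= d0 dP].
by exists d => // s sd; apply: dP; rewrite /ball /= sub0r normrN.
Qed.

(** At sg = 0 the two products are the left side of the gain condition and L d, both below 1; they
    depend continuously on sg. The bound sg <= mu0 lets the residual exp(-mu t) of the predictors be
    absorbed in exp(-sg t). *)
Lemma decay_rate (q pn m M0 h mu0 L d B : R) : 0 < q -> 0 < pn -> 0 < m -> 0 < mu0 ->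
  L * h * (M0 / q) * Num.sqrt (pn / m) * B < 1 -> L * d < 1 ->
  exists sg, [/\ 0 < sg, 2 * sg < q / pn, sg <= mu0,
    M0 * expR (sg * B) * h * L * B * Num.sqrt (q * (q / pn - 2 * sg) * m)^-1 < 1 &
    L * d * expR (sg * d) < 1].
Proof.
move=> q0 pn0 m0 mu00 h1 h2.
have cexp (k : R) : {for (0 : R), continuous (fun s : R => expR (s * k))}.
  rewrite (_ : (fun s => expR (s * k)) = fun s => expR (k * s)); first exact: continuous_expM.
  by apply/funext => s; rewrite mulrC.
have [d1 d10 D1] : exists2 d1, 0 < d1 & forall s, `|s| < d1 ->
    M0 * expR (s * B) * h * L * B * Num.sqrt (q * (q / pn - 2 * s) * m)^-1 < 1.
  apply: continuous_lt1; last first.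
    rewrite mul0r expR0 mulr0 subr0 mulr1.
    have -> : (q * (q / pn) * m)^-1 = q ^- 2 * (pn / m).
      by field; rewrite !gt_eqF.
    rewrite sqrtrM ?invr_ge0 ?sqr_ge0 // -exprVn sqrtr_sqr ger0_norm ?invr_ge0 ?(ltW q0) //.
    by apply: le_lt_trans h1; rewrite le_eqVlt; apply/orP; left; apply/eqP; ring.
  apply: cvgM.
    apply: cvgM; last exact: cvg_cst.
    apply: cvgM; last exact: cvg_cst.
    apply: cvgM; last exact: cvg_cst.
    by apply: cvgM; [exact: cvg_cst|exact: cexp].
  have cg : {for (0 : R), continuous (fun s : R => (q * (q / pn - 2 * s) * m)^-1)}.
    apply: cvgV; first by rewrite mulr0 subr0 !mulf_neq0 // ?invr_eq0 gt_eqF.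
    apply: cvgM; last exact: cvg_cst.
    apply: cvgM; first exact: cvg_cst.
    apply: cvgB; first exact: cvg_cst.
    by apply: cvgM; [exact: cvg_cst|exact: cvg_id].
  have cq := @sqrt_continuous R (q * (q / pn - 2 * 0) * m)^-1.
  exact: (@continuous_comp _ _ _ (fun s : R => (q * (q / pn - 2 * s) * m)^-1) Num.sqrt _ cg cq).
have [d2 d20 D2] : exists2 d2, 0 < d2 & forall s, `|s| < d2 -> L * d * expR (s * d) < 1.
  apply: continuous_lt1; last by rewrite mul0r expR0 mulr1.
  by apply: cvgM; [exact: cvg_cst|exact: cexp].
pose e := Num.min (Num.min d1 d2) (Num.min (q / pn / 2) mu0).
have e0 : 0 < e by rewrite !lt_min d10 d20 mu00 !divr_gt0.
have es : e / 2 < e by lra.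
have e2 : 0 < e / 2 by lra.
have : e / 2 < e by [].
rewrite {2}/e !lt_min => /andP[/andP[s1 s2] /andP[s3 s4]].
exists (e / 2); split => //.
- by rewrite mulrC -ltr_pdivlMr.
- exact: ltW.
- by apply: D1; rewrite ger0_norm // ltW.
- by apply: D2; rewrite ger0_norm // ltW.
Qed.

End Rates.

(** * The sampling index of a time *)

Section Sampling.
Context {R : realType} (tau : nat -> R).
Context (tau_part : is_partition tau).

Lemma tau0 : tau 0%N = 0. Proof. by case: tau_part. Qed.

Lemma tauS i : tau i < tau i.+1. Proof. by case: tau_part. Qed.

Lemma tau_le i j : (i <= j)%N -> tau i <= tau j.
Proof.
by move/subnK <-; elim: (j - i)%N => // d H; rewrite addSn (le_trans H) // ltW // tauS.
Qed.

Lemma tau_ge0 i : 0 <= tau i. Proof. by rewrite -tau0 tau_le. Qed.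

Lemma tau_unbounded t : exists i, t < tau i.
Proof.
have [_ _ tp] := tau_part; move/cvgryPgt : tp => /(_ t)[N _ NP].
by exists N; apply: NP => /=.
Qed.

(** Predecessor of the index of the first sampling time beyond t. For t < 0 that index is 0, and the
    truncated predecessor gives 0 again. *)
Definition tau_idx (t : R) : nat := (ex_minn (tau_unbounded t)).-1.

Lemma tau_idx_neg t : t < tau 1%N -> tau_idx t = 0%N.
Proof.
move=> t1; rewrite /tau_idx; case: ex_minnP => N tN minN.
by have := minN _ t1; case: N {tN minN} => [|[|]].
Qed.

Lemma tau_idx_eq i t : tau i <= t -> t < tau i.+1 -> tau_idx t = i.
Proof.
move=> it ti; rewrite /tau_idx; case: ex_minnP => N tN minN.
have h1 := minN _ ti; have : (i < N)%N.
  by rewrite ltnNge; apply/negP => /tau_le Ni; have := lt_le_trans tN (le_trans Ni it); rewrite ltxx.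
by move=> iN; have -> : N = i.+1 by apply/eqP; rewrite eqn_leq h1.
Qed.

Lemma tau_idxP t : 0 <= t -> tau (tau_idx t) <= t < tau (tau_idx t).+1.
Proof.
move=> t0; rewrite /tau_idx; case: ex_minnP => N tN minN.
case: N tN minN => [|N] tN minN; first by move: tN; rewrite tau0 ltNge t0.
by rewrite /= tN andbT leNgt; apply/negP => /minN; rewrite ltnn.
Qed.

Lemma tau_idx_ge i t : (0 < i)%N -> tau_idx t = i -> tau i <= t < tau i.+1.
Proof.
move=> i0 ti; have [t1|t1] := ltP t (tau 1%N).
  by move: i0; rewrite -ti (tau_idx_neg t1).
by rewrite -ti tau_idxP // (le_trans _ t1) // tau_ge0.
Qed.

Lemma borel_tau_idx k (A : nat -> 'cV[R]_k) : borel_fun (fun t => A (tau_idx t)).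
Proof.
move=> j; apply: (measurability (@RGenInftyO.G R)); first exact: RGenInftyO.measurableE.
move=> _ [_ [x ->] <-]; rewrite setTI.
pose C i := if A i j 0 < x then [set t | tau_idx t = i] else set0.
have -> : (fun t => A (tau_idx t) j 0) @^-1` `]-oo, x[%classic = \bigcup_i C i.
  apply/seteqP; split => t /=; rewrite in_itv/=.
    by move=> At; exists (tau_idx t) => //; rewrite /C At.
  by move=> [i _]; rewrite /C; case: ifPn => // Ax /= ->.
apply: bigcupT_measurable => i; rewrite /C; case: ifP => // _.
case: i => [|i].
  rewrite (_ : [set _ | _] = `]-oo, (tau 1%N)[%classic); first exact: measurable_itv.
  apply/seteqP; split => t /=; rewrite in_itv/=; last exact: tau_idx_neg.
  move=> ti; have [//|t1] := ltP t (tau 1%N).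
  by have := tau_idxP (le_trans (tau_ge0 1) t1); rewrite ti => /andP[_]; rewrite ltNge t1.
rewrite (_ : [set _ | _] = `[tau i.+1, tau i.+2[%classic); first exact: measurable_itv.
apply/seteqP; split => t /=; rewrite in_itv/=; first exact: tau_idx_ge.
by move=> /andP[]; exact: tau_idx_eq.
Qed.

Lemma tau_idx_mono s t : s <= t -> (tau_idx s <= tau_idx t)%N.
Proof.
move=> st; rewrite /tau_idx; case: ex_minnP => N sN minN; case: ex_minnP => M tM _.
by have := minN _ (le_lt_trans st tM); case: N {sN minN} => // N; case: M tM.
Qed.

Lemma loc_bounded_tau_idx k (A : nat -> 'cV[R]_k) : loc_bounded (fun t => A (tau_idx t)).
Proof.
move=> c; exists (\sum_(i < (tau_idx c).+1) enorm (A i)) => t tc.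
have ti : (tau_idx t < (tau_idx c).+1)%N.
  by rewrite ltnS tau_idx_mono // (le_trans _ tc) // ler_norm.
rewrite (bigD1 (Ordinal ti)) //= lerDl; apply: sumr_ge0 => i _; exact: enorm_ge0.
Qed.

Lemma ae_not_sample : {ae @lebesgue_measure R, forall t : R, forall i, t != tau i}.
Proof.
apply: ae_foralln => i; apply: (negligibleS _ (negligible_set1 (tau i))).
by move=> t /= /negP; rewrite negbK => /eqP.
Qed.

End Sampling.

(** * Existence for the state, the observer and one predictor, with Borel input *)

Section Borel_system.
Context {R : realType} {n m : nat} (U : set 'cV[R]_m).
Context (G : 'cV[R]_n * 'cV[R]_m -> 'cV[R]_n) (L F : R) (ut : R -> 'cV[R]_m).
Context (cG : continuous G) (L0 : 0 < L).
Context (lipG : forall x z u, U u -> enorm (G (x, u) - G (z, u)) <= L * enorm (x - z)).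
Context (but : borel_fun ut) (Uut : forall t, U (ut t)).
Context (hF : forall t, enorm (G (0, ut t)) <= F).
Notation mu := (@lebesgue_measure R).

(** The shift c is 0 for x, - r for z and i delta - r for xi_i, so one set of estimates serves all
    equations. *)
Definition rhs (c : R) (y : R -> 'cV[R]_n) (t : R) := G (y t, ut (t + c)).

Lemma rhs_lip c y y' t : enorm (rhs c y t - rhs c y' t) <= L * enorm (y t - y' t).
Proof. exact: lipG. Qed.

Lemma rhs_bound c y t : enorm (rhs c y t) <= F + L * enorm (y t).
Proof.
have := rhs_lip c y (fun=> 0) t; rewrite subr0.
have := enorm_distl (rhs c y t) (rhs c (fun=> 0) t); have := hF (t + c).
by rewrite {2}/rhs /=; lra.
Qed.

Lemma F_ge0 : 0 <= F.
Proof. exact: le_trans (enorm_ge0 _) (hF 0). Qed.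

Lemma rhs_borel c (y : R -> 'cV[R]_n) : continuous y -> borel_fun (rhs c y).
Proof.
by move=> cy; apply: borel_comp2 => //; [exact: continuous_borel|exact: borel_shift].
Qed.

Lemma rhs_loc_bounded c (y : R -> 'cV[R]_n) : continuous y -> loc_bounded (rhs c y).
Proof.
move=> cy b; have [M MP] := continuous_loc_bounded cy b.
exists (F + L * M) => t /MP tM; apply: (le_trans (rhs_bound c y t)).
by rewrite lerD2l ler_wpM2l // ltW.
Qed.

Lemma loc_boundedD k (y z : R -> 'cV[R]_k) : loc_bounded y -> loc_bounded z ->
  loc_bounded (fun t => y t + z t).
Proof.
move=> ly lz c; have [M MP] := ly c; have [N NP] := lz c; exists (M + N) => t tc.
by apply: (le_trans (enormD _ _)); rewrite lerD ?MP ?NP.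
Qed.

Lemma loc_bounded_mulmx k l (A : 'M[R]_(l, k)) (y : R -> 'cV[R]_k) : loc_bounded y ->
  loc_bounded (fun t => A *m y t).
Proof.
move=> ly c; have [M MP] := ly c; exists (opnorm A * M) => t tc.
by apply: (le_trans (enorm_mulmx _ _)); rewrite ler_wpM2l ?opnorm_ge0 ?MP.
Qed.

Lemma loc_boundedB k (y z : R -> 'cV[R]_k) : loc_bounded y -> loc_bounded z ->
  loc_bounded (fun t => y t - z t).
Proof.
move=> ly lz; apply: loc_boundedD => // c; have [M MP] := lz c.
by exists M => t tc; rewrite enormN MP.
Qed.

(** The initial function is frozen after 0, so that it can be the inhomogeneous term of
    [causal_picard] on both sides of 0. *)
Lemma state_solution (x0 : R -> 'cV[R]_n) : continuous x0 -> (forall t, 0 <= t -> x0 t = x0 0) ->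
  exists x : R -> 'cV[R]_n, [/\ continuous x, (forall t, t <= 0 -> x t = x0 t), lip_loc x 0 &
    {ae mu, forall t : R, 0 < t -> is_derive t 1 x (rhs 0 x t)}].
Proof.
move=> cx0 x0c.
have [||||x cx xE] := @causal_picard R n (rhs 0) x0 L => //.
- by move=> y cy; split; [exact: rhs_borel|exact: rhs_loc_bounded].
- move=> y y' t M _ _ t0 yM; apply: (le_trans (rhs_lip _ _ _ _)).
  by rewrite ler_wpM2l ?yM // ltW.
have bx := rhs_borel 0 cx; have lx := rhs_loc_bounded 0 cx.
have xE' t : 0 <= t -> x0 0 + prim 0 (rhs 0 x) t = x t by move=> t0; rewrite xE x0c.
exists x; split => //.
- by move=> t t0; rewrite xE prim_le // addr0.
- apply: (lip_loc_eq xE'); apply: lip_locD; [exact: lip_loc_cst|exact: lip_loc_prim].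
- have := is_derive_prim 0 bx lx; apply: ae_sub => t H t0.
  have eqx s : 0 < s -> x0 0 + prim 0 (rhs 0 x) s = x s by move=> /ltW /xE'.
  exact: (is_derive_right t0 eqx (is_derive_addc (x0 0) (H t0))).
Qed.

(* The equation of w integrated on each sampling interval; substituting it in the
   equation of z leaves a causal equation for z alone. *)
Definition sampled k (tau : nat -> R) (tau_part : is_partition tau) (H : 'M[R]_(k, n))
    (A : nat -> 'cV[R]_k) (r : R) (z : R -> 'cV[R]_n) (t : R) : 'cV[R]_k :=
  A (tau_idx tau_part t) + H *m (prim 0 (rhs (- r) z) t
     - prim 0 (rhs (- r) z) (tau (tau_idx tau_part t))).

Lemma sampledE k tau (tau_part : is_partition tau) (H : 'M[R]_(k, n)) A r z i t :
  tau i <= t -> t < tau i.+1 -> sampled tau_part H A r z t =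
  A i + H *m (prim 0 (rhs (- r) z) t - prim 0 (rhs (- r) z) (tau i)).
Proof. by move=> it ti; rewrite /sampled (tau_idx_eq tau_part it ti). Qed.

(** Away from the countably many sampling times the index is locally constant, so A and the lower
    limit of the integral do not move. *)
Lemma is_derive_sampled k tau (tau_part : is_partition tau) (H : 'M[R]_(k, n)) A r
    (z : R -> 'cV[R]_n) : continuous z ->
  {ae mu, forall t : R, 0 < t -> is_derive t 1 (sampled tau_part H A r z) (H *m rhs (- r) z t)}.
Proof.
move=> cz; have bz := rhs_borel (- r) cz; have lz := rhs_loc_bounded (- r) cz.
apply: ae_sub (ae_and (is_derive_prim 0 bz lz) (ae_not_sample tau)) => t [Hd Ht] t0.
set i := tau_idx tau_part t.
have /andP[it ti] := tau_idxP tau_part (ltW t0).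
have {}it : tau i < t by rewrite lt_neqAle eq_sym Ht.
pose d := Num.min (t - tau i) (tau i.+1 - t).
have d0 : 0 < d by rewrite lt_min !subr_gt0 it.
have d1 : d <= t - tau i by rewrite ge_min lexx.
have d2 : d <= tau i.+1 - t by rewrite ge_min lexx orbT.
pose Fi s := A i + H *m (prim 0 (rhs (- r) z) s - prim 0 (rhs (- r) z) (tau i)).
have eqF s : `|s - t| < d -> Fi s = sampled tau_part H A r z s.
  rewrite ltr_norml => /andP[h1 h2]; rewrite (@sampledE _ _ _ _ _ _ _ i) //; lra.
apply: (is_derive_local d0 eqF); apply: is_derive_addc; apply: is_derive_mulmx.
have := is_deriveB_fun (Hd t0) (is_derive_cst (prim 0 (rhs (- r) z) (tau i)) t 1).
by rewrite subr0.
Qed.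

Lemma observer_solution k tau (tau_part : is_partition tau) (B : R)
    (K : 'M[R]_(n, k)) (H : 'M[R]_(k, n)) A (r : R) (z0 : 'cV[R]_n) :
  (forall i, tau i.+1 - tau i <= B) ->
  exists z : R -> 'cV[R]_n, [/\ continuous z, z 0 = z0, lip_loc z 0 &
   {ae mu, forall t : R, 0 < t -> is_derive t 1 z
      (rhs (- r) z t + K *m (H *m z t - sampled tau_part H A r z t))}].
Proof.
move=> gap; have B0 : 0 <= B by apply: le_trans (gap 0%N); rewrite subr_ge0 ltW // tauS.
pose Phi z t := rhs (- r) z t + K *m (H *m z t - sampled tau_part H A r z t).
have regP (z : R -> 'cV[R]_n) : continuous z -> borel_fun (Phi z) /\ loc_bounded (Phi z).
  move=> cz; have bz := rhs_borel (- r) cz; have lz := rhs_loc_bounded (- r) cz.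
  have cp := prim_continuous (a := 0) bz lz.
  split.
    apply: borelD => //; apply: borel_mulmx; apply: borelB.
      by apply: borel_mulmx; exact: continuous_borel.
    apply: borelD; first exact: borel_tau_idx.
    apply: borel_mulmx; apply: borelB; first exact: continuous_borel.
    exact: (@borel_tau_idx R tau tau_part n (fun i => prim 0 (rhs (- r) z) (tau i))).
  apply: loc_boundedD => //; apply: loc_bounded_mulmx; apply: loc_boundedB.
    by apply: loc_bounded_mulmx; exact: continuous_loc_bounded.
  apply: loc_boundedD; first exact: loc_bounded_tau_idx.
  apply: loc_bounded_mulmx; apply: loc_boundedB; first exact: continuous_loc_bounded.
  exact: (@loc_bounded_tau_idx R tau tau_part n (fun i => prim 0 (rhs (- r) z) (tau i))).
have kh : 0 <= opnorm K * opnorm H by rewrite mulr_ge0 ?opnorm_ge0.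
(* The last summand is the effect of w: between samples two copies of w drift apart by at most |H| L
   B times the distance of the histories of z. *)
pose Lam := L + opnorm K * opnorm H + opnorm K * opnorm H * (L * B).
have Lam0 : 0 < Lam by rewrite /Lam !ltr_wpDr // mulr_ge0 // mulr_ge0 // ltW.
have [||||z cz zE] := @causal_picard R n Phi (fun=> z0) Lam => //.
- by move=> t; exact: cvg_cst.
- move=> y y' t M cy cy' t0 yM.
  have M0 : 0 <= M by exact: le_trans (enorm_ge0 _) (yM t (lexx _)).
  have -> : Phi y t - Phi y' t = (rhs (- r) y t - rhs (- r) y' t) +
    (K *m (H *m (y t - y' t)) - K *m (sampled tau_part H A r y t - sampled tau_part H A r y' t)).
    exact: gain_diff.
  have h1 : enorm (rhs (- r) y t - rhs (- r) y' t) <= L * M.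
    by apply: (le_trans (rhs_lip _ _ _ _)); rewrite ler_wpM2l ?yM // ltW.
  have h2 : enorm (K *m (H *m (y t - y' t))) <= opnorm K * opnorm H * M.
    apply: (le_trans (enorm_mulmx _ _)); rewrite -mulrA ler_wpM2l ?opnorm_ge0 //.
    by apply: (le_trans (enorm_mulmx _ _)); rewrite ler_wpM2l ?opnorm_ge0 ?yM.
  have h3 : enorm (K *m (sampled tau_part H A r y t - sampled tau_part H A r y' t)) <=
     opnorm K * opnorm H * (L * B) * M.
    have /andP[it ti] := tau_idxP tau_part t0.
    rewrite !(sampledE _ _ _ _ _ it ti).
    move: (tau_idx tau_part t) it ti => i it ti.
    have -> : A i + H *m (prim 0 (rhs (- r) y) t - prim 0 (rhs (- r) y) (tau i)) -
       (A i + H *m (prim 0 (rhs (- r) y') t - prim 0 (rhs (- r) y') (tau i))) =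
       H *m (prim (tau i) (rhs (- r) y) t - prim (tau i) (rhs (- r) y') t).
      rewrite !primB ?tau_ge0 //; try exact: rhs_borel; try exact: rhs_loc_bounded.
      by rewrite mulmxBr; apply/matrixP => q j; rewrite !mxE; ring.
    apply: (le_trans (enorm_mulmx _ _)); rewrite -2!mulrA ler_wpM2l ?opnorm_ge0 //.
    apply: (le_trans (enorm_mulmx _ _)); rewrite ler_wpM2l ?opnorm_ge0 //.
    apply: (@le_trans _ _ (L * M * (t - tau i))).
      apply: prim_diff_le => //; try exact: rhs_borel; try exact: rhs_loc_bounded.
        by rewrite mulr_ge0 // ltW.
      move=> s /andP[_ st]; apply: (le_trans (rhs_lip _ _ _ _)).
      by rewrite ler_wpM2l ?yM ?(ltW st) // ltW.
    rewrite mulrAC ler_wpM2r // ler_wpM2l ?(ltW L0) //.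
    by apply: le_trans (gap i); rewrite lerD2r ltW.
  apply: (le_trans (enormD _ _)).
  have -> : Lam * M = L * M + (opnorm K * opnorm H * M + opnorm K * opnorm H * (L * B) * M).
    by rewrite /Lam; ring.
  apply: lerD => //.
  by apply: (le_trans (enormD _ _)); rewrite enormN; exact: lerD.
have [bP lP] := regP z cz.
exists z; split => //.
- by rewrite zE prim_le // addr0.
- apply: (lip_loc_eq (fun t _ => esym (zE t))).
  by apply: lip_locD; [exact: lip_loc_cst|exact: lip_loc_prim].
- apply: ae_sub (is_derive_prim 0 bP lP) => t Hd t0.
  exact: (is_derive_right t0 (fun s _ => esym (zE s)) (is_derive_addc z0 (Hd t0))).
Qed.

(** For t >= 0 this is the integral over [t - d, t]. As a difference of one primitive at two times
    it can be differentiated almost everywhere. *)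
Definition window (d c : R) (xi : R -> 'cV[R]_n) (t : R) : 'cV[R]_n :=
  prim (- d) (rhs c xi) t - prim (- d) (rhs c xi) (t - d).

Lemma is_derive_window d c (xi : R -> 'cV[R]_n) : 0 < d -> continuous xi ->
  {ae mu, forall t : R, 0 < t -> is_derive t 1 (window d c xi) (rhs c xi t - rhs c xi (t - d))}.
Proof.
move=> d0 cxi; have bz := rhs_borel c cxi; have lz := rhs_loc_bounded c cxi.
have h1 := is_derive_prim (- d) bz lz; have h2 := ae_shift (- d) h1.
apply: ae_sub (ae_and h1 h2) => t [H1 H2] t0.
have td : - d < t by lra.
have td' : - d < t + - d by lra.
exact: (is_deriveB_fun (H1 td) (is_derive_shift (H2 td'))).
Qed.

Lemma lip_loc_window d c (xi : R -> 'cV[R]_n) : continuous xi -> lip_loc (window d c xi) 0.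
Proof.
move=> cxi; have bz := rhs_borel c cxi; have lz := rhs_loc_bounded c cxi.
have h b := lip_loc_prim (- d) b bz lz.
move=> b; have [M M0 MP] := h 0 b; have [N N0 NP] := h (- d) (b - d).
exists (M + N) => [|s t s0 st tb]; first exact: addr_ge0.
have -> : window d c xi t - window d c xi s =
  (prim (- d) (rhs c xi) t - prim (- d) (rhs c xi) s) -
  (prim (- d) (rhs c xi) (t - d) - prim (- d) (rhs c xi) (s - d)).
  exact: subrBB.
apply: (le_trans (enormD _ _)); rewrite enormN mulrDl lerD ?MP //.
have -> : t - s = (t - d) - (s - d) by ring.
apply: NP; lra.
Qed.

Lemma window0 d c (xi : R -> 'cV[R]_n) : window d c xi 0 = prim (- d) (rhs c xi) 0.
Proof. by rewrite /window sub0r [X in _ - X]prim_le // subr0. Qed.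

(* The bracket multiplied by mu satisfies y' = - mu y, which gives the integrated
   form of the equation, free of the derivative of the predecessor. *)
Lemma predictor_solution (d c mu0 : R) (prev x0 : R -> 'cV[R]_n) :
  0 < d -> 0 < mu0 -> continuous x0 -> (forall t, 0 <= t -> x0 t = x0 0) ->
  lip_loc prev 0 -> {ae mu, forall t : R, 0 < t -> derivable prev t 1} ->
  exists xi : R -> 'cV[R]_n, [/\ continuous xi, (forall t, t <= 0 -> xi t = x0 t), lip_loc xi 0,
    (forall t, 0 <= t -> xi t = prev t + window d c xi t
       + expR (- mu0 * t) *: (x0 0 - prev 0 - prim (- d) (rhs c x0) 0)) &
    {ae mu, forall t : R, 0 < t -> is_derive t 1 xi (rhs c xi t - rhs c xi (t - d) +
       derive1 prev t - mu0 *: (xi t - prev t - window d c xi t))}].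
Proof.
move=> d0 m0 cx0 x0c lprev dprev.
pose G0 := x0 0 - prev 0 - prim (- d) (rhs c x0) 0.
pose Phi (y : R -> 'cV[R]_n) (t : R) := rhs c y t - rhs c y (t + - d).
(* For t <= 0 both corrections vanish and h is the initial function; for t >= 0 it carries the
   increments of prev and of the exponential, x0 being constant there. *)
pose h t := x0 t + ((prev (Num.max 0 t) - prev 0) + (expR (- mu0 * Num.max 0 t) *: G0 - G0)).
have regP (y : R -> 'cV[R]_n) : continuous y -> borel_fun (Phi y) /\ loc_bounded (Phi y).
  move=> cy; have bz := rhs_borel c cy; have lz := rhs_loc_bounded c cy; split.
    by apply: borelB => //; exact: (borel_shift (- d) bz).
  apply: loc_boundedB => // b; have [M MP] := lz (b + d); exists M => t tb; apply: MP.
  by apply: (le_trans (ler_normB _ _)); rewrite lerD // ger0_norm // ltW.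
have ch : continuous h.
  move=> t; apply: cvgD; first exact: cx0.
  apply: cvgD; apply: cvgB; try exact: cvg_cst.
    exact: (lip_loc_continuous lprev).
  exact: (lip_loc_continuous (lip_loc_expN G0 (ltW m0))).
(* The constant 2 L counts the current and the delayed value; the feedback with factor mu0 is
   already solved and sits in h. *)
have [||||xi cxi xiE] := @causal_picard R n Phi h (2 * L) => //; first by rewrite mulr_gt0.
  move=> y y' t M cy cy' t0 yM.
  have -> : Phi y t - Phi y' t = (rhs c y t - rhs c y' t) - (rhs c y (t + - d) - rhs c y' (t + - d)).
    by rewrite /Phi; apply/matrixP => i j; rewrite !mxE; ring.
  apply: (le_trans (enormD _ _)); rewrite enormN -mulrA mulr_natl mulr2n lerD //.
    by apply: (le_trans (rhs_lip _ _ _ _)); rewrite ler_wpM2l ?yM // ltW.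
  apply: (le_trans (rhs_lip _ _ _ _)); rewrite ler_wpM2l ?(ltW L0) // yM //; lra.
have hneg t : t <= 0 -> h t = x0 t.
  by move=> t0; rewrite /h max_l // mulr0 expR0 scale1r !subrr addr0 addr0.
have xineg t : t <= 0 -> xi t = x0 t by move=> t0; rewrite xiE prim_le // addr0 hneg.
have hpos t : 0 <= t -> h t = x0 0 + ((prev t - prev 0) + (expR (- mu0 * t) *: G0 - G0)).
  by move=> t0; rewrite /h max_r // x0c.
have [bP lP] := regP xi cxi.
have dwin := is_derive_window c d0 cxi.
have lwin := lip_loc_window d c cxi.
(* Both sides vanish at 0 and have the same derivative almost everywhere. This turns the
   differentiated window back into the integral of the predictor. *)
have primW t : 0 <= t -> prim 0 (Phi xi) t = window d c xi t - window d c xi 0.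
  move=> t0; apply/eqP; rewrite -subr_eq0; apply/eqP.
  pose D s := prim 0 (Phi xi) s - (window d c xi s - window d c xi 0).
  rewrite -/(D t); apply: abs_cont_eq0 => //.
  - have a1 : abs_cont 0 t (prim 0 (Phi xi)).
      exact: (lip_loc_abs_cont t (lip_loc_prim 0 0 bP lP)).
    have a2 : abs_cont 0 t (fun s => window d c xi s - window d c xi 0).
      apply: lip_loc_abs_cont; apply: lip_locD => //; exact: lip_loc_cst.
    exact: abs_contB a1 a2.
  - by rewrite /D subrr prim_le // subrr.
  - apply: ae_sub (ae_and (is_derive_prim 0 bP lP) dwin) => s [H1 H2] /andP[s0 _].
    have := is_deriveB_fun (H1 s0) (is_deriveB_fun (H2 s0) (is_derive_cst (window d c xi 0) s 1)).
    by rewrite subr0 /Phi subrr.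
have win0 : window d c xi 0 = prim (- d) (rhs c x0) 0.
  rewrite window0; apply: prim_ext => s /andP[_ s0].
  by rewrite /rhs xineg.
have xiW t : 0 <= t -> xi t = prev t + window d c xi t + expR (- mu0 * t) *: G0.
  move=> t0; rewrite xiE primW // hpos // win0 {2}/G0.
  by apply/matrixP => i j; rewrite !mxE; ring.
have xiP t : 0 <= t -> prev t + window d c xi t + expR (- mu0 * t) *: G0 = xi t.
  by move=> t0; rewrite xiW.
exists xi; split => //.
- apply: (lip_loc_eq xiP); apply: lip_locD; first exact: lip_locD.
  exact: lip_loc_expN (ltW m0).
- apply: ae_sub (ae_and dprev dwin) => t [H1 H2] t0.
  have xiP' s : 0 < s -> prev s + window d c xi s + expR (- mu0 * s) *: G0 = xi s.
    by move=> /ltW /xiP.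
  apply: (is_derive_right t0 xiP').
  have dp : is_derive t 1 prev (derive1 prev t).
    by rewrite derive1E; apply: DeriveDef; [exact: H1|].
  apply: is_derive_eq (is_deriveD_fun (is_deriveD_fun dp (H2 t0)) (is_derive_expN mu0 t G0)) _.
  have -> : xi t - prev t - window d c xi t = expR (- mu0 * t) *: G0.
    by rewrite xiW ?(ltW t0) //; apply/matrixP => i j; rewrite !mxE; ring.
  by apply/matrixP => i j; rewrite !mxE; ring.
Qed.

(** * Uniqueness for each component *)

Lemma state_unique (x x' : R -> 'cV[R]_n) c : 0 <= c ->
  abs_cont 0 c x -> abs_cont 0 c x' -> x' 0 = x 0 ->
  {ae mu, forall t : R, 0 < t -> is_derive t 1 x (rhs 0 x t)} ->
  {ae mu, forall t : R, 0 < t < c -> is_derive t 1 x' (rhs 0 x' t)} ->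
  forall t, 0 <= t <= c -> x' t = x t.
Proof.
move=> c0 ac ac' xx dx dx'; apply: (gronwall_unique c0 L0 ac ac' xx).
apply: ae_sub (ae_and dx dx') => t [H1 H2] t0c; have /andP[t0 _] := t0c.
exists (rhs 0 x t), (rhs 0 x' t); split; [exact: H1|exact: H2|].
move=> M MP; apply: (le_trans (rhs_lip _ _ _ _)); rewrite ler_wpM2l ?(ltW L0) //.
by apply: MP; rewrite lexx ltW.
Qed.

(** The samples agree, so the two versions of w differ by at most |H| L B times the past distance of
    z' and z; with this, Gronwall's inequality for z' - z closes. Equality of w then follows from
    the same bound with M = 0. *)
Lemma observer_unique k tau (tau_part : is_partition tau) (B : R)
    (K : 'M[R]_(n, k)) (H : 'M[R]_(k, n)) A (r c : R) (z z' : R -> 'cV[R]_n) (w' : R -> 'cV[R]_k) :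
  (forall i, tau i.+1 - tau i <= B) -> 0 <= c ->
  continuous z -> lip_loc z 0 ->
  {ae mu, forall t : R, 0 < t -> is_derive t 1 z
      (rhs (- r) z t + K *m (H *m z t - sampled tau_part H A r z t))} ->
  z' 0 = z 0 -> abs_cont 0 c z' ->
  (forall i t, tau i <= t -> t < tau i.+1 -> t <= c -> abs_cont (tau i) t w') ->
  (forall i, tau i <= c -> w' (tau i) = A i) ->
  {ae mu, forall t : R, 0 < t < c -> is_derive t 1 z'
      (rhs (- r) z' t + K *m (H *m z' t - w' t))} ->
  {ae mu, forall t : R, 0 < t < c -> is_derive t 1 w' (H *m rhs (- r) z' t)} ->
  forall t, 0 <= t <= c -> z' t = z t /\ w' t = sampled tau_part H A r z t.
Proof.
move=> gap c0 cz lz dz zz acz' acw' w'A dz' dw'.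
have B0 : 0 <= B by apply: le_trans (gap 0%N); rewrite subr_ge0 ltW // tauS.
have bz := rhs_borel (- r) cz; have lbz := rhs_loc_bounded (- r) cz.
have kh : 0 <= opnorm K * opnorm H by rewrite mulr_ge0 ?opnorm_ge0.
have key t M : 0 <= t <= c -> (forall s, 0 <= s <= t -> enorm (z' s - z s) <= M) ->
    enorm (w' t - sampled tau_part H A r z t) <= opnorm H * (L * B) * M.
  move=> /andP[t0 tc] zM.
  have M0 : 0 <= M by apply: le_trans (enorm_ge0 _) (zM 0 _); rewrite lexx.
  have /andP[it ti] := tau_idxP tau_part t0.
  rewrite (sampledE _ _ _ _ _ it ti); move: (tau_idx tau_part t) it ti => i it ti.
  pose Fi s := A i + H *m (prim 0 (rhs (- r) z) s - prim 0 (rhs (- r) z) (tau i)).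
  have Fi0 : Fi (tau i) = A i by rewrite /Fi subrr mulmx0 addr0.
  have lF : lip_loc Fi (tau i).
    apply: lip_locD; first exact: lip_loc_cst.
    by apply: lip_loc_mulmx; apply: lip_locD; [exact: lip_loc_prim|exact: lip_loc_cst].
  rewrite -/(Fi t).
  have C0 : 0 <= opnorm H * (L * M) by rewrite !mulr_ge0 ?opnorm_ge0 // ltW.
  have := @abs_cont_growth R k (fun s => w' s - Fi s) (fun s => opnorm H * (L * M) * s)
    (tau i) t it (abs_contB (acw' i t it ti tc) (lip_loc_abs_cont t lF)).
  rewrite Fi0 w'A ?(le_trans it) // subrr subr0 => Hg.
  apply: (@le_trans _ _ (opnorm H * (L * M) * t - opnorm H * (L * M) * tau i)).
    apply: Hg => [x y _ xy _|]; first by rewrite ler_wpM2l.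
    apply: ae_sub (ae_and dw' (is_derive_prim 0 bz lbz)) => s [H1 H2] /andP[is_ st].
    have s0 : 0 < s by apply: le_lt_trans is_; exact: tau_ge0.
    have s0c : 0 < s < c by rewrite s0 (lt_le_trans st).
    exists (H *m rhs (- r) z' s - H *m rhs (- r) z s), (opnorm H * (L * M)); split.
    - apply: is_deriveB_fun (H1 s0c) _.
      apply: is_derive_addc; apply: is_derive_mulmx.
      have := is_deriveB_fun (H2 s0) (is_derive_cst (prim 0 (rhs (- r) z) (tau i)) s 1).
      by rewrite subr0.
    - exact: is_derive_lin.
    - rewrite -mulmxBr; apply: (le_trans (enorm_mulmx _ _)); rewrite ler_wpM2l ?opnorm_ge0 //.
      apply: (le_trans (rhs_lip _ _ _ _)); rewrite ler_wpM2l ?(ltW L0) //.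
      by apply: zM; rewrite !ltW.
  have -> : opnorm H * (L * B) * M = opnorm H * (L * M) * B by ring.
  rewrite -mulrBr ler_wpM2l //; apply: le_trans (gap i).
  by rewrite lerD2r ltW.
pose Lam := L + opnorm K * opnorm H + opnorm K * (opnorm H * (L * B)).
have Lam0 : 0 < Lam.
  by rewrite /Lam !ltr_wpDr // !mulr_ge0 ?opnorm_ge0 // ltW.
have zE : forall t, 0 <= t <= c -> z' t = z t.
  apply: (gronwall_unique c0 Lam0 (lip_loc_abs_cont c lz) acz' zz).
  apply: ae_sub (ae_and dz dz') => t [H1 H2] t0c; have /andP[t0 tc] := t0c.
  exists (rhs (- r) z t + K *m (H *m z t - sampled tau_part H A r z t)),
    (rhs (- r) z' t + K *m (H *m z' t - w' t)); split; [exact: H1|exact: H2|].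
  move=> M MP; rewrite gain_diff.
  have zt : enorm (z' t - z t) <= M by apply: MP; rewrite lexx ltW.
  have -> : Lam * M = L * M + (opnorm K * opnorm H * M + opnorm K * (opnorm H * (L * B) * M)).
    by rewrite /Lam; ring.
  apply: (le_trans (enormD _ _)); apply: lerD.
    by apply: (le_trans (rhs_lip _ _ _ _)); rewrite ler_wpM2l ?(ltW L0).
  apply: (le_trans (enormD _ _)); rewrite enormN; apply: lerD.
    apply: (le_trans (enorm_mulmx _ _)); rewrite -mulrA ler_wpM2l ?opnorm_ge0 //.
    by apply: (le_trans (enorm_mulmx _ _)); rewrite ler_wpM2l ?opnorm_ge0.
  apply: (le_trans (enorm_mulmx _ _)); rewrite ler_wpM2l ?opnorm_ge0 //.
  by apply: key => //; rewrite !ltW.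
move=> t tc; split; first exact: zE.
apply/eqP; rewrite -subr_eq0; apply/eqP; apply: enorm_eq0.
apply: (le_trans (key t 0 tc _)); last by rewrite mulr0.
move=> s /andP[s0 st]; have /andP[_ tc'] := tc.
by rewrite zE ?subrr ?enorm0 // s0 (le_trans st).
Qed.

Lemma window_prim d c (xi : R -> 'cV[R]_n) t : continuous xi -> 0 <= d -> 0 <= t ->
  window d c xi t = prim (t - d) (rhs c xi) t.
Proof.
move=> cxi d0 t0; rewrite /window primB //; first exact: rhs_borel.
- exact: rhs_loc_bounded.
- by rewrite lerDr.
- by rewrite gerBl.
Qed.

(** Both functions have the same predecessor, so its derivative cancels in the difference. What
    remains is Lipschitz in the history with constant 2 L from the delayed right-hand sides and mu
    (1 + L d) from the feedback bracket. *)
Lemma predictor_unique (d c1 mu0 c : R) (prev xi xi' xic : R -> 'cV[R]_n) :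
  0 < d -> 0 < mu0 -> 0 <= c -> continuous xi -> lip_loc xi 0 ->
  (forall t, - d <= t <= 0 -> xi' t = xi t) -> abs_cont 0 c xi' ->
  continuous xic -> (forall t, - d <= t <= c -> xic t = xi' t) ->
  {ae mu, forall t : R, 0 < t -> is_derive t 1 xi (rhs c1 xi t - rhs c1 xi (t - d) +
       derive1 prev t - mu0 *: (xi t - prev t - window d c1 xi t))} ->
  {ae mu, forall t : R, 0 < t < c -> is_derive t 1 xi' (rhs c1 xi' t - rhs c1 xi' (t - d) +
       derive1 prev t - mu0 *: (xi' t - prev t - prim (t - d) (rhs c1 xic) t))} ->
  forall t, 0 <= t <= c -> xi' t = xi t.
Proof.
move=> d0 m0 c0 cxi lxi xx0 ac' cxic xicE dxi dxi'.
have x00 : xi' 0 = xi 0 by apply: xx0; rewrite lexx oppr_le0 ltW.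
pose Lam := 2 * L + mu0 * (1 + L * d).
have Lam0 : 0 < Lam.
  by rewrite /Lam ltr_wpDr ?mulr_gt0 // mulr_ge0 ?(ltW m0) // addr_ge0 // mulr_ge0 // ltW.
apply: (gronwall_unique c0 Lam0 (lip_loc_abs_cont c lxi) ac' x00).
apply: ae_sub (ae_and dxi dxi') => t [H1 H2] t0c; have /andP[t0 tc] := t0c.
eexists; eexists; split; [exact: H1 t0|exact: H2 t0c|].
move=> M MP.
have M0 : 0 <= M by apply: le_trans (enorm_ge0 _) (MP 0 _); rewrite lexx ltW.
have MP' s : - d <= s <= t -> enorm (xi' s - xi s) <= M.
  move=> /andP[ds st]; have [s0|/ltW s0] := lerP s 0.
    by rewrite xx0 ?ds // subrr enorm0.
  by apply: MP; rewrite s0.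
rewrite window_prim ?(ltW d0) ?(ltW t0) //.
have -> : rhs c1 xi' t - rhs c1 xi' (t - d) + derive1 prev t -
     mu0 *: (xi' t - prev t - prim (t - d) (rhs c1 xic) t) -
   (rhs c1 xi t - rhs c1 xi (t - d) + derive1 prev t -
     mu0 *: (xi t - prev t - prim (t - d) (rhs c1 xi) t)) =
   (rhs c1 xi' t - rhs c1 xi t) - (rhs c1 xi' (t - d) - rhs c1 xi (t - d)) -
   mu0 *: ((xi' t - xi t) - (prim (t - d) (rhs c1 xic) t - prim (t - d) (rhs c1 xi) t)).
  move: (rhs c1 xi' t) (rhs c1 xi' (t - d)) (rhs c1 xi t) (rhs c1 xi (t - d))
    (prim _ _ _) (prim _ _ _) (derive1 _ _) (xi' t) (xi t) (prev t) => *.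
  by apply/matrixP => i j; rewrite !mxE; ring.
have ht : enorm (xi' t - xi t) <= M by apply: MP; rewrite lexx ltW.
have hd : enorm (xi' (t - d) - xi (t - d)) <= M by apply: MP'; apply/andP; split; lra.
have hp : enorm (prim (t - d) (rhs c1 xic) t - prim (t - d) (rhs c1 xi) t) <= L * M * d.
  have -> : L * M * d = L * M * (t - (t - d)) by ring.
  apply: prim_diff_le; try exact: rhs_borel; try exact: rhs_loc_bounded.
  - by rewrite gerBl ltW.
  - by rewrite mulr_ge0 // ltW.
  - move=> s /andP[s1 s2]; apply: (le_trans (rhs_lip _ _ _ _)); rewrite ler_wpM2l ?(ltW L0) //.
    by rewrite xicE; [apply: MP'|]; apply/andP; split; lra.
have -> : Lam * M = L * M + L * M + mu0 * (M + L * M * d) by rewrite /Lam; ring.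
apply: (le_trans (enormD _ _)); rewrite enormN enormZ ger0_norm ?(ltW m0) //; apply: lerD.
  apply: (le_trans (enormD _ _)); rewrite enormN; apply: lerD.
    by apply: (le_trans (rhs_lip _ _ _ _)); rewrite ler_wpM2l ?(ltW L0).
  by apply: (le_trans (rhs_lip _ _ _ _)); rewrite ler_wpM2l ?(ltW L0).
rewrite ler_wpM2l ?(ltW m0) //; apply: (le_trans (enormD _ _)).
by rewrite enormN; apply: lerD.
Qed.

(** * Linear growth on bounded intervals *)

Definition state_gain (c : R) := 2 * (1 + c) * expR (2 * L * c).

Lemma state_gain_ge1 c : 0 <= c -> 1 <= state_gain c.
Proof.
move=> c0; have e1 : 1 <= expR (2 * L * c) by rewrite one_le_expR // !mulr_ge0 // ltW.
rewrite /state_gain; have := ler_wpM2l c0 e1; nra.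
Qed.

Lemma state_growth (x : R -> 'cV[R]_n) (N c : R) : 0 <= c -> F <= N -> lip_loc x 0 ->
  enorm (x 0) <= N ->
  {ae mu, forall t : R, 0 < t -> is_derive t 1 x (rhs 0 x t)} ->
  forall t, 0 <= t <= c -> enorm (x t) <= state_gain c * N.
Proof.
move=> c0 FN lx x0N dx t tc; have N0 : 0 <= N := le_trans F_ge0 FN.
have /andP[t0 tc'] := tc.
apply: (le_trans (gronwall c0 L0 N0 (lip_loc_abs_cont c lx) x0N _ tc)).
  apply: ae_sub dx => s H /andP[s0 _]; exists (rhs 0 x s); first exact: H.
  move=> M MP; apply: (le_trans (rhs_bound _ _ _)); apply: lerD => //.
  by rewrite ler_wpM2l ?(ltW L0) // MP // lexx ltW.
have -> : 2 * (N + N * c) * expR (2 * L * t) = 2 * (1 + c) * N * expR (2 * L * t) by ring.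
rewrite /state_gain mulrAC ler_wpM2r // ler_wpM2l //; first by rewrite mulr_ge0 // addr_ge0.
by rewrite ler_expR ler_wpM2l // mulr_ge0 // ltW.
Qed.

(** The factor of N in Gronwall's bound for z, when the sampled values of w are at most a N. *)
Definition observer_gain k (K : 'M[R]_(n, k)) (H : 'M[R]_(k, n)) (B a c : R) :=
  2 * (1 + (1 + opnorm K * (a + opnorm H * B)) * c) *
  expR (2 * (L + opnorm K * opnorm H + opnorm K * (opnorm H * (L * B))) * c).

Lemma observer_growth k tau (tau_part : is_partition tau) (B : R)
    (K : 'M[R]_(n, k)) (H : 'M[R]_(k, n)) A (r c N a : R) (z : R -> 'cV[R]_n) :
  (forall i, tau i.+1 - tau i <= B) -> 0 <= c -> F <= N -> 0 <= a ->
  continuous z -> lip_loc z 0 -> enorm (z 0) <= N ->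
  (forall i, tau i <= c -> enorm (A i) <= a * N) ->
  {ae mu, forall t : R, 0 < t -> is_derive t 1 z
      (rhs (- r) z t + K *m (H *m z t - sampled tau_part H A r z t))} ->
  forall t, 0 <= t <= c -> enorm (z t) <= observer_gain K H B a c * N.
Proof.
move=> gap c0 FN a0 cz lz z0N AN dz t tc; have N0 : 0 <= N := le_trans F_ge0 FN.
have B0 : 0 <= B by apply: le_trans (gap 0%N); rewrite subr_ge0 ltW // tauS.
have bz := rhs_borel (- r) cz; have lbz := rhs_loc_bounded (- r) cz.
have kh : 0 <= opnorm K * opnorm H by rewrite mulr_ge0 ?opnorm_ge0.
have h0 := opnorm_ge0 H; have k0 := opnorm_ge0 K.
pose Lam := L + opnorm K * opnorm H + opnorm K * (opnorm H * (L * B)).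
have Lam0 : 0 < Lam by rewrite /Lam !ltr_wpDr // !mulr_ge0 ?opnorm_ge0 // ltW.
pose Z := N + opnorm K * (a * N + opnorm H * (N * B)).
have Z0 : 0 <= Z.
  by rewrite /Z addr_ge0 // mulr_ge0 // addr_ge0 ?mulr_ge0 // mulr_ge0.
have /andP[t0 tc'] := tc.
apply: (le_trans (gronwall c0 Lam0 Z0 (lip_loc_abs_cont c lz) z0N _ tc)); last first.
  have -> : 2 * (N + Z * c) * expR (2 * Lam * t) =
     2 * (1 + (1 + opnorm K * (a + opnorm H * B)) * c) * N * expR (2 * Lam * t) by rewrite /Z; ring.
  rewrite /observer_gain -/Lam mulrAC ler_wpM2r // ler_wpM2l //.
    by rewrite mulr_ge0 // addr_ge0 // mulr_ge0 // addr_ge0 // mulr_ge0 // addr_ge0 // mulr_ge0.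
  by rewrite ler_expR ler_wpM2l // mulr_ge0 // ltW.
apply: ae_sub dz => s Hd /andP[s0 sc]; eexists; first exact: (Hd s0).
move=> M MP; have zs : enorm (z s) <= M by apply: MP; rewrite lexx ltW.
have M0 : 0 <= M by exact: le_trans (enorm_ge0 _) zs.
have /andP[it ti] := tau_idxP tau_part (ltW s0).
have hw : enorm (sampled tau_part H A r z s) <= a * N + opnorm H * ((F + L * M) * B).
  rewrite (sampledE _ _ _ _ _ it ti); move: (tau_idx tau_part s) it ti => i it ti.
  apply: (le_trans (enormD _ _)); apply: lerD; first by apply: AN; rewrite (le_trans it) // ltW.
  apply: (le_trans (enorm_mulmx _ _)); rewrite ler_wpM2l //.
  have FLM : 0 <= F + L * M by rewrite addr_ge0 ?F_ge0 // mulr_ge0 // ltW.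
  apply: (@le_trans _ _ ((F + L * M) * (s - tau i))).
    apply: prim_lipschitz => //; first exact: tau_ge0.
    move=> y /andP[y1 y2]; apply: (le_trans (rhs_bound _ _ _)); rewrite lerD2l ler_wpM2l ?(ltW L0) //.
    by apply: MP; rewrite y2 (le_trans _ y1) // tau_ge0.
  by rewrite ler_wpM2l //; apply: le_trans (gap i); rewrite lerD2r ltW.
have -> : Z + Lam * M = (N + L * M) + (opnorm K * (opnorm H * M) +
   opnorm K * (a * N + opnorm H * ((N + L * M) * B))) by rewrite /Z /Lam; ring.
apply: (le_trans (enormD _ _)); apply: lerD.
  by apply: (le_trans (rhs_bound _ _ _)); apply: lerD => //; rewrite ler_wpM2l ?(ltW L0).
rewrite mulmxBr; apply: (le_trans (enormD _ _)); rewrite enormN; apply: lerD.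
  apply: (le_trans (enorm_mulmx _ _)); rewrite ler_wpM2l //.
  by apply: (le_trans (enorm_mulmx _ _)); rewrite ler_wpM2l.
apply: (le_trans (enorm_mulmx _ _)); rewrite ler_wpM2l //; apply: (le_trans hw).
by rewrite lerD2l ler_wpM2l // ler_wpM2r // lerD2r.
Qed.

(** Bounds the coefficient of exp(-mu t) in units of N: 1 for the initial value of the predictor, a
    for that of its predecessor, d (1 + L) for the initial window. *)
Definition offset_gain (d a : R) := 1 + a + d * (1 + L).

Definition predictor_gain (d c a : R) := a + offset_gain d a +
  2 * (d * (1 + L) + (2 + 2 * L * (a + offset_gain d a + 1)) * c) * expR (2 * (2 * L) * c).

Lemma window0_bound d c1 N (xi : R -> 'cV[R]_n) : 0 <= d -> F <= N -> continuous xi ->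
  (forall t, - d <= t <= 0 -> enorm (xi t) <= N) ->
  enorm (prim (- d) (rhs c1 xi) 0) <= d * (1 + L) * N.
Proof.
move=> d0 FN cxi xiN; have N0 : 0 <= N := le_trans F_ge0 FN.
have -> : d * (1 + L) * N = (N + L * N) * (0 - - d) by ring.
rewrite -[prim _ _ _]subr0 -(@prim_le _ _ (- d) (rhs c1 xi) (- d) (lexx _)).
apply: prim_lipschitz => //; first exact: rhs_borel.
- exact: rhs_loc_bounded.
- by rewrite oppr_le0.
- by rewrite addr_ge0 // mulr_ge0 // ltW.
- move=> t /xiN tN; apply: (le_trans (rhs_bound _ _ _)); apply: lerD => //.
  by rewrite ler_wpM2l // ltW.
Qed.

(** Gronwall's inequality is applied to the window, whose derivative is a difference of right-hand
    sides; the derivative of xi would bring in that of prev. The bound on xi follows from the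
    integrated equation. *)
Lemma predictor_growth (d c1 mu0 c N a : R) (prev xi : R -> 'cV[R]_n) (G0 : 'cV[R]_n) :
  0 < d -> 0 < mu0 -> 0 <= c -> F <= N -> 0 <= a -> continuous xi ->
  (forall t, - d <= t <= 0 -> enorm (xi t) <= N) ->
  (forall t, 0 <= t <= c -> enorm (prev t) <= a * N) ->
  enorm G0 <= offset_gain d a * N ->
  (forall t, 0 <= t -> xi t = prev t + window d c1 xi t + expR (- mu0 * t) *: G0) ->
  forall t, 0 <= t <= c -> enorm (xi t) <= predictor_gain d c a * N.
Proof.
move=> d0 m0 c0 FN a0 cxi xiN pN GN xiE t tc; have N0 : 0 <= N := le_trans F_ge0 FN.
have g0 : 0 <= offset_gain d a by rewrite /offset_gain !addr_ge0 // mulr_ge0 ?addr_ge0 // ltW.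
have L2 : 0 < 2 * L by rewrite mulr_gt0.
have eG s : 0 <= s -> enorm (expR (- mu0 * s) *: G0) <= offset_gain d a * N.
  move=> s0; rewrite enormZ ger0_norm ?expR_ge0 //; apply: le_trans GN.
  by rewrite ler_piMl ?enorm_ge0 // -expR0 ler_expR mulNr oppr_le0 mulr_ge0 // ltW.
pose Z := (2 + 2 * L * (a + offset_gain d a + 1)) * N.
have Z0 : 0 <= Z.
  by rewrite mulr_ge0 // addr_ge0 // mulr_ge0 ?(ltW L2) // addr_ge0 // addr_ge0.
have w0 : enorm (window d c1 xi 0) <= d * (1 + L) * N by rewrite window0; exact: window0_bound (ltW d0) _ _ _.
have /andP[t0 tc'] := tc.
have win : enorm (window d c1 xi t) <= 2 * (d * (1 + L) * N + Z * c) * expR (2 * (2 * L) * t).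
  apply: (gronwall c0 L2 Z0 (lip_loc_abs_cont c (lip_loc_window d c1 cxi)) w0 _ tc).
  apply: ae_sub (is_derive_window c1 d0 cxi) => s Hd /andP[s0 sc].
  eexists; first exact: (Hd s0).
  move=> M MP.
  have M0 : 0 <= M by apply: le_trans (enorm_ge0 _) (MP 0 _); rewrite lexx ltW.
  have bnd y : - d <= y <= s -> enorm (xi y) <= (a + offset_gain d a + 1) * N + M.
    move=> /andP[y1 y2]; have [y0|/ltW y0] := lerP y 0.
      apply: (le_trans (xiN y _)); first by rewrite y1.
      by rewrite -[leLHS]addr0 lerD // ler_peMl // lerDr addr_ge0.
    rewrite xiE // -addrA; apply: (le_trans (enormD _ _)).
    have -> : (a + offset_gain d a + 1) * N + M = a * N + (M + offset_gain d a * N) + N by ring.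
    rewrite -[leLHS]addr0 lerD //; apply: lerD; first by apply: pN; rewrite y0 (le_trans y2) // ltW.
    apply: (le_trans (enormD _ _)); apply: lerD; last exact: eG.
    by apply: MP; rewrite y0.
  have -> : Z + 2 * L * M = (N + L * ((a + offset_gain d a + 1) * N + M)) +
     (N + L * ((a + offset_gain d a + 1) * N + M)) by rewrite /Z; ring.
  apply: (le_trans (enormD _ _)); rewrite enormN; apply: lerD;
    apply: (le_trans (rhs_bound _ _ _)); apply: lerD => //; rewrite ler_wpM2l ?(ltW L0) //;
    apply: bnd; apply/andP; split; lra.
rewrite xiE // -addrA; apply: (le_trans (enormD _ _)).
have -> : predictor_gain d c a * N = a * N + (2 * (d * (1 + L) * N + Z * c) * expR (2 * (2 * L) * c)
   + offset_gain d a * N) by rewrite /predictor_gain /Z; ring.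
apply: lerD; first exact: pN.
apply: (le_trans (enormD _ _)); apply: lerD; last exact: eG.
apply: (le_trans win); rewrite ler_wpM2l //.
  rewrite mulr_ge0 // addr_ge0 //; last by rewrite mulr_ge0.
  by rewrite mulr_ge0 // mulr_ge0 ?addr_ge0 // ltW.
by rewrite ler_expR ler_wpM2l // mulr_ge0 // ltW.
Qed.

(** * Decay at late times *)

Lemma expN_weight (sg t : R) : expR (- sg * t) * expR (sg * t) = 1.
Proof. by rewrite -expRD mulNr addNr expR0. Qed.

Lemma weight_le (sg t E y : R) : expR (sg * t) * y <= E -> y <= expR (- sg * t) * E.
Proof.
by move=> h; rewrite mulNr expRN mulrC ler_pdivlMr ?expR_gt0 // mulrC.
Qed.

(** Since the last sample, w - H x(. - r) has moved by at most |H| L B times the past error, and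
    comparing weights over one sampling interval costs exp(sg B). Used as forcing in
    [lyapunov_decay], this gives E <= (1 + S) a + M0 exp(sg B) V cb + theta E. *)
Lemma observer_decay k tau (tau_part : is_partition tau) (B : R) (P : 'M[R]_n)
    (K : 'M[R]_(n, k)) (H : 'M[R]_(k, n)) A (vs : nat -> 'cV[R]_k) (r q sg T0 t1 a V : R)
    (x z : R -> 'cV[R]_n) :
  let M0 := Num.sqrt (opnorm (K^T *m P *m P *m K)) in
  let S := Num.sqrt (opnorm P / min_sphere P) in
  let cb := Num.sqrt (q * (q / opnorm P - 2 * sg) * min_sphere P)^-1 in
  let theta := M0 * expR (sg * B) * opnorm H * L * B * cb in
  (0 < n)%N -> sym_posdef P -> 0 < q -> 0 < r ->
  (forall x z u, U u ->
     bilin P (z - x) (G (z, u) - G (x, u)) + bilin (P *m K *m H) (z - x) (z - x)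
       <= - q * enorm (z - x) ^+ 2) ->
  (forall i, tau i.+1 - tau i <= B) ->
  continuous x -> lip_loc x 0 -> {ae mu, forall t : R, 0 < t -> is_derive t 1 x (rhs 0 x t)} ->
  continuous z -> lip_loc z 0 ->
  {ae mu, forall t : R, 0 < t -> is_derive t 1 z
      (rhs (- r) z t + K *m (H *m z t - sampled tau_part H A r z t))} ->
  (forall i, A i.+1 = H *m x (tau i.+1 - r) + vs i.+1) ->
  0 < sg -> 2 * sg < q / opnorm P -> theta < 1 -> r + B <= T0 -> T0 <= t1 ->
  (forall s, r <= s <= T0 -> expR (sg * s) * enorm (z s - x (s - r)) <= a) -> 0 <= V ->
  (forall i, (0 < i)%N -> tau i <= t1 -> expR (sg * tau i) * enorm (vs i) <= V) ->
  forall s, r <= s <= t1 -> expR (sg * s) * enorm (z s - x (s - r)) <=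
    ((1 + S) * a + M0 * expR (sg * B) * V * cb) / (1 - theta).
Proof.
move=> M0 S cb theta n0 hP q0 r0 hobs gap cx lx dx cz lz dz AE sg0 sgk th1 T0B T0t1 ea V0 vV.
have B0 : 0 <= B by apply: le_trans (gap 0%N); rewrite subr_ge0 ltW // tauS.
have rT0 : r <= T0 by apply: le_trans T0B; rewrite lerDl.
have T00 : 0 <= T0 by rewrite (le_trans (ltW r0)).
have h0 := opnorm_ge0 H; have M00 : 0 <= M0 := sqrtr_ge0 _.
have S0 : 0 <= S := sqrtr_ge0 _; have cb0 : 0 <= cb := sqrtr_ge0 _.
pose e t := z t - x (t + - r).
have ce : continuous e.
  move=> t; apply: cvgB; first exact: cz.
  exact: (continuous_reparam cx (shift_lip (- r))).
have le_ : lip_loc e T0.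
  apply: lip_locB; first exact: lip_locS lz.
  by apply: lip_locS (lip_loc_shift (- r) lx); rewrite sub0r opprK.
have [E [EP Emin]] := weighted_max sg (le_trans rT0 T0t1) ce.
have E0 : 0 <= E.
  apply: le_trans (EP r _); last by rewrite lexx (le_trans rT0).
  by rewrite mulr_ge0 ?expR_ge0 ?enorm_ge0.
have a0 : 0 <= a.
  apply: le_trans (ea r _); last by rewrite lexx rT0.
  by rewrite mulr_ge0 ?expR_ge0 ?enorm_ge0.
pose C := V + opnorm H * (L * B) * E.
have C0 : 0 <= C by rewrite addr_ge0 // !mulr_ge0 // ltW.
have dxr := ae_shift (- r) dx.
have bz := rhs_borel (- r) cz; have lbz := rhs_loc_bounded (- r) cz.
have eta s : T0 <= s <= t1 ->
    enorm (sampled tau_part H A r z s - H *m x (s + - r)) <= expR (sg * B) * C * expR (- sg * s).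
  move=> /andP[T0s st1]; have s0 : 0 <= s := le_trans T00 T0s.
  have /andP[it ti] := tau_idxP tau_part s0.
  rewrite (sampledE _ _ _ _ _ it ti); move: (tau_idx tau_part s) it ti => i it ti.
  (* As T0 >= r + B, the last sampling time lies beyond r: it has positive index, so w0 is no longer
     involved, and the delayed state is evaluated at positive times, where its equation holds. *)
  have tir : r < tau i by have := gap i; move: T0B T0s ti; lra.
  have i0 : (0 < i)%N by case: i tir {it ti} => //; rewrite tau0 // ltNge (ltW r0).
  pose Fi y := A i + H *m (prim 0 (rhs (- r) z) y - prim 0 (rhs (- r) z) (tau i)).
  pose D y := Fi y - H *m x (y + - r).
  rewrite -/(Fi s) -/(D s).
  have Dti : D (tau i) = vs i.
    rewrite /D /Fi subrr mulmx0 addr0; case: i i0 {it ti tir Fi D} => // i _.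
    by rewrite AE addrAC subrr add0r.
  have ti0 : 0 <= tau i := tau_ge0 tau_part i.
  have lD : lip_loc D (tau i).
    apply: lip_locB.
      apply: lip_locD; first exact: lip_loc_cst.
      by apply: lip_loc_mulmx; apply: lip_locB; [exact: lip_loc_prim|exact: lip_loc_cst].
    apply: lip_loc_mulmx; apply: lip_locS (lip_loc_shift (- r) lx).
    by rewrite sub0r opprK ltW.
  have hD : enorm (D s - D (tau i)) <= expR (- sg * tau i) * (opnorm H * (L * B) * E).
    pose k1 := opnorm H * (L * (expR (- sg * tau i) * E)).
    have k10 : 0 <= k1 by rewrite !mulr_ge0 ?expR_ge0 // ltW.
    apply: (@le_trans _ _ (k1 * s - k1 * tau i)).
      apply: (abs_cont_growth it (lip_loc_abs_cont s lD)) => [y1 y2 _ y12 _|].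
        by rewrite ler_wpM2l.
      apply: ae_sub (ae_and dxr (is_derive_prim 0 bz lbz)) => y [H1 H2] /andP[iy ys].
      have yr : 0 < y + - r by rewrite subr_gt0 (lt_trans tir).
      have y0 : 0 < y by rewrite (le_lt_trans ti0).
      exists (H *m rhs (- r) z y - H *m rhs 0 x (y + - r)), k1; split.
      - apply: is_deriveB_fun.
          apply: is_derive_addc; apply: is_derive_mulmx.
          have := is_deriveB_fun (H2 y0) (is_derive_cst (prim 0 (rhs (- r) z) (tau i)) y 1).
          by rewrite subr0.
        by apply: is_derive_mulmx; apply: is_derive_shift; exact: H1.
      - exact: is_derive_lin.
      - rewrite -mulmxBr; apply: (le_trans (enorm_mulmx _ _)); rewrite ler_wpM2l //.
        rewrite /rhs addr0; apply: (le_trans (lipG _ _ (Uut _))); rewrite ler_wpM2l ?(ltW L0) //.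
        have ey : expR (sg * y) * enorm (e y) <= E.
          by apply: EP; rewrite (ltW (lt_trans tir iy)) (le_trans (ltW ys)).
        apply: (le_trans (weight_le ey)); rewrite ler_wpM2r // ler_expR !mulNr lerN2.
        by rewrite ler_wpM2l ?ltW.
    have -> : expR (- sg * tau i) * (opnorm H * (L * B) * E) = k1 * B by rewrite /k1; ring.
    rewrite -mulrBr ler_wpM2l //; apply: le_trans (gap i).
    by rewrite lerD2r ltW.
  have hv : enorm (vs i) <= expR (- sg * tau i) * V.
    by apply: weight_le; apply: vV => //; rewrite (le_trans it).
  have hC : enorm (D s) <= expR (- sg * tau i) * C.
    rewrite /C mulrDr; apply: (le_trans (enorm_distl (D s) (D (tau i)))).
    by rewrite Dti in hD *; apply: lerD.
  apply: (le_trans hC).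
  have -> : expR (sg * B) * C * expR (- sg * s) = expR (sg * B + - sg * s) * C.
    by rewrite expRD; ring.
  rewrite ler_wpM2r // ler_expR; have := gap i.
  have : 0 <= sg * (tau i + B - s) by rewrite mulr_ge0 ?(ltW sg0) //; have := gap i; lra.
  lra.
have bound t : r <= t <= t1 -> expR (sg * t) * enorm (e t) <=
    (1 + S) * a + M0 * (expR (sg * B) * C) * cb.
  move=> /andP[rt tt1]; have [tT0|/ltW T0t] := lerP t T0.
    apply: (le_trans (ea t _)); first by rewrite rt tT0.
    rewrite mulrDl mul1r -addrA lerDl addr_ge0 ?mulr_ge0 ?expR_ge0 //.
  have M1 : 0 <= M0 * (expR (sg * B) * C) by rewrite !mulr_ge0 ?expR_ge0.
  have eb : exists N, forall s, T0 <= s <= t -> enorm (e s) <= N.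
    by have [N N0 NP] := loc_bounded_itv T0 t (continuous_loc_bounded ce); exists N.
  apply: (le_trans (lyapunov_decay n0 hP q0 sg0 sgk M1 T0t le_ eb T00 _)).
    apply: ae_sub (ae_and dz dxr) => s [H1 H2] /andP[T0s st].
    have s0 : 0 < s := le_lt_trans T00 T0s.
    have sr : 0 < s + - r by rewrite subr_gt0 (le_lt_trans rT0).
    eexists; first exact: (is_deriveB_fun (H1 s0) (is_derive_shift (H2 sr))).
    pose w := sampled tau_part H A r z s.
    have hs : enorm (w - H *m x (s + - r)) <= expR (sg * B) * C * expR (- sg * s).
      by apply: eta; rewrite (ltW T0s) (le_trans (ltW st)).
    have -> : rhs (- r) z s + K *m (H *m z s - sampled tau_part H A r z s) - rhs 0 x (s + - r) =
      (G (z s, ut (s + - r)) - G (x (s + - r), ut (s + - r))) +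
       (K *m (H *m e s) - K *m (w - H *m x (s + - r))).
      by rewrite -/w (gain_error _ _ _ _ _ (x (s + - r)) w) /rhs addr0.
    rewrite bilinDr [bilin P _ (K *m _ - _)]bilinDr bilinNr.
    have E1 : bilin P (e s) (K *m (H *m e s)) = bilin (P *m K *m H) (e s) (e s).
      by rewrite /bilin !mulmxA.
    have E2 : `|bilin P (e s) (K *m (w - H *m x (s + - r)))| <=
       enorm (e s) * (M0 * (expR (sg * B) * C) * expR (- sg * s)).
      apply: (le_trans (bilin_le _ _ _)); rewrite ler_wpM2l ?enorm_ge0 // mulmxA.
      by apply: (le_trans (enorm_PK K _ (proj1 hP))); rewrite -mulrA ler_wpM2l.
    have := hobs (x (s + - r)) (z s) _ (Uut (s + - r)); rewrite -/(e s) E1.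
    by move: E2; rewrite ler_norml => /andP[]; lra.
  rewrite lerD2r; apply: (@le_trans _ _ (S * a)).
    by rewrite ler_wpM2l // ea // rT0 lexx.
  by rewrite ler_wpM2r // lerDr.
(* C contains E, so this is an inequality of E with itself; it is solved by dividing by 1 -
   theta. *)
have EC := Emin _ bound.
have th0 : 0 < 1 - theta by rewrite subr_gt0.
move=> s sb; apply: (le_trans (EP s sb)); rewrite ler_pdivlMr //.
rewrite mulrBr mulr1 lerBlDr; apply: (le_trans EC).
by rewrite /C /theta le_eqVlt; apply/orP; left; apply/eqP; ring.
Qed.

(** The error is that of the predecessor at the earlier target time, plus the integral over
    [t - d, t] of a difference of right-hand sides, plus the exponential residual. The middle term
    contributes theta times E. *)
Lemma predictor_decay (d c1 mu0 r sg T0 t1 a Dp g : R) (x prev xi : R -> 'cV[R]_n) (G0 : 'cV[R]_n) :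
  let theta := L * d * expR (sg * d) in
  0 < d -> 0 < r -> 0 < sg -> sg <= mu0 -> theta < 1 -> r + d <= T0 -> T0 <= t1 -> d - r <= c1 ->
  continuous x -> lip_loc x 0 -> {ae mu, forall t : R, 0 < t -> is_derive t 1 x (rhs 0 x t)} ->
  continuous xi ->
  (forall t, 0 <= t -> xi t = prev t + window d c1 xi t + expR (- mu0 * t) *: G0) ->
  (forall s, r <= s <= T0 -> expR (sg * s) * enorm (xi s - x (s + c1)) <= a) ->
  (forall s, r <= s <= t1 -> expR (sg * s) * enorm (prev s - x (s + c1 - d)) <= Dp) ->
  enorm G0 <= g ->
  forall s, r <= s <= t1 -> expR (sg * s) * enorm (xi s - x (s + c1)) <= (a + Dp + g) / (1 - theta).
Proof.
move=> theta d0 r0 sg0 sgmu th1 T0d T0t1 c1d cx lx dx cxi xiE ea eD Gg.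
have rT0 : r <= T0 by apply: le_trans T0d; rewrite lerDl ltW.
have T00 : 0 <= T0 by rewrite (le_trans (ltW r0)).
pose e t := xi t - x (t + c1).
have ce : continuous e.
  move=> t; apply: cvgB; first exact: cxi.
  exact: (continuous_reparam cx (shift_lip c1)).
have [E [EP Emin]] := weighted_max sg (le_trans rT0 T0t1) ce.
have E0 : 0 <= E.
  apply: le_trans (EP r _); last by rewrite lexx (le_trans rT0).
  by rewrite mulr_ge0 ?expR_ge0 ?enorm_ge0.
have a0 : 0 <= a.
  apply: le_trans (ea r _); last by rewrite lexx rT0.
  by rewrite mulr_ge0 ?expR_ge0 ?enorm_ge0.
have Dp0 : 0 <= Dp.
  apply: le_trans (eD r _); last by rewrite lexx (le_trans rT0).
  by rewrite mulr_ge0 ?expR_ge0 ?enorm_ge0.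
have g0 : 0 <= g := le_trans (enorm_ge0 _) Gg.
have dxc := ae_shift c1 dx.
have bxi := rhs_borel c1 cxi; have lbxi := rhs_loc_bounded c1 cxi.
have bound t : r <= t <= t1 -> expR (sg * t) * enorm (e t) <= a + Dp + g + theta * E.
  have th0 : 0 <= theta * E by rewrite !mulr_ge0 ?expR_ge0 // ltW.
  move=> /andP[rt tt1]; have [tT0|/ltW T0t] := lerP t T0.
    apply: (le_trans (ea t _)); first by rewrite rt tT0.
    by rewrite -!addrA lerDl !addr_ge0.
  have t0 : 0 <= t := le_trans T00 T0t.
  pose D y := prim (- d) (rhs c1 xi) y - x (y + c1).
  have tdt : t - d <= t by rewrite gerBl ltW.
  (* The true state satisfies the window identity without residual: x(t + c1) - x(t + c1 - d) is the
     integral of its own right-hand side, so it can be subtracted inside D. *)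
  have eE : e t = (prev t - x (t + c1 - d)) + (D t - D (t - d)) + expR (- mu0 * t) *: G0.
    rewrite /e xiE // /window /D -[t - d + c1]addrAC.
    move: (prim _ _ t) (prim _ _ (t - d)) (prev t) (x _) (x _) => *.
    by apply/matrixP => i j; rewrite !mxE; ring.
  have lD : lip_loc D (t - d).
    apply: lip_locB; first exact: lip_loc_prim.
    by apply: lip_locS (lip_loc_shift c1 lx); lra.
  have hD : enorm (D t - D (t - d)) <= expR (- sg * t) * (theta * E).
    pose k1 := L * (expR (- sg * (t - d)) * E).
    have k10 : 0 <= k1 by rewrite !mulr_ge0 ?expR_ge0 // ltW.
    apply: (@le_trans _ _ (k1 * t - k1 * (t - d))).
      apply: (abs_cont_growth tdt (lip_loc_abs_cont t lD)) => [y1 y2 _ y12 _|].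
        by rewrite ler_wpM2l.
      apply: ae_sub (ae_and dxc (is_derive_prim (- d) bxi lbxi)) => y [H1 H2] /andP[dy yt].
      (* Here d - r <= c1 and r + d <= T0 enter: the window starts after r, so the shifted state is
         evaluated at positive times. *)
      have yc : 0 < y + c1 by lra.
      have yd : - d < y by lra.
      exists (rhs c1 xi y - rhs 0 x (y + c1)), k1; split.
      - by apply: is_deriveB_fun (H2 yd) (is_derive_shift (H1 yc)).
      - exact: is_derive_lin.
      - rewrite /rhs addr0; apply: (le_trans (lipG _ _ (Uut _))); rewrite ler_wpM2l ?(ltW L0) //.
        have ry : r <= y by lra.
        have ey : expR (sg * y) * enorm (e y) <= E.
          by apply: EP; rewrite ry (le_trans (ltW yt)).
        apply: (le_trans (weight_le ey)); rewrite ler_wpM2r // ler_expR !mulNr lerN2.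
        by rewrite ler_wpM2l ?ltW.
    have -> : k1 * t - k1 * (t - d) = k1 * d by ring.
    have -> : expR (- sg * t) * (theta * E) = L * (expR (- sg * t + sg * d) * E) * d.
      by rewrite expRD /theta; ring.
    have -> : - sg * t + sg * d = - sg * (t - d) by ring.
    exact: lexx.
  have hp : enorm (prev t - x (t + c1 - d)) <= expR (- sg * t) * Dp.
    by apply: weight_le; apply: eD; rewrite rt.
  have hG : enorm (expR (- mu0 * t) *: G0) <= expR (- sg * t) * g.
    rewrite enormZ ger0_norm ?expR_ge0 //; apply: ler_pM; rewrite ?expR_ge0 ?enorm_ge0 //.
    by rewrite ler_expR !mulNr lerN2 ler_wpM2r.
  have : enorm (e t) <= expR (- sg * t) * (Dp + theta * E + g).
    rewrite eE !mulrDr; apply: (le_trans (enormD _ _)); apply: lerD => //.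
    by apply: (le_trans (enormD _ _)); apply: lerD.
  move=> h; apply: (@le_trans _ _ (Dp + theta * E + g)); last first.
    have -> : a + Dp + g + theta * E = a + (Dp + theta * E + g) by ring.
    by rewrite lerDr.
  apply: (le_trans (ler_wpM2l (expR_ge0 _) h)).
  by rewrite mulrA [expR (sg * t) * _]mulrC expN_weight mul1r.
have EC := Emin _ bound.
have th0 : 0 < 1 - theta by rewrite subr_gt0.
move=> s sb; apply: (le_trans (EP s sb)); rewrite ler_pdivlMr //.
by rewrite mulrBr mulr1 lerBlDr [E * _]mulrC.
Qed.

(** * Monotonicity and positivity of the gains *)

Lemma state_gain_mono c c' : 0 <= c -> c <= c' -> state_gain c <= state_gain c'.
Proof.
move=> c0 cc; rewrite /state_gain; apply: ler_pM; rewrite ?expR_ge0 //.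
- by rewrite mulr_ge0 // addr_ge0.
- by rewrite ler_wpM2l // lerD2l.
- by rewrite ler_expR ler_wpM2l // mulr_ge0 // ltW.
Qed.

Lemma observer_gain_mono k (K : 'M[R]_(n, k)) (H : 'M[R]_(k, n)) B a c c' :
  0 <= B -> 0 <= a -> 0 <= c -> c <= c' -> observer_gain K H B a c <= observer_gain K H B a c'.
Proof.
move=> B0 a0 c0 cc; rewrite /observer_gain.
have h0 := opnorm_ge0 H; have k0 := opnorm_ge0 K.
have z0 : 0 <= 1 + opnorm K * (a + opnorm H * B) by rewrite addr_ge0 // mulr_ge0 // addr_ge0 // mulr_ge0.
apply: ler_pM; rewrite ?expR_ge0 //.
- by rewrite mulr_ge0 // addr_ge0 // mulr_ge0.
- by rewrite ler_wpM2l // lerD2l ler_wpM2l.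
- rewrite ler_expR ler_wpM2l // mulr_ge0 // addr_ge0 ?addr_ge0 ?mulr_ge0 // ?ltW //.
Qed.

Lemma observer_gain_ge0 k (K : 'M[R]_(n, k)) (H : 'M[R]_(k, n)) B a c :
  0 <= B -> 0 <= a -> 0 <= c -> 0 <= observer_gain K H B a c.
Proof.
move=> B0 a0 c0; rewrite /observer_gain mulr_ge0 ?expR_ge0 // mulr_ge0 // addr_ge0 // mulr_ge0 //.
by rewrite addr_ge0 // mulr_ge0 ?opnorm_ge0 // addr_ge0 // mulr_ge0 ?opnorm_ge0.
Qed.

Lemma offset_gain_ge0 d a : 0 <= d -> 0 <= a -> 0 <= offset_gain d a.
Proof.
by move=> d0 a0; rewrite /offset_gain !addr_ge0 // mulr_ge0 ?addr_ge0 // ltW.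
Qed.

Lemma predictor_gain_mono d c c' a : 0 <= d -> 0 <= a -> 0 <= c -> c <= c' ->
  predictor_gain d c a <= predictor_gain d c' a.
Proof.
move=> d0 a0 c0 cc; rewrite /predictor_gain lerD2l.
have o0 := offset_gain_ge0 d0 a0; have L0' := ltW L0.
have z0 : 0 <= 2 + 2 * L * (a + offset_gain d a + 1).
  rewrite addr_ge0 // mulr_ge0 //; first by rewrite mulr_ge0.
  by rewrite addr_ge0 // addr_ge0.
have y0 : 0 <= d * (1 + L) by rewrite mulr_ge0 // addr_ge0.
apply: ler_pM; rewrite ?expR_ge0 //.
- by rewrite mulr_ge0 // addr_ge0 // mulr_ge0.
- by rewrite ler_wpM2l // lerD2l ler_wpM2l.
- by rewrite ler_expR ler_wpM2l // !mulr_ge0.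
Qed.

Lemma predictor_gain_ge0 d c a : 0 <= d -> 0 <= a -> 0 <= c -> 0 <= predictor_gain d c a.
Proof.
move=> d0 a0 c0; have o0 := offset_gain_ge0 d0 a0; have L0' := ltW L0.
rewrite /predictor_gain addr_ge0 //; first exact: addr_ge0.
rewrite mulr_ge0 ?expR_ge0 // mulr_ge0 // addr_ge0 //; first by rewrite mulr_ge0 // addr_ge0.
rewrite mulr_ge0 // addr_ge0 // mulr_ge0 //; first by rewrite mulr_ge0.
by rewrite addr_ge0 // addr_ge0.
Qed.

(** * The chain of predictors *)

Definition chain_link (d mu0 c : R) (x0 prev xi : R -> 'cV[R]_n) :=
  [/\ continuous xi, (forall t, t <= 0 -> xi t = x0 t), lip_loc xi 0,
    (forall t, 0 <= t -> xi t = prev t + window d c xi t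
       + expR (- mu0 * t) *: (x0 0 - prev 0 - prim (- d) (rhs c x0) 0)) &
    {ae mu, forall t : R, 0 < t -> is_derive t 1 xi (rhs c xi t - rhs c xi (t - d) +
       derive1 prev t - mu0 *: (xi t - prev t - window d c xi t))}].

(** The observer state is member 0, so that every predictor has a predecessor of the same kind.
    Recursion runs over functions bundled with the regularity that [predictor_solution] asks of a
    predecessor, and continues beyond p. *)
Lemma chain_solution (d mu0 : R) (c : nat -> R) (xi0 : nat -> R -> 'cV[R]_n) (z : R -> 'cV[R]_n) :
  0 < d -> 0 < mu0 -> (forall i, continuous (xi0 i)) ->
  (forall i t, 0 <= t -> xi0 i t = xi0 i 0) ->
  lip_loc z 0 -> {ae mu, forall t : R, 0 < t -> derivable z t 1} ->
  exists xi : nat -> R -> 'cV[R]_n, xi 0%N = z /\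
    forall i, chain_link d mu0 (c i.+1) (xi0 i.+1) (xi i) (xi i.+1).
Proof.
move=> d0 m0 cxi0 xi0c lz dz.
pose good (y : R -> 'cV[R]_n) := lip_loc y 0 /\ {ae mu, forall t : R, 0 < t -> derivable y t 1}.
have step (iy : nat * {y | good y}) : exists y' : {y | good y},
    chain_link d mu0 (c iy.1.+1) (xi0 iy.1.+1) (sval iy.2) (sval y').
  case: iy => i [y [ly dy]] /=.
  have [xi xiP] := predictor_solution (c i.+1) d0 m0 (@cxi0 i.+1) (@xi0c i.+1) ly dy.
  have gxi : good xi.
    case: xiP => _ _ lxi _ dxi; split; first exact: lxi.
    by apply: ae_sub dxi => t Hd t0; have h := Hd t0; exact: ex_derive.
  by exists (exist _ xi gxi).
have [S SP] := choice step.
pose X := fix X (i : nat) : {y | good y} := if i is j.+1 then S (j, X j) else exist _ z (conj lz dz).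
exists (fun i => sval (X i)); split => // i.
exact: (SP (i, X i)).
Qed.

(** The samples of w are at most (|H| [state_gain T0] + 1) N, the 1 standing for the measurement
    error; each predictor then feeds the gain of its predecessor into its own. *)
Definition growth_gain k (K : 'M[R]_(n, k)) (H : 'M[R]_(k, n)) (B d T0 : R) (i : nat) : R :=
  iter i (predictor_gain d T0) (observer_gain K H B (opnorm H * state_gain T0 + 1) T0).

Lemma growth_gain_ge0 k (K : 'M[R]_(n, k)) (H : 'M[R]_(k, n)) B d T0 i :
  0 <= B -> 0 <= d -> 0 <= T0 -> 0 <= growth_gain K H B d T0 i.
Proof.
move=> B0 d0 T00; have s0 : 0 <= state_gain T0 := le_trans ler01 (state_gain_ge1 T00).
elim: i => [|i IH]; last exact: predictor_gain_ge0.
by apply: observer_gain_ge0 => //; rewrite addr_ge0 // mulr_ge0 ?opnorm_ge0.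
Qed.

Lemma offset_bound (d a N : R) (y1 y2 y3 : 'cV[R]_n) :
  enorm y1 <= N -> enorm y2 <= a * N -> enorm y3 <= d * (1 + L) * N ->
  enorm (y1 - y2 - y3) <= offset_gain d a * N.
Proof.
move=> h1 h2 h3; have := enormD (y1 - y2) (- y3); have := enormD y1 (- y2).
by rewrite !enormN /offset_gain; lra.
Qed.

Lemma chain_growth k tau (tau_part : is_partition tau) (B : R)
    (K : 'M[R]_(n, k)) (H : 'M[R]_(k, n)) A (vs : nat -> 'cV[R]_k) (r d mu0 T0 c N : R)
    (cs : nat -> R) (x z : R -> 'cV[R]_n) (xi0 xi : nat -> R -> 'cV[R]_n) :
  (forall i, tau i.+1 - tau i <= B) -> 0 < r -> 0 < d -> 0 < mu0 -> 0 <= c -> c <= T0 -> F <= N ->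
  lip_loc x 0 -> {ae mu, forall t : R, 0 < t -> is_derive t 1 x (rhs 0 x t)} ->
  (forall t, - r <= t <= 0 -> enorm (x t) <= N) ->
  continuous z -> lip_loc z 0 -> enorm (z 0) <= N ->
  {ae mu, forall t : R, 0 < t -> is_derive t 1 z
      (rhs (- r) z t + K *m (H *m z t - sampled tau_part H A r z t))} ->
  enorm (A 0%N) <= N -> (forall i, A i.+1 = H *m x (tau i.+1 - r) + vs i.+1) ->
  (forall i, tau i <= c -> enorm (vs i) <= N) ->
  xi 0%N = z -> (forall i, chain_link d mu0 (cs i.+1) (xi0 i.+1) (xi i) (xi i.+1)) ->
  (forall i t, - d <= t <= 0 -> enorm (xi0 i t) <= N) -> (forall i, continuous (xi0 i)) ->
  forall i t, 0 <= t <= c -> enorm (xi i t) <= growth_gain K H B d T0 i * N.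
Proof.
move=> gap r0 d0 m0 c0 cT0 FN lx dx hx cz lz hz dz A0 AS hv xi0z link hxi0 cxi0.
have N0 : 0 <= N := le_trans F_ge0 FN.
have B0 : 0 <= B by apply: le_trans (gap 0%N); rewrite subr_ge0 ltW // tauS.
have T00 : 0 <= T0 := le_trans c0 cT0.
have s1 : 1 <= state_gain T0 := state_gain_ge1 T00.
have s0 : 0 <= state_gain T0 := le_trans ler01 s1.
have xc t : - r <= t <= c -> enorm (x t) <= state_gain T0 * N.
  move=> /andP[rt tc]; have [t0|/ltW t0] := leP t 0.
    by apply: (@le_trans _ _ N); [apply: hx; rewrite rt|rewrite ler_peMl].
  apply: (le_trans (state_growth c0 FN lx _ dx _)); first by apply: hx; rewrite lexx oppr_le0 ltW.
    by rewrite t0.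
  by rewrite ler_wpM2r // state_gain_mono.
have a0 : 0 <= opnorm H * state_gain T0 + 1 by rewrite addr_ge0 // mulr_ge0 ?opnorm_ge0.
have hA i : tau i <= c -> enorm (A i) <= (opnorm H * state_gain T0 + 1) * N.
  case: i => [_|i ic].
    by apply: (le_trans A0); rewrite ler_peMl // lerDr mulr_ge0 ?opnorm_ge0.
  rewrite AS mulrDl mul1r; apply: (le_trans (enormD _ _)); apply: lerD; last exact: hv.
  apply: (le_trans (enorm_mulmx _ _)); rewrite -mulrA ler_wpM2l ?opnorm_ge0 //; apply: xc.
  by have := tau_ge0 tau_part i.+1; move: r0 ic => ? ? ?; apply/andP; split; lra.
elim=> [|i IH] t tc.
  rewrite xi0z; apply: (le_trans (observer_growth gap c0 FN a0 cz lz hz hA dz tc)).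
  by rewrite ler_wpM2r // observer_gain_mono.
have [cxi xiN lxi xiE dxi] := link i.
have g0 := growth_gain_ge0 K H i B0 (ltW d0) T00.
have hxi s : - d <= s <= 0 -> enorm (xi i.+1 s) <= N.
  by move=> ds; rewrite xiN; [apply: hxi0|case/andP: ds].
have hG : enorm (xi0 i.+1 0 - xi i 0 - prim (- d) (rhs (cs i.+1) (xi0 i.+1)) 0) <=
    offset_gain d (growth_gain K H B d T0 i) * N.
  have h1 : enorm (xi0 i.+1 0) <= N by apply: hxi0; rewrite lexx oppr_le0 ltW.
  have h2 : enorm (xi i 0) <= growth_gain K H B d T0 i * N by apply: IH; rewrite lexx.
  have h3 := window0_bound (cs i.+1) (ltW d0) FN (cxi0 i.+1) (@hxi0 i.+1).
  exact: offset_bound.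
apply: (le_trans (predictor_growth d0 m0 c0 FN g0 cxi hxi IH hG xiE tc)).
by rewrite ler_wpM2r // predictor_gain_mono // ltW.
Qed.

(** The i-th member estimates x(s + i delta - r), which for i = p is x(s). The bounds D i are
    specified by their recursion, so that a solution linear in N and V can be supplied later. *)
Lemma chain_decay k tau (tau_part : is_partition tau) (B : R) (P : 'M[R]_n)
    (K : 'M[R]_(n, k)) (H : 'M[R]_(k, n)) A (vs : nat -> 'cV[R]_k) (r d q sg mu0 T0 t1 N V : R)
    (p : nat) (D : nat -> R) (x z : R -> 'cV[R]_n) (xi0 xi : nat -> R -> 'cV[R]_n) :
  let M0 := Num.sqrt (opnorm (K^T *m P *m P *m K)) in
  let S := Num.sqrt (opnorm P / min_sphere P) in
  let cb := Num.sqrt (q * (q / opnorm P - 2 * sg) * min_sphere P)^-1 in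
  let theta := M0 * expR (sg * B) * opnorm H * L * B * cb in
  let theta' := L * d * expR (sg * d) in
  let a i := expR (sg * T0) * (growth_gain K H B d T0 i + state_gain T0) * N in
  (0 < n)%N -> sym_posdef P -> 0 < q ->
  (forall x z u, U u ->
     bilin P (z - x) (G (z, u) - G (x, u)) + bilin (P *m K *m H) (z - x) (z - x)
       <= - q * enorm (z - x) ^+ 2) ->
  (forall i, tau i.+1 - tau i <= B) -> 0 < r -> 0 < d -> p%:R * d = r -> sg <= mu0 -> F <= N ->
  continuous x ->
  lip_loc x 0 -> {ae mu, forall t : R, 0 < t -> is_derive t 1 x (rhs 0 x t)} ->
  (forall t, - r <= t <= 0 -> enorm (x t) <= N) ->
  continuous z -> lip_loc z 0 -> enorm (z 0) <= N ->
  {ae mu, forall t : R, 0 < t -> is_derive t 1 z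
      (rhs (- r) z t + K *m (H *m z t - sampled tau_part H A r z t))} ->
  enorm (A 0%N) <= N -> (forall i, A i.+1 = H *m x (tau i.+1 - r) + vs i.+1) ->
  (forall i, tau i <= T0 -> enorm (vs i) <= N) ->
  xi 0%N = z ->
  (forall i, chain_link d mu0 (i.+1%:R * d - r) (xi0 i.+1) (xi i) (xi i.+1)) ->
  (forall i t, - d <= t <= 0 -> enorm (xi0 i t) <= N) -> (forall i, continuous (xi0 i)) ->
  0 < sg -> 2 * sg < q / opnorm P -> theta < 1 -> theta' < 1 -> r + B <= T0 -> r + d <= T0 ->
  T0 <= t1 -> 0 <= V ->
  (forall i, (0 < i)%N -> tau i <= t1 -> expR (sg * tau i) * enorm (vs i) <= V) ->
  D 0%N = ((1 + S) * a 0%N + M0 * expR (sg * B) * V * cb) / (1 - theta) ->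
  (forall i, D i.+1 = (a i.+1 + D i + offset_gain d (growth_gain K H B d T0 i) * N) / (1 - theta')) ->
  forall i, (i <= p)%N -> forall s, r <= s <= t1 ->
    expR (sg * s) * enorm (xi i s - x (s + (i%:R * d - r))) <= D i.
Proof.
move=> M0 S cb theta theta' a n0 hP q0 hobs gap r0 d0 pd sgmu FN cx lx dx hx cz lz hz dz A0 AS hv.
move=> xi0z link hxi0 cxi0 sg0 sgk th1 th2 T0B T0d T0t1 V0 vV D0 DS.
have m0 : 0 < mu0 := lt_le_trans sg0 sgmu.
have T00 : 0 <= T0 by apply: le_trans T0d; rewrite addr_ge0 ?ltW.
have N0 : 0 <= N := le_trans F_ge0 FN.
have gr := @chain_growth k tau tau_part B K H A vs r d mu0 T0 T0 N
  (fun i => i%:R * d - r) x z xi0 xi gap r0 d0 m0 T00 (lexx T0) FN lx dx hx cz lz hz dz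
  A0 AS hv xi0z link hxi0 cxi0.
have hx0 : enorm (x 0) <= N by apply: hx; rewrite lexx oppr_le0 ltW.
(* For i <= p the shift lies in [-r, 0], so at s in [r, T0] the state is evaluated within [0, T0],
   where [state_growth] applies. *)
have ip i : (i <= p)%N -> - r <= i%:R * d - r <= 0.
  move=> ip; rewrite -{3}pd subr_le0 ler_wpM2r ?(ltW d0) ?ler_nat // andbT.
  by rewrite lerDr mulr_ge0 // ltW.
have early i s : (i <= p)%N -> r <= s <= T0 ->
    expR (sg * s) * enorm (xi i s - x (s + (i%:R * d - r))) <= a i.
  move=> /ip /andP[i0 i1] /andP[rs sT]; rewrite /a -mulrA; apply: ler_pM; rewrite ?expR_ge0 ?enorm_ge0 //.
    by rewrite ler_expR ler_wpM2l // ltW.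
  rewrite mulrDl; apply: (le_trans (enormD _ _)); rewrite enormN; apply: lerD.
    by apply: gr; rewrite sT andbT (le_trans (ltW r0)).
  by apply: (state_growth T00 FN lx hx0 dx); apply/andP; split; lra.
elim=> [_ s rs|i IH ilp].
  have e1 t : t + (0%:R * d - r) = t - r by rewrite mul0r sub0r.
  rewrite D0 e1 xi0z.
  apply: (observer_decay n0 hP q0 r0 hobs gap cx lx dx cz lz dz AS sg0 sgk th1 T0B T0t1 _ V0 vV) => //.
  by move=> t /(early 0%N t isT); rewrite e1 xi0z.
have [cxi xiN lxi xiE dxi] := link i.
have := predictor_decay d0 r0 sg0 sgmu th2 T0d T0t1 _ cx lx dx cxi xiE (fun t => early i.+1 t ilp) _ _.
move=> h s rs; rewrite DS; apply: h rs.
- by rewrite -natr1 mulrDl mul1r [_ * d + d]addrC lerD2r lerDl mulr_ge0 // ltW.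
- move=> t rt; have := IH (ltnW ilp) t rt.
  by congr (_ * enorm (_ - x _) <= _); rewrite -natr1; ring.
- have h1 : enorm (xi0 i.+1 0) <= N by apply: hxi0; rewrite lexx oppr_le0 ltW.
  have h2 : enorm (xi i 0) <= growth_gain K H B d T0 i * N by apply: gr; rewrite lexx.
  have h3 := window0_bound (i.+1%:R * d - r) (ltW d0) FN (cxi0 i.+1) (@hxi0 i.+1).
  exact: offset_bound.
Qed.

(** * Back to the original system and its uniqueness *)

Section Realization.
Context {k : nat} (p : nat) (f : 'cV[R]_n -> 'cV[R]_m -> 'cV[R]_n).
Context (K : 'M[R]_(n, k)) (H : 'M[R]_(k, n)) (r B mu0 : R) (tau : nat -> R).
Context (tau_part : is_partition tau) (z0 : 'cV[R]_n) (w0 : 'cV[R]_k).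
Context (u : R -> 'cV[R]_m) (v : R -> 'cV[R]_k) (x0 : R -> 'cV[R]_n) (xi0 : nat -> R -> 'cV[R]_n).
Context (fG : forall x w, U w -> f x w = G (x, w)).
Context (uU : forall t, - r <= t -> U (u t)) (utu : {ae mu, forall t : R, - r <= t -> ut t = u t}).
Context (r0 : 0 < r) (p0 : (0 < p)%N) (m0 : 0 < mu0) (gap : forall i, tau i.+1 - tau i <= B).
Context (x z : R -> 'cV[R]_n) (xi : nat -> R -> 'cV[R]_n).

Let d := p%:R^-1 * r.
Let A i := if i is j.+1 then H *m x (tau i - r) + v (tau i) else w0.

Context (lx : lip_loc x 0) (xx0 : forall t, - r <= t <= 0 -> x t = x0 t).
Context (dx : {ae mu, forall t : R, 0 < t -> is_derive t 1 x (rhs 0 x t)}).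
Context (cz : continuous z) (lz : lip_loc z 0) (zz0 : z 0 = z0).
Context (dz : {ae mu, forall t : R, 0 < t -> is_derive t 1 z
   (rhs (- r) z t + K *m (H *m z t - sampled tau_part H A r z t))}).
Context (xi0z : xi 0%N = z) (xi0E : forall i, (1 <= i <= p)%N -> forall t, - r <= t <= 0 -> xi i t = xi0 i t).
Context (link : forall i, exists y, chain_link d mu0 (i.+1%:R * d - r) y (xi i) (xi i.+1)).

Let w := sampled tau_part H A r z.

Lemma ae_rhs c (y : R -> 'cV[R]_n) : 
  {ae mu, forall t, - r <= t + c -> rhs c y t = f (y t) (u (t + c))}.
Proof.
apply: ae_sub (ae_shift c utu) => t E tc.
by rewrite /rhs E // fG //; exact: uU.
Qed.

Lemma ae_pos (Q : R -> Prop) : {ae mu, forall t : R, 0 < t -> Q t} ->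
  {ae mu, forall t : R, 0 <= t -> Q t}.
Proof.
have h0 : {ae mu, forall t : R, t != 0}.
  by apply: (negligibleS _ (negligible_set1 0)) => t /= /negP; rewrite negbK => /eqP.
move=> h; apply: ae_sub (ae_and h0 h) => t [tn0 Qt] t0.
by apply: Qt; rewrite lt_neqAle eq_sym tn0.
Qed.

Let d0 : 0 < d.
Proof. by rewrite /d mulr_gt0 // invr_gt0 ltr0n. Qed.

Let pd : p%:R * d = r.
Proof. by rewrite /d mulrA divff ?mul1r // pnatr_eq0 -lt0n. Qed.

(** Translates the equation of the system into the Borel one on [0, c[. The function yc is a
    continuous extension of y that makes the window integrable, and agreement of the predecessors
    near t gives equal derivatives. *)
Lemma ae_predictor_rhs i (prev prev' y yc : R -> 'cV[R]_n) (c : \bar R) : (0 < i)%N ->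
  continuous yc -> (forall t, - d <= t -> (t%:E < c)%E -> yc t = y t) ->
  (forall t, 0 < t -> (t%:E < c)%E -> prev' t = prev t) ->
  {ae mu, forall t : R, 0 < t -> (t%:E < c)%E ->
    predictor_rhs f r p mu0 u i prev' y t = rhs (i%:R * d - r) y t - rhs (i%:R * d - r) y (t - d) +
       derive1 prev t - mu0 *: (y t - prev t - prim (t - d) (rhs (i%:R * d - r) yc) t)}.
Proof.
move=> i0 cyc ycE pE; set ci := i%:R * d - r.
(* For i >= 1 the delayed argument t - d + i d - r is at least - r, so the input is evaluated where
   it is given. *)
have di : d <= i%:R * d by rewrite ler_peMl ?(ltW d0) // ler1n.
have h1 := ae_rhs ci y; have h2 := ae_shift (- d) h1; have h3 := ae_rhs ci yc.
apply: ae_sub (ae_and h1 h2) => t [H1 H2] t0 tc.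
rewrite /predictor_rhs -/d.
have e1 : t - r + i%:R * d = t + ci by rewrite /ci; ring.
have e2 : t - r + (i%:R - 1) * d = t - d + ci by rewrite /ci; ring.
rewrite e1 e2 -H1 -?H2; last 2 first.
- by rewrite /ci; have := r0; have := d0; lra.
- by rewrite /ci; have := r0; have := d0; lra.
have E1 : derive1 prev' t = derive1 prev t.
  have : \forall s \near t, prev' s = prev s.
    have [e e0 eP] : exists2 e, 0 < e & forall s, `|s - t| < e -> prev' s = prev s.
      case: c tc ycE pE => [c| |] //= tc ycE pE.
        rewrite lte_fin in tc.
        exists (Num.min t (c - t)) => [|s]; first by rewrite lt_min t0 subr_gt0.
        rewrite lt_min => /andP[]; rewrite !ltr_norml => /andP[a1 a2] /andP[a3 a4].
        by apply: pE; rewrite ?lte_fin; have := r0; have := d0; lra.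
      exists t => // s; rewrite ltr_norml => /andP[a1 a2].
      by apply: pE; rewrite ?ltry //; have := r0; have := d0; lra.
    apply/nbhs_ballP; exists e => // s /= se; apply: eP.
    by rewrite distrC.
  by move=> ne; rewrite !derive1E; exact: near_eq_derive.
have E2 : vec_integral (t - d) t (fun s => f (y s) (u (s - r + i%:R * d))) = prim (t - d) (rhs ci yc) t.
  apply: vec_integral_borel; [exact: rhs_borel|exact: rhs_loc_bounded|].
  apply: ae_sub h3 => s H3 /andP[ds st].
  rewrite H3; last by rewrite /ci; have := r0; have := d0; lra.
  have -> : s - r + i%:R * d = s + ci by rewrite /ci; ring.
  rewrite ycE //; first by have := d0; lra.
  by apply: le_lt_trans tc; rewrite lee_fin.
by rewrite E1 E2 (pE t t0 tc).
Qed.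

Lemma realization_solution : is_solution f K H r p mu0 tau z0 w0 u v x0 xi0 +oo x z w xi.
Proof.
have tS := tauS tau_part.
have wt i : w (tau i) = A i by rewrite /w (sampledE _ _ _ _ _ (lexx _) (tS i)) subrr mulmx0 addr0.
have bz := rhs_borel (- r) cz; have lbz := rhs_loc_bounded (- r) cz.
split.
- split => //; by rewrite -(tau0 tau_part) wt.
- split.
  + by move=> c _ _; exact: lip_loc_abs_cont.
  + by move=> c _ _; exact: lip_loc_abs_cont.
  + move=> i c ic; rewrite lt_min => /andP[]; rewrite lte_fin => ci _.
    have la : lip_loc (fun t => A i + H *m (prim 0 (rhs (- r) z) t - prim 0 (rhs (- r) z) (tau i))) (tau i).
      apply: lip_locD; first exact: lip_loc_cst.
      by apply: lip_loc_mulmx; apply: lip_locB; [exact: lip_loc_prim|exact: lip_loc_cst].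
    move=> e e0; have [de de0 deP] := lip_loc_abs_cont c la e0.
    exists de; first exact: de0.
    move=> N l h lh lt sm.
    have -> : \sum_(j < N) enorm (w (h j) - w (l j)) = \sum_(j < N)
      enorm (A i + H *m (prim 0 (rhs (- r) z) (h j) - prim 0 (rhs (- r) z) (tau i)) -
        (A i + H *m (prim 0 (rhs (- r) z) (l j) - prim 0 (rhs (- r) z) (tau i)))).
      apply: eq_bigr => j _; have [l1 l2 l3] := lh j; rewrite /w.
      have h1 := le_trans l1 l2; have h2 := le_lt_trans l3 ci; have h3 := le_lt_trans l2 h2.
      by rewrite (sampledE tau_part H A r z h1 h2) (sampledE tau_part H A r z l1 h3).
    exact: deP.
  + move=> [|i] // _ c _ _; have [y [_ _ ly _ _]] := link i; exact: lip_loc_abs_cont.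
- split.
  + apply: ae_pos; apply: ae_sub (ae_and dx (ae_rhs 0 x)) => t [Hd Hr] t0 _.
    by move: (Hd t0); rewrite Hr addr0 //; have := r0; have := d0; lra.
  + apply: ae_pos; apply: ae_sub (ae_and dz (ae_rhs (- r) z)) => t [Hd Hr] t0 _.
    by move: (Hd t0); rewrite Hr //; have := r0; have := d0; lra.
  + have dw := is_derive_sampled tau_part H A r cz.
    apply: ae_pos; apply: ae_sub (ae_and dw (ae_rhs (- r) z)) => t [Hd Hr] t0 _.
    by move: (Hd t0); rewrite Hr //; have := r0; have := d0; lra.
- by move=> i _; rewrite wt.
- move=> [|i] // _; have [y [cxi _ _ _ dxi]] := link i.
  have -> : (if i.+1 == 1%N then z else xi i.+1.-1) = xi i.
    by case: i {y cxi dxi} => //=; rewrite xi0z.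
  have hr := @ae_predictor_rhs i.+1 (xi i) (xi i) (xi i.+1) (xi i.+1) +oo%E isT cxi
    (fun _ _ _ => erefl) (fun _ _ _ => erefl).
  apply: ae_pos; apply: ae_sub (ae_and dxi hr) => t [Hd Hr] t0 tc.
  move: (Hd t0); rewrite (Hr t0 tc) window_prim //; exact: ltW.
Qed.

(** Every comparison is made on [0, c] with c below T, where the competing components are absolutely
    continuous. The order is x, then z and w, whose samples need x, then the predictors. *)
Lemma realization_unique (T : \bar R) x' z' w' xi' : (0 < T)%E ->
  is_solution f K H r p mu0 tau z0 w0 u v x0 xi0 T x' z' w' xi' ->
  agree_before p T x z w xi x' z' w' xi'.
Proof.
move=> T0 [[hx hxi hz hw] [ax az aw axi] [dx' dz' dw'] jump dxi'].
have oz c : 0 <= c -> (c%:E < T)%E -> forall t, 0 <= t <= c -> x' t = x t.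
  move=> c0 cT; apply: state_unique => //; [exact: lip_loc_abs_cont|exact: ax| |].
    by rewrite hx ?xx0 // lexx oppr_le0 ltW.
  apply: ae_sub (ae_and dx' (ae_rhs 0 x')) => t [Hd Hr] /andP[t0 tc].
  rewrite Hr ?addr0; last by have := r0; lra.
  by apply: Hd; [exact: ltW|apply: lt_trans cT; rewrite lte_fin].
have xr t : - r <= t -> (t%:E < T)%E -> x' t = x t.
  move=> rt tT; have [t0|/ltW t0] := leP t 0; first by rewrite hx ?xx0 ?rt.
  by apply: (oz t) => //; rewrite lexx t0.
have zw c : 0 <= c -> (c%:E < T)%E -> forall t, 0 <= t <= c -> z' t = z t /\ w' t = w t.
  move=> c0 cT; apply: (observer_unique gap c0 cz lz dz).
  - by rewrite hz zz0.
  - exact: az.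
  - move=> i t it ti tc; apply: aw => //.
    by rewrite lt_min lte_fin ti; apply: le_lt_trans cT; rewrite lee_fin.
  - case=> [_|i ic]; first by rewrite (tau0 tau_part).
    have iT : ((tau i.+1)%:E < T)%E by apply: le_lt_trans cT; rewrite lee_fin.
    rewrite jump // xr //; first by have := tau_ge0 tau_part i.+1; have := r0; have := d0; lra.
    by apply: lt_trans iT; rewrite lte_fin; have := r0; have := d0; lra.
  - apply: ae_sub (ae_and dz' (ae_rhs (- r) z')) => t [Hd Hr] /andP[t0 tc].
    rewrite Hr; last by have := r0; lra.
    by apply: Hd; [exact: ltW|apply: lt_trans cT; rewrite lte_fin].
  - apply: ae_sub (ae_and dw' (ae_rhs (- r) z')) => t [Hd Hr] /andP[t0 tc].
    rewrite Hr; last by have := r0; lra.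
    by apply: Hd; [exact: ltW|apply: lt_trans cT; rewrite lte_fin].
pose prev' i := if i == 1%N then z' else xi' i.-1.
(* Induction along the chain: once the competing predecessor is identified, its derivative may be
   replaced and both predictors solve the same equation. Index 0 is the observer. *)
have xie i : (i <= p)%N -> forall c, 0 <= c -> (c%:E < T)%E -> forall t, 0 <= t <= c ->
    prev' i.+1 t = xi i t.
  elim: i => [_|i IH ip] c c0 cT t tc.
    by rewrite xi0z; have [] := zw c c0 cT t tc.
  rewrite /prev' /=; have [y [cxi _ lxi _ dxi]] := link i.
  have ip' : (1 <= i.+1 <= p)%N by [].
  have dr : d <= r by rewrite -pd ler_peMl ?(ltW d0) // ler1n.
  have init s : - d <= s <= 0 -> xi' i.+1 s = xi i.+1 s.
    move=> /andP[ds s0]; have rs : - r <= s <= 0 by rewrite s0 andbT; have := r0; have := d0; lra.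
    by rewrite hxi // xi0E.
  have ac : abs_cont 0 c (xi' i.+1) by apply: axi.
  have nd0 : - d <= 0 by rewrite oppr_le0 ltW.
  have [xc cxc xcE] := extension_continuous c0 cxi init ac nd0.
  have ih s : 0 < s -> (s%:E < c%:E)%E -> prev' i.+1 s = xi i s.
    rewrite lte_fin => s0 sc; apply: (IH (ltnW ip) c c0 cT).
    by rewrite !ltW.
  have hr := @ae_predictor_rhs i.+1 (xi i) (prev' i.+1) (xi' i.+1) xc c%:E isT cxc
    (fun s ds sc => xcE s (introT andP (conj ds (ltW sc)))) ih.
  apply: (predictor_unique d0 m0 c0 cxi lxi init ac cxc xcE dxi) => //.
  apply: ae_sub (ae_and (dxi' i.+1 ip') hr) => s [Hd Hr] /andP[s0 sc].
  rewrite -Hr //; apply: Hd; first exact: ltW.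
  by apply: lt_trans cT; rewrite lte_fin.
move=> t t0 tT; have t1 : 0 <= t <= t by rewrite t0 lexx.
have [zt wt] := zw t t0 tT t t1; split => //; first exact: (oz t).
by move=> [|i] // ip; exact: (xie i.+1 _ t).
Qed.

End Realization.

End Borel_system.


(** * Norms and bounds of the data *)

Section Data.
Context {R : realType}.
Notation mu := (@lebesgue_measure R).

(** The essential supremum is shown to be non-negative and finite, so [fine] does not replace it by
    its default value. *)
Lemma Linfty_normP m (D : set R) (U : set 'cV[R]_m) (u : R -> 'cV[R]_m) : Linfty D U u ->
  0 <= Linfty_norm D u /\ {ae mu, forall t, D t -> enorm (u t) <= Linfty_norm D u}.
Proof.
move=> [_ _ [M MP]]; rewrite /Linfty_norm; set g := fun t => _.
have g0 : (0 <= ess_sup mu g)%E.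
  have muT := @lebesgue_measure_itv R `]-oo, +oo[; rewrite set_itvNyy in muT.
  apply: ess_sup_gee; first by rewrite [X in (_ < X)%E]muT /= addye ?ltry.
  by apply: nearW => t; rewrite /g; case: ifP => // _; rewrite lee_fin enorm_ge0.
have gM : (ess_sup mu g <= (Num.max M 0)%:E)%E.
  apply/ess_supP; apply: ae_sub MP => t tM; rewrite /g; case: ifPn => tD.
    by rewrite lee_fin le_max (tM (set_mem tD)).
  by rewrite lee_fin le_max lexx orbT.
have gf : ess_sup mu g \is a fin_num.
  by rewrite ge0_fin_numE //; apply: le_lt_trans gM _; rewrite ltry.
split; first exact: fine_ge0.
apply: ae_sub (ess_sup_ge mu g) => t tg tD; rewrite -lee_fin fineK //.
by apply: le_trans tg; rewrite /g mem_set.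
Qed.

(** The Borel representative is reset to us wherever it exceeds the essential supremum, so the bound
    holds at every time; this reset is the origin of the maximum with |us|. *)
Lemma bounded_representative m (r : R) (U : set 'cV[R]_m) (us : 'cV[R]_m) (u : R -> 'cV[R]_m) :
  U us -> Linfty `[- r, +oo[ U u -> exists ut, [/\ borel_fun ut, (forall t, U (ut t)),
    (forall t, enorm (ut t) <= Num.max (Linfty_norm `[- r, +oo[ u) (enorm us)) &
    {ae mu, forall t : R, - r <= t -> ut t = u t}].
Proof.
move=> Uus Lu; have [N0 uN] := Linfty_normP Lu; have [uU um _] := Lu.
have [g [bg _ Ug gu]] := borel_representative Uus (measurable_itv `[- r, +oo[) uU um.
set N := Linfty_norm _ _ in N0 uN *.
have mN : measurable_fun [set: R] (fun t => enorm (g t) <= N).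
  apply: measurable_fun_ler => //; rewrite /enorm.
  apply: (measurableT_comp (f := @Num.sqrt R)).
    by apply: continuous_measurable_fun; exact: sqrt_continuous.
  by apply: measurable_sum => i; apply: measurable_funX; exact: bg.
exists (fun t => if enorm (g t) <= N then g t else us); split.
- move=> j; rewrite (_ : (fun t => _) = fun t => if enorm (g t) <= N then g t j 0 else us j 0).
    by apply: measurable_fun_ifT => //; exact: bg.
  by apply/funext => t; case: ifP.
- by move=> t; case: ifP.
- by move=> t; case: ifP => h; rewrite le_max ?h ?lexx ?orbT.
- apply: ae_sub (ae_and uN gu) => t [H1 H2] rt.
  have Dt : `[- r, +oo[%classic t by rewrite /= in_itv /= rt.
  by rewrite (H2 Dt) (H1 Dt).
Qed.

Lemma continuous_section (V W T : topologicalType) (G : V * W -> T) a :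
  continuous G -> continuous (fun w => G (a, w)).
Proof.
move=> cG w; have c2 : {for w, continuous (fun w => (a, w))}.
  have h1 : (fun=> a) @ nbhs w --> nbhs a by exact: cvg_cst.
  exact: (cvg_pair h1 cvg_id).
exact: (@continuous_comp _ _ _ (fun w => (a, w)) G _ c2 (cG _)).
Qed.

(** Taking the supremum over the ball makes the bound non-decreasing, as Q requires; the radius is
    at least s0 to include the substitute value us. *)
Lemma ball_bound n m (g : 'cV[R]_m -> 'cV[R]_n) (s0 : R) : continuous g -> 0 <= s0 ->
  exists Fb : R -> R, [/\ forall s, 0 <= Fb s, {homo Fb : s s' / s <= s'} &
    forall s w, enorm w <= Num.max s s0 -> enorm (g w) <= Fb s].
Proof.
move=> cg s00; pose E s := [set enorm (g w) | w in [set w | enorm w <= Num.max s s0]].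
have Eub s : has_ubound (E s).
  by have [M MP] := bounded_on_ball cg (Num.max s s0); exists M => _ [w /MP wM <-].
have E0 s : E s (enorm (g 0)).
  by exists 0 => //=; rewrite enorm0 le_max s00 orbT.
exists (fun s => sup (E s)); split.
- by move=> s; apply: le_trans (enorm_ge0 (g 0)) _; exact: ub_le_sup.
- move=> s s' ss; apply: ge_sup; first by exists (enorm (g 0)).
  move=> _ [w /= ws <-]; apply: ub_le_sup => //; exists w => //=; apply: (le_trans ws).
  by rewrite ge_max !le_max ss lexx orbT.
- by move=> s w ws; apply: ub_le_sup => //; exists w.
Qed.

Lemma sup_norm_ge n (a b : R) (y : R -> 'cV[R]_n) : a <= b -> {within `[a, b], continuous y} ->
  forall t, a <= t <= b -> enorm (y t) <= sup_norm `[a, b] y.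
Proof.
move=> ab /(continuous_comp_clamp ab) cy t tab.
have [M _ MP] := loc_bounded_itv a b (continuous_loc_bounded cy).
apply: ub_le_sup; last by exists t => //=; rewrite in_itv.
exists M => _ [s sab <-]; rewrite /= in_itv /= in sab; have := MP s sab.
by rewrite clampE.
Qed.

Lemma sup_norm_ge0 n (a b : R) (y : R -> 'cV[R]_n) : a <= b -> {within `[a, b], continuous y} ->
  0 <= sup_norm `[a, b] y.
Proof.
move=> ab cy; apply: le_trans (enorm_ge0 (y a)) _; apply: sup_norm_ge => //.
by rewrite lexx.
Qed.

Lemma summand_le (a b c d e g : R) : 0 <= a -> 0 <= b -> 0 <= c -> 0 <= d -> 0 <= e -> 0 <= g ->
  let S := a + b + c + d + e + g in
  [/\ a <= S, b <= S, c <= S, d <= S & (e <= S) /\ (g <= S)].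
Proof. by move=> ? ? ? ? ? ? S; split; [| | | |split]; rewrite /S; lra. Qed.

Lemma le_sum_nat (F : nat -> R) (a b i : nat) : (forall j, (a <= j < b)%N -> 0 <= F j) ->
  (a <= i < b)%N -> F i <= \sum_(a <= j < b) F j.
Proof.
move=> F0 iab; rewrite (bigD1_seq i) ?mem_index_iota ?iota_uniq //= lerDl.
by rewrite big_seq_cond; apply: sumr_ge0 => j; rewrite mem_index_iota => /andP[/F0].
Qed.

End Data.

Unset Implicit Arguments.

Theorem theorem3p4 (R : realType) (n m k : nat) (hn : (0 < n)%N)
    (U : set 'cV[R]_m) (hU : U !=set0)
    (f : 'cV[R]_n -> 'cV[R]_m -> 'cV[R]_n)
    (f_smooth : smooth_on ([set: 'cV[R]_n] `*` U) (fun a => f a.1 a.2))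
    (L : R) (hL : 0 < L)
    (f_lip : forall (x z : 'cV[R]_n) (u : 'cV[R]_m), U u ->
       enorm (f x u - f z u) <= L * enorm (x - z))
    (P : 'M[R]_n) (hP : sym_posdef P) (q : R) (hq : 0 < q)
    (K : 'M[R]_(n, k)) (H : 'M[R]_(k, n))
    (hobs : forall (x z : 'cV[R]_n) (u : 'cV[R]_m), U u ->
       bilin P (z - x) (f z u - f x u) + bilin (P *m K *m H) (z - x) (z - x)
       <= - q * enorm (z - x) ^+ 2)
    (r : R) (hr : 0 < r) :
  forall (p : nat) (mu b B : R),
    (0 < p)%N -> L * r < p%:R -> 0 < mu -> 0 < b -> b <= B ->
    L * opnorm H * (Num.sqrt (opnorm (K^T *m P *m P *m K)) / q)
      * Num.sqrt (opnorm P / min_sphere P) * B < 1 ->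
  exists (Q : R -> R) (sigma Gamma : R),
    [/\ (forall s, 0 <= s -> 0 <= Q s),
        (forall s s', 0 <= s -> s <= s' -> Q s <= Q s'),
        0 < sigma, 0 < Gamma &
  forall (tau : nat -> R),
    is_partition tau ->
    (forall i, tau i.+1 - tau i <= B) ->
    (forall i, b <= tau i.+1 - tau i) ->
  forall (z0 : 'cV[R]_n) (w0 : 'cV[R]_k) (u : R -> 'cV[R]_m)
         (v : R -> 'cV[R]_k) (x0 : R -> 'cV[R]_n) (xi0 : nat -> R -> 'cV[R]_n),
    Linfty `[- r, +oo[ U u ->
    Linfty_loc `[0, +oo[ setT v ->
    {within `[- r, 0], continuous x0} ->
    (forall i, (1 <= i <= p)%N -> {within `[- r, 0], continuous (xi0 i)}) ->
  exists (x z : R -> 'cV[R]_n) (w : R -> 'cV[R]_k) (xi : nat -> R -> 'cV[R]_n),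
    is_unique_global_solution f K H r p mu tau z0 w0 u v x0 xi0 x z w xi /\
    forall t : R, 0 <= t ->
      has_ubound [set enorm (v s) | s in `[0, t]] ->
      enorm (xi p t - x t) <=
        expR (- sigma * t)
          * Q (sup_norm `[- r, 0] x0
               + \sum_(1 <= i < p.+1) sup_norm `[- r, 0] (xi0 i)
               + Linfty_norm `[- r, +oo[ u + enorm z0 + enorm w0
               + sup [set enorm (v s) | s in `[0, t]])
        + Gamma * sup [set expR (- sigma * (t - s)) * enorm (v s)
                      | s in `[0, t]]].
Proof.
move=> p mu0 b B p0 Lp m0 b0 bB gain.
have B0 : 0 < B := lt_le_trans b0 bB.
pose d := p%:R^-1 * r.
have pr0 : 0 < p%:R :> R by rewrite ltr0n.
have d0 : 0 < d by rewrite mulr_gt0 // invr_gt0.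
have pd : p%:R * d = r by rewrite /d mulrA divff ?mul1r // gt_eqF.
have dr : d <= r by rewrite -pd ler_peMl ?(ltW d0) // ler1n.
have Ld : L * d < 1 by rewrite /d mulrCA mulrC ltr_pdivrMr // mul1r.
have [ms0 msP] := min_sphereP hn hP.
have pn0 : 0 < opnorm P := lt_le_trans ms0 (min_sphere_le_opnorm hn hP).
have [sg [sg0 sgk sgm th1 th2]] := decay_rate hq pn0 ms0 m0 gain Ld.
(* The smooth extension is defined on the whole space, so continuity arguments need no topology on
   U; on U it inherits the inequalities assumed of f. *)
have [G Gc Gf] := f_smooth.
have cG : continuous G by have [] := Gc 0%N.
have fG x w : U w -> f x w = G (x, w) by move=> Uw; exact: (Gf (x, w) (conj I Uw)).
have lipG x z w : U w -> enorm (G (x, w) - G (z, w)) <= L * enorm (x - z).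
  by move=> Uw; rewrite -!fG //; exact: f_lip.
have obsG x z w : U w -> bilin P (z - x) (G (z, w) - G (x, w)) +
    bilin (P *m K *m H) (z - x) (z - x) <= - q * enorm (z - x) ^+ 2.
  by move=> Uw; rewrite -!fG //; exact: hobs.
have [us Uus] := hU.
have cg : continuous (fun w => G (0, w)).
  exact: continuous_section.
have [Fb [Fb0 Fbm FbP]] := ball_bound cg (enorm_ge0 us).
(* After T0 every window [t - d, t] and the last sampling time lie beyond r,
   where x is only evaluated at nonnegative times. *)
pose T0 := 2 * r + B.
have T0B : r + B <= T0 by rewrite /T0; lra.
have rT0 : r <= T0 by rewrite /T0; lra.
have T0d : r + d <= T0 by rewrite /T0; lra.
have T00 : 0 <= T0 by rewrite /T0; lra.
pose M0 := Num.sqrt (opnorm (K^T *m P *m P *m K)).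
pose S := Num.sqrt (opnorm P / min_sphere P).
pose cb := Num.sqrt (q * (q / opnorm P - 2 * sg) * min_sphere P)^-1.
pose theta := M0 * expR (sg * B) * opnorm H * L * B * cb.
pose theta' := L * d * expR (sg * d).
pose gg i := growth_gain L K H B d T0 i.
pose sG := state_gain L T0.
pose E := expR (sg * T0).
(* The recursion of [chain_decay] is linear and solved by D i = al i N + be i V. Only be multiplies
   the measurement error, hence it determines the constant Gamma. *)
pose al := fix al i := if i is j.+1 then
    (E * (gg i + sG) + al j + offset_gain L d (gg j)) / (1 - theta')
  else ((1 + S) * (E * (gg i + sG))) / (1 - theta).
pose be i := M0 * expR (sg * B) * cb / (1 - theta) / (1 - theta') ^+ i.
have gg0 i : 0 <= gg i by apply: growth_gain_ge0 => //; exact: ltW.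
have sG1 : 1 <= sG := state_gain_ge1 hL T00.
have sG0 : 0 <= sG := le_trans ler01 sG1.
have M00 : 0 <= M0 := sqrtr_ge0 _.
have S0 : 0 <= S := sqrtr_ge0 _.
have cb0 : 0 <= cb := sqrtr_ge0 _.
have E0 : 0 <= E := expR_ge0 _.
have t10 : 0 <= (1 - theta)^-1 by rewrite invr_ge0 subr_ge0 ltW.
have t20 : 0 <= (1 - theta')^-1 by rewrite invr_ge0 subr_ge0 ltW.
have hE i : 0 <= E * (gg i + sG) by rewrite mulr_ge0 // addr_ge0.
have al0 i : 0 <= al i.
  elim: i => [|i IH]; apply: mulr_ge0 => //.
    by apply: mulr_ge0; [exact: addr_ge0|exact: hE].
  apply: addr_ge0; last by apply: offset_gain_ge0 => //; exact: ltW.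
  by apply: addr_ge0 => //; exact: hE.
have be0 i : 0 <= be i.
  by rewrite /be -exprVn mulr_ge0 ?exprn_ge0 // !mulr_ge0 ?expR_ge0.
(* The first term serves times after T0, the second times before, where E = exp(sg T0) pays for the
   factor exp(- sg t). *)
pose Cc := al p + E * (gg p + sG).
have Cc0 : 0 <= Cc by rewrite addr_ge0 // mulr_ge0 // addr_ge0.
(* Adding 1 keeps Gamma positive even if be p vanishes, for instance when K = 0. *)
exists (fun s => Cc * (s + Fb s)), sg, (be p + 1); split => //.
- by move=> s s0; rewrite mulr_ge0 // addr_ge0.
- by move=> s s' s0 ss; rewrite ler_wpM2l // lerD // Fbm.
- by rewrite ltr_wpDl.
move=> tau tauP gap _ z0 w0 u v x0 xi0 uL vL cx0 cxi0.
have [uU _ _] := uL.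
have uU' t : - r <= t -> U (u t) by move=> rt; apply: uU; rewrite /= in_itv /= rt.
have [nu0 _] := Linfty_normP uL.
have [ut [but Uut utb utu]] := bounded_representative Uus uL.
set nu := Linfty_norm _ u in nu0 utb.
have hF t : enorm (G (0, ut t)) <= Fb nu by apply: FbP; exact: utb.
have nr0 : - r <= 0 by rewrite oppr_le0 ltW.
pose x0c t := x0 (clamp (- r) 0 t).
have cx0c : continuous x0c by exact: continuous_comp_clamp.
have clamp0 t : 0 <= t -> clamp (- r) 0 t = clamp (- r) 0 0.
  by move=> t0; rewrite /clamp (min_idPr t0) minxx.
have [x [cx xN lx dx]] := state_solution cG hL lipG but Uut hF cx0c (fun t t0 => congr1 x0 (clamp0 t t0)).
pose A i := if i is j.+1 then H *m x (tau i - r) + v (tau i) else w0.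
have [z [cz zz0 lz dz]] := observer_solution cG hL lipG but Uut hF tauP K H A r z0 gap.
(* The chain runs over all indices, while initial functions are given for 1 to p; the others start
   from 0. Within the range, the data are frozen outside [-r, 0]. *)
pose xi0c i t := if (1 <= i <= p)%N then xi0 i (clamp (- r) 0 t) else 0.
have cxi0c i : continuous (xi0c i).
  case ip : (1 <= i <= p)%N; last first.
    rewrite (_ : xi0c i = fun=> 0); first by move=> t; exact: cvg_cst.
    by apply/funext => t; rewrite /xi0c ip.
  rewrite (_ : xi0c i = fun t => xi0 i (clamp (- r) 0 t)).
    by apply: continuous_comp_clamp => //; exact: cxi0.
  by apply/funext => t; rewrite /xi0c ip.
have ddz : {ae @lebesgue_measure R, forall t : R, 0 < t -> derivable z t 1}.
  by apply: ae_sub dz => t Hd t0; have h := Hd t0; exact: ex_derive.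
have xi0cc i t : 0 <= t -> xi0c i t = xi0c i 0 by move=> t0; rewrite /xi0c clamp0.
have [xi [xi0z link]] := chain_solution cG hL lipG but Uut hF
  (fun i => i%:R * d - r) d0 m0 cxi0c xi0cc lz ddz.
have xx0 t : - r <= t <= 0 -> x t = x0 t.
  by move=> rt; have /andP[_ t0] := rt; rewrite xN // /x0c clampE.
have xi0E i : (1 <= i <= p)%N -> forall t, - r <= t <= 0 -> xi i t = xi0 i t.
  case: i => // i ip t rt; have [_ xiN _ _ _] := link i; have /andP[_ t0] := rt.
  by rewrite xiN // /xi0c ip clampE.
have link' i : exists y, chain_link G ut d mu0 (i.+1%:R * d - r) y (xi i) (xi i.+1).
  by exists (xi0c i.+1); exact: link.
exists x, z, (sampled G ut tauP H A r z), xi; split.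
  split.
    exact: (realization_solution cG hL lipG but Uut hF
      fG uU' utu hr p0 lx xx0 dx cz lz zz0 dz xi0z xi0E link').
  move=> T x' z' w' xi' T0' sol.
  exact: (realization_unique cG hL lipG but Uut hF fG uU' utu hr p0 m0 gap
    lx xx0 dx cz lz zz0 dz xi0z xi0E link' T0' sol).
move=> t t0 vub.
set vsup := sup [set enorm (v s) | s in `[0, t]].
set W := sup [set expR _ * _ | s in _].
set Sg := _ + vsup.
pose N := Sg + Fb Sg.
have vle s : 0 <= s <= t -> enorm (v s) <= vsup.
  by move=> st; apply: ub_le_sup => //; exists s => //=; rewrite in_itv.
have vs0 : 0 <= vsup by apply: le_trans (enorm_ge0 (v 0)) (vle _ _); rewrite lexx.
(* The weights are at most 1 on [0, t], so the assumed bound on |v| also bounds the weighted set and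
   its supremum is a true one. *)
have Wle s : 0 <= s <= t -> expR (- sg * (t - s)) * enorm (v s) <= W.
  move=> st; apply: ub_le_sup; last by exists s => //=; rewrite in_itv.
  have [M MP] := vub; exists M => _ [y yt <-]; rewrite /= in_itv /= in yt.
  apply: le_trans (MP (enorm (v y)) _); last by exists y => //=; rewrite in_itv.
  rewrite ler_piMl ?enorm_ge0 // -[leRHS]expR0 ler_expR mulNr oppr_le0.
  by rewrite mulr_ge0 ?(ltW sg0) // subr_ge0; case/andP: yt.
have W0 : 0 <= W.
  by apply: le_trans (Wle 0 _); rewrite ?lexx ?t0 // mulr_ge0 ?expR_ge0 ?enorm_ge0.
have sx0 := sup_norm_ge0 nr0 cx0.
have sxi0 i : (1 <= i < p.+1)%N -> 0 <= sup_norm `[- r, 0] (xi0 i).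
  by move=> ip; apply: sup_norm_ge0 => //; exact: cxi0.
have ssum : 0 <= \sum_(1 <= i < p.+1) sup_norm `[- r, 0] (xi0 i).
  rewrite big_seq_cond; apply: sumr_ge0 => i; rewrite mem_index_iota andbT; exact: sxi0.
have z00 := enorm_ge0 z0; have w00 := enorm_ge0 w0.
have [Sx Sxi nuS Sz [Sw Sv]] := summand_le sx0 ssum nu0 z00 w00 vs0.
rewrite -/Sg in Sx Sxi nuS Sz Sw Sv.
have Sg0 : 0 <= Sg := le_trans vs0 Sv.
have SgN : Sg <= N by rewrite lerDl.
have FN : Fb nu <= N.
  by apply: (le_trans (Fbm _ _ nuS)); rewrite lerDr.
have N0 : 0 <= N := le_trans (Fb0 _) FN.
have hx y : - r <= y <= 0 -> enorm (x y) <= N.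
  move=> ry; rewrite xx0 //; apply: le_trans SgN.
  exact: le_trans (sup_norm_ge nr0 cx0 ry) Sx.
have hz : enorm (z 0) <= N by rewrite zz0; exact: le_trans SgN.
have hA : enorm (A 0%N) <= N by exact: le_trans SgN.
have hxi0 i y : - d <= y <= 0 -> enorm (xi0c i y) <= N.
  move=> /andP[dy y0]; have ry : - r <= y <= 0 by rewrite y0 (le_trans _ dy) // lerN2.
  rewrite /xi0c; case: ifP => ip; last by rewrite enorm0.
  rewrite clampE //; apply: le_trans SgN; apply: (le_trans (sup_norm_ge nr0 (cxi0 i ip) ry)).
  exact: le_trans (le_sum_nat sxi0 ip) Sxi.
have hv c : c <= t -> forall i, tau i <= c -> enorm (v (tau i)) <= N.
  move=> ct i ic; apply: le_trans SgN; apply: le_trans Sv; apply: vle.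
  by rewrite tau_ge0 //= (le_trans ic).
have AS i : A i.+1 = H *m x (tau i.+1 - r) + v (tau i.+1) by [].
(* Up to T0 the linear growth bounds suffice: exp(- sg t) E >= 1 there. *)
have [tT0|/ltW T0t] := leP t T0.
  have gr := chain_growth (vs := fun i => v (tau i)) (cs := fun i => i%:R * d - r)
    cG hL lipG but Uut hF gap hr d0 m0 t0 tT0 FN lx dx hx cz lz hz dz hA AS
    (hv t (lexx _)) xi0z link hxi0 cxi0c.
  have h1 : enorm (xi p t) <= gg p * N by apply: gr; rewrite t0 lexx.
  have h2 : enorm (x t) <= sG * N.
    have hx0 : enorm (x 0) <= N by apply: hx; rewrite lexx nr0.
    apply: (le_trans (state_growth hL lipG Uut hF t0 FN lx hx0 dx _)).
      by rewrite t0 lexx.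
    by rewrite ler_wpM2r // state_gain_mono.
  have h3 : enorm (xi p t - x t) <= (gg p + sG) * N.
    by rewrite mulrDl; apply: (le_trans (enormD _ _)); rewrite enormN; exact: lerD.
  have G1 : 0 <= (be p + 1) * W by rewrite mulr_ge0 // addr_ge0.
  apply: (le_trans h3); rewrite -[leLHS]addr0; apply: lerD => //.
  rewrite -/N mulrA ler_wpM2r //.
  have e1 : 1 <= expR (- sg * t) * E.
    by rewrite /E -expRD -[leLHS]expR0 ler_expR mulNr addrC -mulrBr mulr_ge0 ?(ltW sg0) // subr_ge0.
  have e2 : gg p + sG <= expR (- sg * t) * (E * (gg p + sG)).
    by rewrite mulrA ler_peMl // addr_ge0.
  by apply: (le_trans e2); rewrite ler_wpM2l ?expR_ge0 // lerDr.
(* W carries the weight exp(-sg (t - s)), the decay lemma exp(sg s); they differ by exp(sg t), which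
   cancels against exp(- sg t) at the end. *)
pose V := expR (sg * t) * W.
have V0 : 0 <= V by rewrite mulr_ge0 ?expR_ge0.
have vV i : (0 < i)%N -> tau i <= t -> expR (sg * tau i) * enorm (v (tau i)) <= V.
  move=> _ it; have := Wle (tau i) _; rewrite tau_ge0 //= it => /(_ isT) h.
  apply: le_trans (ler_wpM2l (expR_ge0 (sg * t)) h); rewrite mulrA -expRD.
  by rewrite le_eqVlt; apply/orP; left; apply/eqP; congr (expR _ * _); ring.
pose D i := al i * N + be i * V.
have D0 : D 0%N = ((1 + S) * (expR (sg * T0) * (gg 0%N + sG) * N) +
    M0 * expR (sg * B) * V * cb) / (1 - theta).
  by rewrite /D /be /= expr0 divr1 -/E; ring.
have DS i : D i.+1 = (expR (sg * T0) * (gg i.+1 + sG) * N + D i + offset_gain L d (gg i) * N) / (1 - theta').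
  rewrite /D /be exprSr invfM /= -/E; ring.
have := chain_decay (vs := fun i => v (tau i))
  cG hL lipG but Uut hF hn hP hq obsG gap hr d0 pd sgm FN cx lx dx hx cz lz hz
  dz hA AS (hv T0 T0t) xi0z link hxi0 cxi0c sg0 sgk th1 th2 T0B T0d T0t V0 vV D0 DS (leqnn p).
have rt : r <= t <= t by rewrite lexx (le_trans rT0).
move=> /(_ t rt); rewrite pd subrr addr0 => /weight_le h; apply: (le_trans h).
rewrite /D mulrDr; apply: lerD.
  by rewrite ler_wpM2l ?expR_ge0 // ler_wpM2r // lerDl mulr_ge0 // addr_ge0.
by rewrite /V mulrCA [_ * (_ * W)]mulrA expN_weight mul1r ler_wpM2r // lerDl.
Qed.
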